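(* The threshold constant $\lambda_c$ of the three-dimensional Ohta-Kawasaki energy (defined in the context) satisfies $$\frac{3}{4\sqrt[3]{2}}\le\lambda_c\le\frac{3}{2\sqrt[3]{5}}.$$
   Context: $\mathbb T_\ell$ is the flat three-dimensional torus of sidelength $\ell>0$. For $\lambda>0$ and small $\varepsilon>0$ let $\bar u_\varepsilon=-1+\lambda\varepsilon^{2/3}$ and $$\mathcal E_\varepsilon(u)=\int_{\mathbb T_\ell}\left(\frac{\varepsilon^2}{2}|\nabla u|^2+W(u)+\frac12(u-\bar u_\varepsilon)(-\Delta)^{-1}(u-\bar u_\varepsilon)\right)dx,\qquad W(u)=\frac14(1-u^2)^2,$$ for $u\in H^1(\mathbb T_\ell)$ with $\ell^{-3}\int_{\mathbb T_\ell}u\,dx=\bar u_\varepsilon$, where $(-\Delta)^{-1}f$ is the zero-average solution $v$ of $-\Delta v=f$. The constant $\lambda_c>0$ is the universal constant (independent of $\ell,\lambda$) such that, for minimizers $u_\varepsilon$ of $\mathcal E_\varepsilon$ and measures $d\mu_\varepsilon=\frac12\varepsilon^{-2/3}(1+\mathrm{sgn}\,u_\varepsilon)\,dx$, one has, weakly as measures on $\mathbb T_\ell$ as $\varepsilon\to0$: $\mu_\varepsilon\rightharpoonup0$ if $\lambda\le\lambda_c$, and $\mu_\varepsilon\rightharpoonup\frac12(\lambda-\lambda_c)\,dx$ if $\lambda>\lambda_c$. The paper defines this constant explicitly by $\lambda_c:=2^{-1/3}\sigma^{2/3}\kappa^2f^*$, where $\sigma=\int_{-1}^1\sqrt{2W(s)}\,ds$,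 $\kappa=1/\sqrt{W''(1)}$ for $W(u)=\frac14(1-u^2)^2$, and $$f^*=\inf_{\chi}\frac{\widetilde E_\infty(\chi)}{\int_{\mathbb R^3}\chi\,dx},\qquad \widetilde E_\infty(\chi)=\int_{\mathbb R^3}|\nabla\chi|\,dx+\frac1{8\pi}\int_{\mathbb R^3}\int_{\mathbb R^3}\frac{\chi(x)\chi(y)}{|x-y|}\,dx\,dy,$$ the infimum being over all $\chi\in BV(\mathbb R^3;\{0,1\})$ with $\int_{\mathbb R^3}\chi\,dx>0$ (here $\int|\nabla\chi|$ is the total variation). *)

(* Defs.v *)
From HB Require Import structures.
From mathcomp Require Import all_boot all_order all_algebra.
From mathcomp Require Import all_classical all_reals all_analysis.

Set Implicit Arguments.
Unset Strict Implicit.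
Unset Printing Implicit Defensive.

Import Order.TTheory GRing.Theory Num.Theory.
Import numFieldNormedType.Exports.

Local Open Scope classical_set_scope.
Local Open Scope ring_scope.

(* The library norm on R * R * R is the max norm: it is used only for the
   topology. Lengths and distances are measured with [eucl] below. *)
Notation R3 R := (R * R * R)%type.

Section Space.
Variable R : realType.

Definition vol3 : {measure set (R3 (measurableTypeR R)) -> \bar R} :=
  ((@lebesgue_measure R \x @lebesgue_measure R) \x @lebesgue_measure R)%E.

Definition eucl (x : R3 R) : R :=
  Num.sqrt (x.1.1 ^+ 2 + x.1.2 ^+ 2 + x.2 ^+ 2).

Definition e1 : R3 R := (1, 0, 0).
Definition e2 : R3 R := (0, 1, 0).
Definition e3 : R3 R := (0, 0, 1).

Definition C1 (f : R3 R -> R) : Prop :=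
  forall e, e = e1 \/ e = e2 \/ e = e3 ->
    (forall x, derivable f x e) /\ continuous (fun x => 'D_e f x).

Definition div3 (phi : R3 R -> R3 R) (x : R3 R) : R :=
  'D_e1 (fun y => (phi y).1.1) x + 'D_e2 (fun y => (phi y).1.2) x
  + 'D_e3 (fun y => (phi y).2) x.

Definition test_field (phi : R3 R -> R3 R) : Prop :=
  [/\ C1 (fun y => (phi y).1.1) /\ C1 (fun y => (phi y).1.2)
        /\ C1 (fun y => (phi y).2),
      compact (closure [set x | phi x != 0]) &
      forall x, eucl (phi x) <= 1].

Definition TV3 (chi : R3 R -> R) : \bar R :=
  ereal_sup [set (\int[vol3]_x (chi x * div3 phi x)%:E)%E
            | phi in test_field].

(* Borel representatives: every class in BV(R^3; {0,1}) contains a Borel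
   function with values in {0,1}, and all the functionals here depend only on
   the class. *)
Definition BV01 (chi : R3 R -> R) : Prop :=
  [/\ forall x, chi x = 0 \/ chi x = 1,
      vol3.-integrable setT (EFin \o chi) &
      (TV3 chi < +oo)%E].

(* On the diagonal x = y, which is negligible, the integrand is 0 because
   0^-1 = 0. *)
Definition coulomb (chi : R3 R -> R) : \bar R :=
  (\int[vol3]_x \int[vol3]_y (chi x * chi y / eucl (x - y))%:E)%E.

Definition E_infty (chi : R3 R -> R) : \bar R :=
  (TV3 chi + ((8 * pi)^-1)%:E * coulomb chi)%E.

Definition mass (chi : R3 R -> R) : \bar R := (\int[vol3]_x (chi x)%:E)%E.

Definition f_star : \bar R :=
  ereal_inf [set (E_infty chi / mass chi)%E
            | chi in [set chi | BV01 chi /\ (0 < mass chi)%E]].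

Definition W (u : R) : R := 4^-1 * (1 - u ^+ 2) ^+ 2.

Definition sigma : R :=
  \int[@lebesgue_measure R]_(s in `[(-1 : R), 1]) Num.sqrt (2 * W s).

Definition kappa : R := (Num.sqrt ((W^`(2))%classic 1))^-1.

Definition lambda_c : \bar R :=
  ((2 `^ (- 3^-1) * sigma `^ (2 / 3) * kappa ^+ 2)%:E * f_star)%E.

End Space.

Arguments lambda_c : clear implicits.

(* Main.v *)
Require Import Defs.
From HB Require Import structures.
From mathcomp Require Import all_boot all_order all_algebra.
From mathcomp Require Import all_classical all_reals all_analysis.
From mathcomp Require Import measurable_realfun ring lra.

Set Implicit Arguments.
Unset Strict Implicit.
Unset Printing Implicit Defensive.

Import Order.TTheory GRing.Theory Num.Theory.
Import numFieldNormedType.Exports.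

Local Open Scope classical_set_scope.
Local Open Scope ring_scope.

(** The prefactor of [f_star] in [lambda_c] is [18 `^ (- 3^-1)] ([prefactorE]),
so the two bounds amount to [(243/64)^(1/3) <= f_star <= (243/20)^(1/3)].

Upper bound. The ball of radius [r] has mass [4/3 pi r^3], perimeter at most
[4 pi r^2] and Coulomb energy [32/15 pi^2 r^5], so its energy per unit mass is
at most [3/r + r^2/5]; the minimum over [r] is attained at [r^3 = 15/2].  The
perimeter is bounded by integrating by parts against a radial cut-off
([flux_ball_le]), and the Coulomb energy comes from the Newtonian potential
[2 pi (r^2 - |x|^2/3)] of the ball ([ball_potential]).

Lower bound. The heart is the interpolation inequality
[isoperimetric_coulomb]: for every length [r],
  [4 pi V <= 28/45 pi r P + 4/r^2 D],
where [V], [P], [D] are the mass, the perimeter and the Coulomb energy of a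
set.  Consider the field [K z = z / |z|^3 * max (1 - |z|^2/r^2) 0 ^ 2].  Its
divergence is [4 pi] times a Dirac mass at the origin, minus a nonnegative
function which is at most [4 / (r^2 |z|)].  Convolving [K] with the indicator
[chi] gives a field whose flux through the set is therefore at least
[4 pi V - 4/r^2 D].  On the other hand this flux is at most [P] times the
supremum of [|K * chi|].  As [K] is odd, [chi] may be replaced by [chi - 1/2]
in this convolution, and so the supremum is at most half the integral of the
modulus of one component of [K], which is at most [56/45 pi r]
([integral_abs_ker_le]).  Taking [r = 45/(7 Q)] with [Q^3 = 243/64] turns the
inequality into [Q V <= P + D / (8 pi)].

Two regularizations make this rigorous.  The singularity of [K] is removed by
replacing [|z|^2] with [|z|^2 + e^2] in the radial factor, which spreads the
Dirac mass over a small ball ([div_ker], [conv_core_ge]).  The indicator is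
replaced by a compactly supported continuous density [G], for which
the convolution is a legitimate [C1] test field ([test_field_potential]) and
the limit [e -> 0] only needs uniform continuity
([mollified_lower_bound]).  Finally [G] tends to [chi] in the mean
([BV01_approximation]), which the Coulomb term tolerates because the potential
of a set of finite mass is bounded ([coulomb2_le]). *)

(** * Lebesgue measure in space: Tonelli, shears and rotations *)

Section SigmaFiniteProduct.
Context d1 d2 (T1 : measurableType d1) (T2 : measurableType d2) (R : realType).
Variables (m1 : {sigma_finite_measure set T1 -> \bar R})
          (m2 : {sigma_finite_measure set T2 -> \bar R}).
Local Open Scope ereal_scope.

(** A copy of the product measure that carries a sigma-finite structure, so that
Tonelli's theorem can be applied once more to a product of products. *)
Definition sfprod : set (T1 * T2) -> \bar R := (m1 \x m2).

HB.instance Definition _ := Measure.copy sfprod (m1 \x m2).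

Let sfprod_sigma_finite : sigma_finite setT sfprod.
Proof.
have /sigma_finiteP[F [TF ndF Foo]] := sigma_finiteT m1.
have /sigma_finiteP[G [TG ndG Goo]] := sigma_finiteT m2.
exists (fun n => F n `*` G n) => [|k].
  rewrite -setXTT TF TG predeqE => -[x y]; split.
    move=> [/= [n _ Fnx] [k _ Gky]]; exists (maxn n k) => //; split.
    - by move: x Fnx; exact/subsetPset/ndF/leq_maxl.
    - by move: y Gky; exact/subsetPset/ndG/leq_maxr.
  by move=> [n _ []/= ? ?]; split; exists n.
have [? ?] := Foo k; have [? ?] := Goo k.
split; first exact: measurableX.
by rewrite /sfprod product_measure1E// lte_mul_pinfty// ge0_fin_numE.
Qed.

HB.instance Definition _ := Measure_isSigmaFinite.Build _ _ _ sfprod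
  sfprod_sigma_finite.

End SigmaFiniteProduct.

Section Space.
Context {R : realType}.
Notation T3 := (R3 (measurableTypeR R)).
Notation mu := (@lebesgue_measure R).
Notation leb2 := (sfprod mu mu).
Notation leb3 := (sfprod leb2 mu).

Lemma measurable_x1 : measurable_fun setT (fun x : T3 => x.1.1).
Proof. exact: (measurableT_comp measurable_fst measurable_fst). Qed.

Lemma measurable_x2 : measurable_fun setT (fun x : T3 => x.1.2).
Proof. exact: (measurableT_comp measurable_snd measurable_fst). Qed.

Lemma measurable_x3 : measurable_fun setT (fun x : T3 => x.2).
Proof. exact: measurable_snd. Qed.

(** Boxes with rational endpoints form a countable base of the topology. *)
Lemma open_measurable3 (U : set (R3 R)) : open U -> measurable (U : set T3).
Proof.
move=> oU.
pose bx (b : (rat * rat) * (rat * rat) * (rat * rat)) : set T3 :=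
  [set x : T3 | (x.1.1 \in `]ratr b.1.1.1, ratr b.1.1.2[) /\
    (x.1.2 \in `]ratr b.1.2.1, ratr b.1.2.2[) /\
    (x.2 \in `]ratr b.2.1, ratr b.2.2[)].
have mbx b : measurable (bx b).
  have -> : bx b = ((`]ratr b.1.1.1, ratr b.1.1.2[%classic `*`
                   `]ratr b.1.2.1, ratr b.1.2.2[%classic) `*`
                   `]ratr b.2.1, ratr b.2.2[%classic : set T3).
    by apply/seteqP; split => x /=; rewrite /bx /=; tauto.
  by apply: measurableX; [apply: measurableX|]; exact: measurable_itv.
have -> : (U : set T3) =
    \bigcup_b (if pselect (bx b `<=` U) then bx b else set0).
  apply/seteqP; split => x /=; last first.
    by case=> b _; case: pselect => // h; exact: h.
  move=> Ux; have : nbhs x U by rewrite nbhsE; exists U.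
  rewrite -nbhs_ballE => -[e /= e0 xU].
  have H (s : R) : exists ab : rat * rat, (s \in `]ratr ab.1, ratr ab.2[) /\
      forall y, (y \in `]ratr ab.1, ratr ab.2[) -> `|s - y| < e.
    have h1 : s - e < s by rewrite gtrBl.
    have h2 : s < s + e by rewrite ltrDl.
    have [q1 /[!in_itv] /= /andP[q1l q1r]] := rat_in_itvoo h1.
    have [q2 /[!in_itv] /= /andP[q2l q2r]] := rat_in_itvoo h2.
    exists (q1, q2); rewrite !in_itv /= q1r q2l; split=> // y.
    by rewrite in_itv /= ltr_distlC => /andP[/(lt_trans q1l) -> /lt_trans ->].
  have [ab1 [ab1x ab1e]] := H x.1.1.
  have [ab2 [ab2x ab2e]] := H x.1.2.
  have [ab3 [ab3x ab3e]] := H x.2.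
  exists (ab1, ab2, ab3) => //; case: pselect => [h|[]]; first by split.
  by move=> y /= [/ab1e y1 [/ab2e y2 /ab3e y3]]; apply: xU.
apply: countable_bigcupT_measurable => [|b]; first exact: countableP.
by case: pselect => [h|h] /=; [exact: mbx|exact: measurable0].
Qed.

Lemma continuous_measurable3 (f : R3 R -> R) : continuous f ->
  measurable_fun setT (f : T3 -> R).
Proof.
move=> cf; apply: (measurability _ (RGenOpens.measurableE R)).
move=> _ [_ [a [b ->] <-]]; rewrite setTI; apply: open_measurable3.
by apply: open_comp; [move=> x _; exact: cf | exact: interval_open].
Qed.

Lemma integral_vol3E (f : T3 -> \bar R) :
  (\int[vol3 R]_x f x = \int[leb3]_x f x)%E.
Proof. by []. Qed.

Lemma tonelli3 (f : T3 -> \bar R) : measurable_fun [set: T3] f ->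
  (forall x, 0 <= f x)%E ->
  (\int[vol3 R]_x f x =
   \int[mu]_a \int[mu]_b \int[mu]_c f (a, b, c))%E.
Proof.
move=> mf f0; rewrite integral_vol3E.
have h1 := @fubini_tonelli1 _ _ _ _ _ leb2 mu f mf f0.
rewrite h1.
have mF := @measurable_fun_fubini_tonelli_F _ _ _ _ _ mu f mf f0.
have h2 := @fubini_tonelli1 _ _ _ _ _ mu mu (fubini_F mu f) mF.
apply: h2.
by move=> x; apply: integral_ge0.
Qed.

Definition swap12 (x : T3) : T3 := (x.1.2, x.1.1, x.2).
Definition swap23 (x : T3) : T3 := (x.1.1, x.2, x.1.2).

Lemma measurable_swap12 : measurable_fun [set: T3] swap12.
Proof.
apply: measurable_fun_pair; last exact: measurable_x3.
by apply: measurable_fun_pair; [exact: measurable_x2|exact: measurable_x1].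
Qed.

Lemma measurable_swap23 : measurable_fun [set: T3] swap23.
Proof.
apply: measurable_fun_pair; last exact: measurable_x2.
by apply: measurable_fun_pair; [exact: measurable_x1|exact: measurable_x3].
Qed.

Lemma integral_swap12 (f : T3 -> \bar R) : measurable_fun [set: T3] f ->
  (forall x, 0 <= f x)%E ->
  (\int[vol3 R]_x f (swap12 x) = \int[vol3 R]_x f x)%E.
Proof.
move=> mf f0; rewrite (tonelli3 mf f0).
have mfs := measurableT_comp mf measurable_swap12.
rewrite (tonelli3 mfs (fun x => f0 (swap12 x))).
pose g (x : measurableTypeR R * measurableTypeR R) := (\int[mu]_c f (x.1, x.2, c))%E.
have mg : measurable_fun [set: measurableTypeR R * measurableTypeR R] g.
  have := @measurable_fun_fubini_tonelli_F _ _ _ _ _ mu f mf f0.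
  by apply: eq_measurable_fun => -[a b] _.
have g0 x : (0 <= g x)%E by apply: integral_ge0.
have /esym h := @fubini_tonelli _ _ _ _ _ mu mu g mg g0.
exact: h.
Qed.

Lemma integral_swap23 (f : T3 -> \bar R) : measurable_fun [set: T3] f ->
  (forall x, 0 <= f x)%E ->
  (\int[vol3 R]_x f (swap23 x) = \int[vol3 R]_x f x)%E.
Proof.
move=> mf f0; rewrite (tonelli3 mf f0).
have mfs := measurableT_comp mf measurable_swap23.
rewrite (tonelli3 mfs (fun x => f0 (swap23 x))).
apply: eq_integral => a _.
pose g (x : measurableTypeR R * measurableTypeR R) := (f (a, x.1, x.2))%E.
have mg : measurable_fun [set: measurableTypeR R * measurableTypeR R] g.
  apply: (measurableT_comp mf); apply: measurable_fun_pair; last exact: measurable_snd.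
  by apply: measurable_fun_pair; [exact: measurable_cst|exact: measurable_fst].
have g0 x : (0 <= g x)%E by exact: f0.
have /esym h := @fubini_tonelli _ _ _ _ _ mu mu g mg g0.
exact: h.
Qed.

Lemma integral_preserved_signed (s : T3 -> T3) :
  (forall f : T3 -> \bar R, measurable_fun [set: T3] f -> (forall x, 0 <= f x)%E ->
    (\int[vol3 R]_x f (s x) = \int[vol3 R]_x f x)%E) ->
  forall f : T3 -> \bar R, measurable_fun [set: T3] f ->
    (\int[vol3 R]_x f (s x) = \int[vol3 R]_x f x)%E.
Proof.
move=> hs f mf; rewrite [LHS]integralE [RHS]integralE; congr (_ - _)%E.
  rewrite -[RHS](hs _ (measurable_funepos mf)); last exact: funepos_ge0.
  by apply: eq_integral => x _; rewrite funepos.unlock.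
rewrite -[RHS](hs _ (measurable_funeneg mf)); last exact: funeneg_ge0.
by apply: eq_integral => x _; rewrite funeneg.unlock.
Qed.

Lemma lebesgue_measure_shift (c : R) (A : set (measurableTypeR R)) : measurable A ->
  mu A = mu ((fun x => x + c) @^-1` A).
Proof.
have ms : measurable_fun [set: measurableTypeR R] (fun x : measurableTypeR R => x + c : measurableTypeR R).
  by apply: measurable_funD; [exact: measurable_id|exact: measurable_cst].
move=> mA.
pose nu := pushforward mu (fun x : measurableTypeR R => x + c : measurableTypeR R).
have -> // : mu A = nu A.
apply: (lebesgue_measure_unique (mu := nu)) => // _ [[a b] _ <-].
transitivity (mu `]a - c, b - c]%classic); last first.
  congr (mu _); apply/seteqP; split=> x /=; rewrite !in_itv /= ltrBlDr lerBrDr //.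
rewrite !lebesgue_measure_itv /= !lte_fin ltrD2r.
by case: ifPn => // _; rewrite -!EFinB; congr EFin; ring.
Qed.

Lemma integral_shift (c : R) (f : measurableTypeR R -> \bar R) :
  measurable_fun [set: measurableTypeR R] f -> (forall x, 0 <= f x)%E ->
  (\int[mu]_x f (x + c)%R = \int[mu]_x f x)%E.
Proof.
move=> mf f0.
have ms : measurable_fun [set: measurableTypeR R] (fun x : measurableTypeR R => x + c : measurableTypeR R).
  by apply: measurable_funD; [exact: measurable_id|exact: measurable_cst].
have h := @ge0_integral_pushforward _ _ _ _ _ _ ms mu setT f measurableT mf (fun y _ => f0 y).
rewrite preimage_setT in h; rewrite -[LHS]h.
by apply: eq_measure_integral => A mA _; exact: (esym (lebesgue_measure_shift c mA)).
Qed.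

Definition shear23 (t : R) (x : T3) : T3 := (x.1.1, x.1.2, x.2 + t * x.1.2).

Lemma measurable_shear23 t : measurable_fun [set: T3] (shear23 t).
Proof.
apply: measurable_fun_pair.
  by apply: measurable_fun_pair; [exact: measurable_x1|exact: measurable_x2].
apply: measurable_funD; first exact: measurable_x3.
by apply: measurable_funM; [exact: measurable_cst|exact: measurable_x2].
Qed.

Lemma integral_shear23 t (f : T3 -> \bar R) : measurable_fun [set: T3] f ->
  (forall x, 0 <= f x)%E ->
  (\int[vol3 R]_x f (shear23 t x) = \int[vol3 R]_x f x)%E.
Proof.
move=> mf f0; rewrite (tonelli3 mf f0).
have mfs := measurableT_comp mf (measurable_shear23 t).
rewrite (tonelli3 mfs (fun x => f0 (shear23 t x))).
apply: eq_integral => a _; apply: eq_integral => b _.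
apply: (@integral_shift (t * b) (fun c => f (a, b, c))) => //.
apply: (measurableT_comp mf); apply: measurable_fun_pair; last exact: measurable_id.
by apply: measurable_fun_pair; exact: measurable_cst.
Qed.

Definition shear32 (t : R) (x : T3) : T3 := swap23 (shear23 t (swap23 x)).

Lemma measurable_shear32 t : measurable_fun [set: T3] (shear32 t).
Proof.
apply: (measurableT_comp measurable_swap23).
exact: (measurableT_comp (measurable_shear23 t) measurable_swap23).
Qed.

Lemma integral_shear32 t (f : T3 -> \bar R) : measurable_fun [set: T3] f ->
  (forall x, 0 <= f x)%E ->
  (\int[vol3 R]_x f (shear32 t x) = \int[vol3 R]_x f x)%E.
Proof.
move=> mf f0; rewrite -[RHS](integral_swap23 mf f0).
have m1 := measurableT_comp mf measurable_swap23.
rewrite -[RHS](integral_shear23 t m1 (fun x => f0 (swap23 x))).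
have m2 := measurableT_comp m1 (measurable_shear23 t).
by rewrite -[RHS](integral_swap23 m2 (fun x => f0 (swap23 (shear23 t x)))).
Qed.

Definition rot23 (a b : R) (x : T3) : T3 :=
  (x.1.1, a * x.1.2 + b * x.2, - b * x.1.2 + a * x.2).

Lemma measurable_rot23 a b : measurable_fun [set: T3] (rot23 a b).
Proof.
have mlin (c d : R) : measurable_fun [set: T3] (fun x : T3 => c * x.1.2 + d * x.2).
  by apply: measurable_funD; apply: measurable_funM;
    [exact: measurable_cst|exact: measurable_x2|exact: measurable_cst|exact: measurable_x3].
apply: measurable_fun_pair; last exact: mlin.
by apply: measurable_fun_pair; [exact: measurable_x1|exact: mlin].
Qed.

(** A rotation by an angle in the closed right half-circle is the product of three
shears, with slopes [t], [-b], [t], where [t] is the tangent of half the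
angle; each shear is a translation on every line of its direction. *)
Lemma integral_rot23 (a b : R) (f : T3 -> \bar R) : 0 <= a -> a ^+ 2 + b ^+ 2 = 1 ->
  measurable_fun [set: T3] f -> (forall x, 0 <= f x)%E ->
  (\int[vol3 R]_x f (rot23 a b x) = \int[vol3 R]_x f x)%E.
Proof.
move=> a0 ab mf f0; pose t := b / (1 + a).
have a1 : 1 + a != 0 by rewrite lt0r_neq0// ltr_wpDr.
have bt : b * t = 1 - a.
  rewrite /t mulrA; apply: (canLR (mulfK a1)); rewrite -expr2.
  by apply: (addrI (a ^+ 2)); rewrite ab; ring.
have tt : t + t * a = b by rewrite -{1}(mulr1 t) -mulrDr /t divfK.
have E x : rot23 a b x = shear32 t (shear23 (- b) (shear32 t x)).
  rewrite /rot23 /shear32 /shear23 /swap23 /=; congr (_, _, _).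
    have -> : x.1.2 + t * x.2 + t * (x.2 + - b * (x.1.2 + t * x.2)) =
     (1 - b * t) * x.1.2 + (t + t * (1 - b * t)) * x.2 by ring.
    by rewrite bt (_ : 1 - (1 - a) = a) ?tt//; ring.
  have -> : x.2 + - b * (x.1.2 + t * x.2) = - b * x.1.2 + (1 - b * t) * x.2 by ring.
  by rewrite bt; ring.
under eq_integral do rewrite E.
have m1 := measurableT_comp mf (measurable_shear32 t).
have m2 := measurableT_comp m1 (measurable_shear23 (- b)).
rewrite -[RHS](integral_shear32 t mf f0).
rewrite -[RHS](integral_shear23 (- b) m1 (fun x => f0 _)).
by rewrite -[RHS](integral_shear32 t m2 (fun x => f0 _)).
Qed.
End Space.

(** * One-variable calculus *)

Section Calculus.
Context {R : realType}.
Notation mu := (@lebesgue_measure R).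
Implicit Types (f F : R -> R) (a b x : R).

Lemma is_derive_continuous F x l : is_derive x 1 F l -> {for x, continuous F}.
Proof.
by move=> h; apply/differentiable_continuous/derivable1_diffP; exact: ex_derive.
Qed.

Lemma der_derivable F x l : is_derive x 1 F l -> derivable F x 1.
Proof. by move=> h; exact: ex_derive. Qed.

Lemma der_derive1 F x l : is_derive x 1 F l -> derive1 F x = l.
Proof. by move=> h; rewrite derive1E derive_val. Qed.

Lemma ftc F f a b : a <= b ->
  (forall x, a <= x <= b -> is_derive x 1 F (f x)) ->
  {within `[a, b], continuous f} ->
  (\int[mu]_(x in `[a, b]) (f x)%:E = (F b - F a)%:E)%E.
Proof.
rewrite le_eqVlt => /predU1P[<- _ _|ab dF cf].
  by rewrite set_itv1 integral_set1 subrr.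
rewrite (@continuous_FTC2 _ f F)//.
  split => [x /[!in_itv] /= /andP[ax xb]||].
  - by have := dF x; rewrite !ltW// => /(_ isT) h; exact: ex_derive.
  - apply: cvg_at_right_filter; apply: is_derive_continuous (dF _ _).
    by rewrite lexx ltW.
  - apply: cvg_at_left_filter; apply: is_derive_continuous (dF _ _).
    by rewrite lexx ltW.
move=> x /[!in_itv] /= /andP[ax xb].
have := dF x; rewrite !ltW// => /(_ isT) h.
by rewrite derive1E derive_val.
Qed.

Lemma isd_cst (c x : R) : is_derive x 1 (fun=> c) 0.
Proof. exact: is_derive_cst. Qed.

Lemma isd_id x : is_derive x 1 (fun t : R => t) 1.
Proof. exact: is_derive_id. Qed.

Lemma isd_add f F x (a b : R) : is_derive x 1 f a -> is_derive x 1 F b ->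
  is_derive x 1 (fun t => f t + F t) (a + b).
Proof. by move=> ? ?; exact: is_deriveD. Qed.

Lemma isd_opp f x (a : R) : is_derive x 1 f a ->
  is_derive x 1 (fun t => - f t) (- a).
Proof. by move=> ?; exact: is_deriveN. Qed.

Lemma isd_mul f F x (a b : R) : is_derive x 1 f a -> is_derive x 1 F b ->
  is_derive x 1 (fun t => f t * F t) (a * F x + f x * b).
Proof.
move=> h1 h2; apply: (is_derive_eq (is_deriveM h1 h2)).
by rewrite addrC /GRing.scale /= [F x * a]mulrC.
Qed.

Lemma isd_exp f n x (a : R) : is_derive x 1 f a ->
  is_derive x 1 (fun t => f t ^+ n) (n%:R * f x ^+ n.-1 * a).
Proof.
move=> h; have -> : (fun t => f t ^+ n) = f ^+ n by apply/funext => t; rewrite exprfctE.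
exact: (is_derive_eq (is_deriveX n h)).
Qed.

Lemma isd_comp f F x (a b : R) : is_derive x 1 f a -> is_derive (f x) 1 F b ->
  is_derive x 1 (fun t => F (f t)) (b * a).
Proof.
by move=> h1 h2; exact: is_derive1_comp h2 h1.
Qed.

Lemma isd_eq f x (a b : R) : is_derive x 1 f a -> a = b -> is_derive x 1 f b.
Proof. by move=> h <-. Qed.

End Calculus.

(** Differentiation driven by the syntax of the function: the value of the
derivative is left as an existential variable, to be compared afterwards with
the intended one by [ring] or [field]. *)
Ltac der := repeat match goal with
  | |- is_derive _ _ (fun _ => ?c) _ => notypeclasses refine (isd_cst c _)
  | |- is_derive _ _ (fun t => t) _ => notypeclasses refine (isd_id _)
  | |- is_derive _ _ (fun t => @GRing.add _ (@?f t) (@?g t)) _ =>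
      notypeclasses refine (@isd_add _ f g _ _ _ _ _)
  | |- is_derive _ _ (fun t => @GRing.opp _ (@?f t)) _ =>
      notypeclasses refine (@isd_opp _ f _ _ _)
  | |- is_derive _ _ (fun t => @GRing.mul _ (@?f t) (@?g t)) _ =>
      notypeclasses refine (@isd_mul _ f g _ _ _ _ _)
  | |- is_derive _ _ (fun t => @GRing.exp _ (@?f t) ?n) _ =>
      notypeclasses refine (@isd_exp _ f n _ _ _)
  | |- is_derive _ _ (fun t => sin t) _ => exact: is_derive_sin
  | |- is_derive _ _ (fun t => cos t) _ => exact: is_derive_cos
  end.

Ltac dereq := notypeclasses refine (isd_eq _ _); [der|].

Section SquaredPositivePart.
Context {R : realType}.
Notation mu := (@lebesgue_measure R).
Implicit Types (f F : R -> R) (a b x : R).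

(** At the origin the difference quotient is at most [|h|] in modulus. *)
Lemma is_derive_sqpos x :
  is_derive x 1 (fun t => (Num.max t 0) ^+ 2) (2 * Num.max x 0 : R).
Proof.
have [x0|x0|->] := ltgtP x 0.
- have h : is_derive x 1 (cst 0 : R -> R) (2 * 0) by rewrite mulr0; exact: is_derive_cst.
  apply: near_eq_is_derive h.
  by near=> y; rewrite max_r ?expr0n//; apply: ltW; near: y; exact: lt_nbhsl.
- have h : is_derive x 1 (fun t : R => t ^+ 2) (2 * x).
    by dereq; rewrite /=; ring.
  apply: near_eq_is_derive h.
  by near=> y; rewrite max_l//; apply: ltW; near: y; exact: lt_nbhsr.
- rewrite mulr0.
  have h : (fun h : R => h^-1 *: ((fun t => (Num.max t 0) ^+ 2) (h *: (1:R) + 0) - (Num.max 0 0 : R) ^+ 2)) @ 0^' --> (0 : R).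
    rewrite maxxx expr0n /= .
    apply/cvgr0Pnorm_lt => e e0; near=> h; rewrite subr0 addr0 scaler1.
    have h0 : h != 0 by near: h; exact: nbhs_dnbhs_neq.
    rewrite normrM normfV ltr_pdivrMl ?normr_gt0// normrX expr2.
    apply: (@le_lt_trans _ _ (`|h| * `|h|)).
      by rewrite ler_pM// ger0_norm ?le_max ?lexx ?orbT// ge_max ler_norm normr_ge0.
    rewrite ltr_pM2l ?normr_gt0//; near: h.
    by apply: dnbhs0_lt.
  split; first by apply/cvg_ex; exists 0.
  exact: cvg_lim h.
Unshelve. all: end_near. Qed.

End SquaredPositivePart.

(** * Radial integration in the plane, and cylindrical coordinates *)

Section HalfDisc.
Context {R : realType}.
Notation mu := (@lebesgue_measure R).
Implicit Types (f F : R -> R) (a b x : R).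

(** Substitute [x = r sin t]. *)
Lemma integral_half_disc (r : R) : 0 < r ->
  (\int[mu]_(x in `[(- r)%R, r]) (Num.sqrt (r ^+ 2 - x ^+ 2))%:E =
   (pi * r ^+ 2 / 2)%:E)%E.
Proof.
move=> r0; pose F t : R := r * sin t; pose p : R := pi / 2.
have p0 : - p <= p by rewrite ge0_cp//; apply/ltW/divr_gt0 => //; exact: pi_gt0.
have dF x : is_derive x 1 (fun t => r * sin t) (r * cos x).
  by dereq; rewrite /=; ring.

have F' : (derive1 F) = (fun x => r * cos x).
  by apply/funext => x; exact: (der_derive1 (dF x)).
have cF' : continuous (derive1 F).
  by rewrite F' => x; apply: cvgM; [exact: cvg_cst|exact: continuous_cos].
have FE : F p = r by rewrite /F sin_pihalf mulr1.
have FNE : F (- p) = - r by rewrite /F sinN sin_pihalf mulrN1.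
have h := @integration_by_substitution_increasing R F
  (fun x => Num.sqrt (r ^+ 2 - x ^+ 2)) (- p) p p0.
rewrite FE FNE in h; rewrite h.
- transitivity (\int[mu]_(x in `[(- p)%R, p]) (r ^+ 2 * cos x ^+ 2)%:E)%E.
    apply: eq_integral => x; rewrite inE /= in_itv /= => xp.
    rewrite F'; congr EFin.
    change (Num.sqrt (r ^+ 2 - (r * sin x) ^+ 2) * (r * cos x) = r ^+ 2 * cos x ^+ 2).
    have -> : r ^+ 2 - (r * sin x) ^+ 2 = (r * cos x) ^+ 2.
      by rewrite !exprMn sin2cos2; ring.
    rewrite sqrtr_sqr ger0_norm; first by ring.
    by apply: mulr_ge0; [exact: ltW|exact: cos_ge0_pihalf].
  have d1 x : - p <= x <= p ->
      is_derive x 1 (fun x => r ^+ 2 / 2 * (x + sin x * cos x)) (r ^+ 2 * cos x ^+ 2).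
    move=> _; dereq.
    transitivity (r ^+ 2 / 2 * (1 + (cos x ^+ 2 - sin x ^+ 2))).
      by rewrite /=; ring.
    by rewrite sin2cos2; field.
  rewrite (ftc p0 d1).
    by rewrite cosN sinN cos_pihalf sin_pihalf /p; congr EFin; field.
  apply: continuous_subspaceT => x; apply: cvgM; first exact: cvg_cst.
  by apply: cvgM; exact: continuous_cos.
- move=> x y; rewrite !in_itv /= => xp yp xy.
  by rewrite /F ltr_pM2l// ltr_sin// in_itv.
- by move=> x _; exact: cF'.
- by apply/cvg_ex; exists ((derive1 F) (- p)); apply: cvg_at_right_filter; exact: cF'.
- by apply/cvg_ex; exists ((derive1 F) p); apply: cvg_at_left_filter; exact: cF'.
- split=> [x _||].
  + exact: (der_derivable (dF x)).
  + by apply: cvg_at_right_filter; apply: is_derive_continuous (dF _).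
  + by apply: cvg_at_left_filter; apply: is_derive_continuous (dF _).
- apply: continuous_subspaceT => x; apply: continuous_comp; last exact: sqrt_continuous.
  by apply: cvgB; [exact: cvg_cst|exact: exprn_continuous].
Qed.

End HalfDisc.

Section Disc.
Context {R : realType}.
Notation mu := (@lebesgue_measure R).
Notation T1 := (measurableTypeR R).
Notation leb2 := (sfprod mu mu).

Definition sqnorm2 (x : T1 * T1) : T1 := x.1 ^+ 2 + x.2 ^+ 2.

Lemma measurable_sqnorm2 : measurable_fun [set: T1 * T1] sqnorm2.
Proof.
by apply: measurable_funD; apply: measurable_funX;
  [exact: measurable_fst|exact: measurable_snd].
Qed.

Lemma sq_lt_itv (w : R) : 0 < w ->
  [set y : T1 | y ^+ 2 < w] = `](- Num.sqrt w), (Num.sqrt w)[%classic.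
Proof.
move=> w0; apply/seteqP; split => y /=; rewrite in_itv /= -ltr_norml.
  by rewrite -sqrtr_sqr ltr_sqrt.
by rewrite -sqrtr_sqr ltr_sqrt.
Qed.

Lemma disc_area (s : R) : 0 <= s ->
  leb2 [set x | sqnorm2 x < s] = (pi * s)%:E.
Proof.
move=> s0.
have xs (x : T1) : mu (xsection [set x | sqnorm2 x < s] x) =
    (2 * Num.sqrt (s - x ^+ 2))%:E.
  have -> : xsection [set x | sqnorm2 x < s] x = [set y : T1 | y ^+ 2 < s - x ^+ 2].
    by apply/seteqP; split => y /=; rewrite /xsection /= inE /= /sqnorm2 /= ltrBrDl.
  have [w0|w0] := ltP 0 (s - x ^+ 2); last first.
    rewrite ler0_sqrtr// mulr0 [X in mu X](_ : _ = set0) ?measure0//.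
    by apply/seteqP; split => y //=; rewrite ltNge (le_trans w0)// sqr_ge0.
  rewrite sq_lt_itv// lebesgue_measure_itv /= lte_fin -EFinB.
  have : 0 < Num.sqrt (s - x ^+ 2) by rewrite sqrtr_gt0.
  set q := Num.sqrt _ => q0.
  by rewrite gtrN// ?q0; congr EFin; ring.
transitivity (\int[mu]_x (2 * Num.sqrt (s - x ^+ 2))%:E)%E.
  by apply: eq_integral => x _; exact: xs.
have [->|sn0] := eqVneq s 0.
  rewrite mulr0 integral0_eq// => x _.
  by rewrite ler0_sqrtr ?mulr0// sub0r oppr_le0 sqr_ge0.
have r0 : 0 < Num.sqrt s by rewrite sqrtr_gt0 lt0r sn0.
transitivity (\int[mu]_(x in `[(- Num.sqrt s)%R, Num.sqrt s]) (2 * Num.sqrt (s - x ^+ 2))%:E)%E.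
  rewrite integral_mkcond [RHS]integral_mkcond; apply: eq_integral => x _.
  rewrite !patchE in_setT; case: ifPn => //; rewrite notin_setE /= in_itv /= -ler_norml -sqrtr_sqr ler_sqrt// => /negP; rewrite -ltNge => sx.
  by rewrite ltr0_sqrtr ?mulr0// subr_lt0.
under eq_integral do rewrite EFinM.
rewrite ge0_integralZl//; last first.
  apply/measurable_EFinP; apply: measurable_funTS.
  apply: continuous_measurable_fun => x; apply: continuous_comp; last exact: sqrt_continuous.
  by apply: cvgB; [exact: cvg_cst|exact: exprn_continuous].
have := integral_half_disc r0; rewrite sqr_sqrtr// => ->.
by rewrite -EFinM; congr EFin; field.
Qed.

Let nng : measurable (`[0, +oo[%classic : set T1) := measurable_itv _.

Lemma integral_mrestr_nng (g : T1 -> \bar R) : measurable_fun [set: T1] g ->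
  (forall s, 0 <= g s)%E ->
  (\int[mrestr mu nng]_s g s = \int[mu]_(s in `[0%R, +oo[) g s)%E.
Proof.
move=> mg g0; rewrite -(setUv (`[0, +oo[%classic : set T1)).
rewrite ge0_integral_setU//; last 3 first.
- exact: measurableC.
- exact: measurable_funTS.
- exact/disj_setPCl.
rewrite [X in (_ + X)%E]null_set_integral ?adde0//.
- apply: eq_measure_integral => A mA Asub.
  by rewrite /mrestr/=; congr (mu _); exact/setIidPl.
- exact: measurableC.
- exact: measurable_funTS.
- change (mu (~` `[0, +oo[%classic `&` `[0, +oo[%classic) = 0%E).
  by rewrite setICl measure0.
Qed.

Let pi_nng : {nonneg R} := NngNum (pi_ge0 R).

(** Both sides are measures that agree on the half-lines [s < b], by the area of
a disc; these generate the Borel sets. *)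
Lemma pushforward_sqnorm2 (A : set T1) : measurable A ->
  pushforward leb2 sqnorm2 A = mscale pi_nng (mrestr mu nng) A.
Proof.
move=> mA.
pose nu : {measure set T1 -> \bar R} :=
  pushforward leb2 sqnorm2.
pose nu1 := nu measurable_sqnorm2.
pose G : set (set R) := @measurable_realfun.RGenInftyO.G R.
have GE : @measurable _ T1 = <<s G >> := measurable_realfun.RGenInftyO.measurableE R.
have GI : setI_closed G.
  move=> _ _ [x ->] [y ->]; exists (Num.min x y).
  by apply/seteqP; split=> t /=; rewrite !in_itv /= lt_min => /andP.
have Gk (k : nat) : G `]-oo, k%:R[%classic by exists k%:R.
have Gcov : \bigcup_k `]-oo, (k%:R : R)[%classic = setT.
  apply/seteqP; split => // t _; exists (Num.bound `|t|) => //=.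
  by rewrite in_itv /= (le_lt_trans (ler_norm _))// archi_boundP.
have nu1E (b : R) : nu1 `]-oo, b[%classic = (pi * Num.max b 0)%:E.
  have b0 : 0 <= Num.max b 0 by rewrite le_max lexx orbT.
  rewrite -(disc_area b0).
  congr (leb2 _); apply/seteqP; split=> x /=; rewrite in_itv /= lt_max.
    by move=> ->.
  by case/orP => //; rewrite ltNge addr_ge0// sqr_ge0.
have nu2E (b : R) : mscale pi_nng (mrestr mu nng) `]-oo, b[%classic = (pi * Num.max b 0)%:E.
  change (pi%:E * mu (`]-oo, b[%classic `&` `[0%R, +oo[%classic) = (pi * Num.max b 0)%:E)%E.
  rewrite EFinM; congr (_ * _)%E.
  have -> : `]-oo, b[%classic `&` `[0, +oo[%classic = `[0, b[%classic :> set R.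
    by apply/seteqP; split=> x /=; rewrite !in_itv /= andbT; [case=> -> ->|case/andP => -> ->].
  by rewrite lebesgue_measure_itv /= lte_fin; case: ltP => //; rewrite oppr0 adde0.
pose nu2 : {measure set T1 -> \bar R} := mscale pi_nng (mrestr mu nng).
have h1 B : G B -> nu1 B = nu2 B by move=> [b ->]; exact: etrans (nu1E b) (esym (nu2E b)).
have h2 k : (nu1 `]-oo, (k%:R : R)[%classic < +oo)%E by rewrite nu1E ltry.
exact: (@measure_unique _ _ T1 G (fun k : nat => `]-oo, (k%:R : R)[%classic) GE GI Gk Gcov
  nu1 nu2 h1 h2 A mA).
Qed.

Lemma integral_radial2 (g : T1 -> \bar R) : measurable_fun [set: T1] g ->
  (forall s, 0 <= g s)%E ->
  (\int[leb2]_x g (sqnorm2 x) = pi%:E * \int[mu]_(s in `[0%R, +oo[) g s)%E.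
Proof.
move=> mg g0.
have h := @ge0_integral_pushforward _ _ _ _ _ _ measurable_sqnorm2 leb2 setT g
  measurableT mg (fun y _ => g0 y).
rewrite preimage_setT in h; rewrite -[LHS]h -integral_mrestr_nng//.
rewrite -(@ge0_integral_mscale _ _ _ _ _ measurableT pi_nng)//.
apply: eq_measure_integral => [|m A mA _]; first exact: measurable_sqnorm2.
exact: (pushforward_sqnorm2 mA).
Qed.

Notation T3 := (R3 (measurableTypeR R)).

Lemma integral_cylindrical (h : T1 * T1 -> \bar R) : measurable_fun [set: T1 * T1] h ->
  (forall x, 0 <= h x)%E ->
  (\int[vol3 R]_x h (sqnorm2 x.1, x.2) =
   \int[mu]_z (pi%:E * \int[mu]_(s in `[0%R, +oo[) h (s, z)))%E.
Proof.
move=> mh h0; rewrite integral_vol3E.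
have mf : measurable_fun [set: T3] (fun x : T3 => h (sqnorm2 x.1, x.2)).
  apply: (measurableT_comp mh); apply: measurable_fun_pair; last exact: measurable_snd.
  exact: (measurableT_comp measurable_sqnorm2 measurable_fst).
rewrite (@fubini_tonelli2 _ _ _ _ _ leb2 mu _ mf)//.
apply: eq_integral => z _.
have mz : measurable_fun [set: T1] (fun s : T1 => h (s, z)).
  by apply: (measurableT_comp mh); exact: measurable_fun_pair.
exact: (integral_radial2 mz).
Qed.

End Disc.

(** * Mass and Coulomb energy of a ball *)

Section BallIntegrals.
Context {R : realType}.
Notation mu := (@lebesgue_measure R).
Notation T1 := (measurableTypeR R).
Notation T3 := (R3 (measurableTypeR R)).

Lemma measurable_ball_profile (rho : R) (f : T1 * T1 -> R) :
  measurable_fun [set: T1 * T1] f ->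
  measurable_fun [set: T1 * T1] (fun x : T1 * T1 =>
    (if (0 <= x.1) && (x.1 + x.2 ^+ 2 < rho) then f x else 0)%:E).
Proof.
move=> mf; apply/measurable_EFinP; apply: measurable_fun_ifT => //.
  apply: measurable_and.
    by apply: measurable_fun_ler; [exact: measurable_cst|exact: measurable_fst].
  apply: measurable_fun_ltr; last exact: measurable_cst.
  apply: measurable_funD; first exact: measurable_fst.
  by apply: measurable_funX; exact: measurable_snd.
Qed.

Lemma integral_itvco_closed (w : R) (f F : R -> R) : 0 <= w ->
  (forall x, 0 <= x <= w -> is_derive x 1 F (f x)) ->
  {within `[0, w], continuous f} ->
  (\int[mu]_(s in `[0%R, w[) (f s)%:E = (F w - F 0)%:E)%E.
Proof.
move=> w0 dF cf; rewrite -(ftc w0 dF cf) integral_itv_bndo_bndc//.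
apply/measurable_EFinP; apply: (@measurable_funS _ _ _ _ `[0, w]%classic) => //.
  by move=> x /=; rewrite !in_itv /= => /andP[-> /ltW ->].
exact: subspace_continuous_measurable_fun.
Qed.

Lemma integral_ball_slice (rho z : R) (f : T1 * T1 -> R) :
  (\int[mu]_(s in `[0%R, +oo[)
     (if (0 <= s) && (s + z ^+ 2 < rho)%R then f (s, z) else 0)%:E =
   \int[mu]_(s in `[0%R, (rho - z ^+ 2)%R[) (f (s, z))%:E)%E.
Proof.
rewrite integral_mkcond [RHS]integral_mkcond; apply: eq_integral => s _.
rewrite !patchE !mem_setE !in_itv /= andbT ltrBrDr.
by case: (0 <= s) => //=; case: ifP.
Qed.

Lemma integral_ball_quadratic (r a b : R) : 0 <= r -> 0 <= b -> b * r ^+ 2 <= a ->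
  (\int[vol3 R]_x (if eucl x ^+ 2 < r ^+ 2 then a - b * eucl x ^+ 2 else 0)%:E =
   (4 * pi * r ^+ 3 * (a / 3 - b * r ^+ 2 / 5))%:E)%E.
Proof.
move=> r0 b0 bra.
pose f (x : T1 * T1) : R := a - b * (x.1 + x.2 ^+ 2).
have mf : measurable_fun [set: T1 * T1] f.
  apply: measurable_funB; first exact: measurable_cst.
  apply: measurable_funM; first exact: measurable_cst.
  apply: measurable_funD; first exact: measurable_fst.
  by apply: measurable_funX; exact: measurable_snd.
have mh := measurable_ball_profile (r ^+ 2) mf.
set h := (X in measurable_fun _ X) in mh.
have h0 x : (0 <= h x)%E.
  rewrite /h lee_fin; case: ifP => // /andP[_ xr].
  by rewrite /f subr_ge0 (le_trans _ bra)// ler_wpM2l// ltW.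
transitivity (\int[vol3 R]_x h (sqnorm2 x.1, x.2))%E.
  apply: eq_integral => x _; rewrite /h /f /= /sqnorm2 /eucl sqr_sqrtr.
    by rewrite addr_ge0 ?sqr_ge0.
  by rewrite !addr_ge0 ?sqr_ge0.
rewrite (integral_cylindrical mh h0).
pose w (z : R) : R := r ^+ 2 - z ^+ 2.
pose g (z : R) : R := pi * (a * w z - b * (w z ^+ 2 / 2 + z ^+ 2 * w z)).
transitivity (\int[mu]_(z in `[(- r)%R, r]) (g z)%:E)%E.
  rewrite [RHS]integral_mkcond; apply: eq_integral => z _.
  rewrite patchE mem_setE /= (integral_ball_slice _ _ f) in_itv /= -ler_norml.
  rewrite -(ger0_norm r0) -ler_sqr -?normrX ?real_normK ?num_real //.
  rewrite (ger0_norm (sqr_ge0 _)) (ger0_norm (sqr_ge0 _)).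
  case: ifPn => [zr|]; last first.
    rewrite -ltNge => zr; rewrite set_itv_ge ?integral_set0 ?mule0//.
    by rewrite bnd_simp -leNgt subr_le0 ltW.
  have w0 : 0 <= w z by rewrite subr_ge0.
  have dF (s : R) : 0 <= s <= w z ->
     is_derive s 1 (fun s => a * s - b * (s ^+ 2 / 2 + z ^+ 2 * s)) (f (s, z)).
    by move=> _; dereq; rewrite /f /=; field.
  rewrite (integral_itvco_closed w0 dF); last first.
    apply: continuous_subspaceT.
    change (continuous (fun s : R => a - b * (s + z ^+ 2))) => s.
    by apply: is_derive_continuous; der.
  by rewrite -EFinM; congr EFin; rewrite /g; ring.
have dG (z : R) : - r <= z <= r -> is_derive z 1 (fun z =>
  pi * (a * (r ^+ 2 * z - z ^+ 3 / 3) - b * (r ^+ 4 * z / 2 - z ^+ 5 / 10))) (g z).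
  by move=> _; dereq; rewrite /g /w /=; field.
rewrite (ftc _ dG) ?ge0_cp//; last first.
  by apply: continuous_subspaceT => z; rewrite /g /w; apply: is_derive_continuous; der.
by congr EFin; field.
Qed.

End BallIntegrals.

Section BallPotential.
Context {R : realType}.
Notation mu := (@lebesgue_measure R).
Notation T1 := (measurableTypeR R).
Notation T3 := (R3 (measurableTypeR R)).

Lemma measurable_inv_sqrt d (T : measurableType d) (f : T -> R) :
  measurable_fun [set: T] f ->
  measurable_fun [set: T] (fun x => (Num.sqrt (f x))^-1).
Proof.
move=> mf; have -> : (fun x => (Num.sqrt (f x))^-1) = (fun x => (Num.sqrt (f x)) `^ (-1)).
  by apply/funext => x; rewrite powR_inv1// sqrtr_ge0.
apply: (measurableT_comp (measurable_powR _)).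
have ms := continuous_measurable_fun (@sqrt_continuous R).
exact: (measurableT_comp ms mf).
Qed.

Lemma isd_sqpos (f : R -> R) (x a : R) : is_derive x 1 f a ->
  is_derive x 1 (fun t => (Num.max (f t) 0) ^+ 2) (2 * Num.max (f x) 0 * a).
Proof. by move=> df; exact: (isd_comp df (is_derive_sqpos _)). Qed.

Lemma isd_sqrt (f : R -> R) (x a : R) : 0 < f x -> is_derive x 1 f a ->
  is_derive x 1 (fun t => Num.sqrt (f t)) ((2 * Num.sqrt (f x))^-1 * a).
Proof. by move=> fx df; apply: isd_comp df _; exact: is_derive1_sqrt. Qed.

Lemma isd_sqrt3 (f : R -> R) (x a : R) : 0 < f x -> is_derive x 1 f a ->
  is_derive x 1 (fun t => Num.sqrt (f t) ^+ 3) (3 / 2 * Num.sqrt (f x) * a).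
Proof.
move=> fx df; notypeclasses refine (isd_eq (isd_exp 3 (isd_sqrt fx df)) _).
have s0 : Num.sqrt (f x) != 0 by rewrite gt_eqF// sqrtr_gt0.
by rewrite /=; field.
Qed.

Lemma continuous_sqrt_comp (f : R -> R) : continuous f ->
  continuous (fun t => Num.sqrt (f t)).
Proof. by move=> cf x; exact: (continuous_comp (cf x) (@sqrt_continuous R _)). Qed.

(** A primitive of [|z - q|] without case distinction is half of
[max (z - q) 0 ^ 2 - max (q - z) 0 ^ 2]. *)
Lemma integral_norm_shift (r q : R) : `|q| <= r ->
  (\int[mu]_(z in `[(- r)%R, r]) `|z - q|%:E = (r ^+ 2 + q ^+ 2)%:E)%E.
Proof.
rewrite ler_norml => /andP[rq qr].
have r0 : - r <= r by lra.
pose F (z : R) := ((Num.max (z - q) 0) ^+ 2 - (Num.max (q - z) 0) ^+ 2) / 2.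
have dF (z : R) : - r <= z <= r -> is_derive z 1 F `|z - q|.
  move=> _; rewrite /F.
  have d1 : is_derive z 1 (fun z => (Num.max (z - q) 0) ^+ 2) (2 * Num.max (z - q) 0 * (1 + - 0)).
    by notypeclasses refine (@isd_sqpos (fun z => z - q) _ _ _); der.
  have d2 : is_derive z 1 (fun z => (Num.max (q - z) 0) ^+ 2) (2 * Num.max (q - z) 0 * (0 + - 1)).
    by notypeclasses refine (@isd_sqpos (fun z => q - z) _ _ _); der.
  notypeclasses refine (isd_eq (isd_mul (isd_add d1 (isd_opp d2)) (isd_cst _ _)) _).
  have -> : `|z - q| = Num.max (z - q) 0 + Num.max (q - z) 0.
    rewrite -(opprB z q); case: (leP 0 (z - q)) => h; rewrite ?oppr_le0 ?oppr_lt0.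
      by rewrite ger0_norm// max_r ?oppr_le0// addr0.
    by rewrite ltr0_norm// max_l ?add0r// ltW// oppr_gt0.
  by rewrite /=; field.
rewrite (ftc r0 dF); last first.
  apply: continuous_subspaceT => z.
  by apply: cvg_norm; apply: cvgB; [exact: cvg_id|exact: cvg_cst].
congr EFin; rewrite /F (max_l (_ : 0 <= r - q)) ?(max_r (_ : q - r <= 0)) ?(max_r (_ : - r - q <= 0)) ?(max_l (_ : 0 <= q - - r)); [by field|lra..].
Qed.

Lemma integral_sqrt_shift (r q : R) : `|q| < r ->
  (\int[mu]_(z in `[(- r)%R, r]) (Num.sqrt (r ^+ 2 + q ^+ 2 - 2 * z * q))%:E =
   (2 * r ^+ 2 + 2 / 3 * q ^+ 2)%:E)%E.
Proof.
move=> qr; have r0 : 0 < r by exact: le_lt_trans qr.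
have r1 : - r <= r by lra.
move: (qr); rewrite ltr_norml => /andP[q1 q2].
have [->|q0] := eqVneq q 0.
  have h0 : forall z : R, Num.sqrt (r ^+ 2 + 0 ^+ 2 - 2 * z * 0) = r.
    by move=> z; rewrite expr0n /= addr0 mulr0 subr0 sqrtr_sqr gtr0_norm.
  under eq_integral do rewrite h0.
  have dF (z : R) : - r <= z <= r -> is_derive z 1 (fun z => r * z) r.
    by move=> _; dereq; rewrite /=; ring.
  rewrite (ftc r1 dF); first by congr EFin; ring.
  by apply: continuous_subspaceT => z; exact: cvg_cst.
have pos (z : R) : - r <= z <= r -> 0 < r ^+ 2 + q ^+ 2 - 2 * z * q.
  move=> /andP[z1 z2].
  have zq : z * q <= r * `|q|.
    apply: (le_trans (ler_norm _)); rewrite normrM ler_wpM2r// ler_norml z1//.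
  have := exprn_gt0 2 (_ : 0 < r - `|q|); rewrite subr_gt0 => /(_ qr).
  by rewrite sqrrB real_normK ?num_real// => h; lra.
have dF (z : R) : - r <= z <= r -> is_derive z 1
  (fun z => - (3 * q)^-1 * Num.sqrt (r ^+ 2 + q ^+ 2 - 2 * z * q) ^+ 3)
  (Num.sqrt (r ^+ 2 + q ^+ 2 - 2 * z * q)).
  move=> zr.
  have d1 : is_derive z 1 (fun z => r ^+ 2 + q ^+ 2 - 2 * z * q) (- 2 * q).
    by dereq; rewrite /=; ring.
  notypeclasses refine (isd_eq (isd_mul (isd_cst _ _) 
    (@isd_sqrt3 (fun z => r ^+ 2 + q ^+ 2 - 2 * z * q) _ _ (pos z zr) d1)) _).
  by rewrite /=; field.
rewrite (ftc r1 dF); last first.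
  apply/continuous_subspaceT/continuous_sqrt_comp => z.
  by apply: is_derive_continuous; der.
have -> : r ^+ 2 + q ^+ 2 - 2 * r * q = (r - q) ^+ 2 by ring.
have -> : r ^+ 2 + q ^+ 2 - 2 * (- r) * q = (r + q) ^+ 2 by ring.
rewrite !sqrtr_sqr !ger0_norm; [|lra..].
by congr EFin; field.
Qed.

(** In cylindrical coordinates the slice at height [z] contributes
[2 pi (sqrt (r^2 + q^2 - 2 z q) - |z - q|)], which has an elementary primitive
in [z]. *)
Lemma ball_potential_axis (r q : R) : `|q| < r ->
  (\int[vol3 R]_y (if eucl y ^+ 2 < r ^+ 2 then (eucl ((0, 0, q) - y))^-1 else 0)%:E =
   (2 * pi * (r ^+ 2 - q ^+ 2 / 3))%:E)%E.
Proof.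
move=> qr; have r0 : 0 < r by exact: le_lt_trans qr.
pose f (x : T1 * T1) : R := (Num.sqrt (x.1 + (q - x.2) ^+ 2))^-1.
have mf : measurable_fun [set: T1 * T1] f.
  apply: measurable_inv_sqrt; apply: measurable_funD; first exact: measurable_fst.
  apply: measurable_funX; apply: measurable_funB; first exact: measurable_cst.
  exact: measurable_snd.
have mh := measurable_ball_profile (r ^+ 2) mf.
set h := (X in measurable_fun _ X) in mh.
have h0 x : (0 <= h x)%E.
  by rewrite /h lee_fin; case: ifP => // _; rewrite /f invr_ge0 sqrtr_ge0.
transitivity (\int[vol3 R]_x h (sqnorm2 x.1, x.2))%E.
  apply: eq_integral => x _; rewrite /h /f /= /sqnorm2 /eucl sqr_sqrtr.
    rewrite addr_ge0 ?sqr_ge0//=.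
    by rewrite !sub0r !sqrrN.
  by rewrite !addr_ge0 ?sqr_ge0.
rewrite (integral_cylindrical mh h0).
pose H (z : T1) := (pi%:E * \int[mu]_(s in `[0%R, +oo[) h (s, z))%E.
have mH : measurable_fun [set: T1] H.
  apply: emeasurable_funM; first exact: measurable_cst.
  have := @measurable_fun_fubini_tonelli_G _ _ _ _ _ mu h mh h0.
  apply: eq_measurable_fun => z _; rewrite [RHS]integral_mkcond.
  apply: eq_integral => s _; rewrite patchE mem_setE in_itv /= andbT.
  by case: ifP => // s0; rewrite /h /= s0.
pose g (z : R) : R := 2 * pi * (Num.sqrt (r ^+ 2 + q ^+ 2 - 2 * z * q) - `|z - q|).
have cS : continuous (fun z : R => Num.sqrt (r ^+ 2 + q ^+ 2 - 2 * z * q)).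
  by apply: continuous_sqrt_comp => z; apply: is_derive_continuous; der.
have mg : measurable_fun [set: T1] g.
  apply: continuous_measurable_fun => z; apply: cvgM; first exact: cvg_cst.
  apply: cvgB; last by apply: cvg_norm; apply: cvgB; [exact: cvg_id|exact: cvg_cst].
  exact: cS.
transitivity (\int[mu]_(z in `[(- r)%R, r]) (g z)%:E)%E.
  (* On the slice [z = q] the integrand is singular at the axis; that slice is
     null. *)
  rewrite -[LHS](@integral_setD1 _ _ q setT) ?setTD; last 2 first.
  - exact: measurableC.
  - exact: measurable_funTS.
  rewrite [RHS]integral_mkcond -[RHS](@integral_setD1 _ _ q setT) ?setTD; last 2 first.
  - exact: measurableC.
  - apply/measurable_funTS/(measurable_restrictT _ _).1 => //.
    by apply/measurable_EFinP; exact: measurable_funTS.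
  apply: eq_integral => z; rewrite inE /= => /eqP zq.
  rewrite patchE mem_setE /= /H (integral_ball_slice _ _ f) in_itv /= -ler_norml.
  have -> : (`|z| <= r) = (z ^+ 2 <= r ^+ 2).
    by rewrite -[in LHS](ger0_norm (ltW r0)) -ler_sqr ?nnegrE// !real_normK ?num_real.
  case: ifPn => [zr|]; last first.
    rewrite -ltNge => zr; rewrite set_itv_ge ?integral_set0 ?mule0//.
    by rewrite bnd_simp -leNgt subr_le0 ltW.
  have w0 : 0 <= r ^+ 2 - z ^+ 2 by rewrite subr_ge0.
  have zq0 : 0 < (q - z) ^+ 2 by rewrite exprn_even_gt0//= subr_eq0 eq_sym.
  have dF (s : R) : 0 <= s <= r ^+ 2 - z ^+ 2 ->
     is_derive s 1 (fun s => 2 * Num.sqrt (s + (q - z) ^+ 2)) (f (s, z)).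
    move=> /andP[s0 _]; have p : 0 < s + (q - z) ^+ 2 by rewrite ltr_wpDl.
    have d1 : is_derive s 1 (fun s => s + (q - z) ^+ 2) (1 + 0) by der.
    notypeclasses refine (isd_eq (isd_mul (isd_cst _ _)
      (@isd_sqrt (fun s => s + (q - z) ^+ 2) _ _ p d1)) _).
    have sp : Num.sqrt (s + (q - z) ^+ 2) != 0 by rewrite gt_eqF// sqrtr_gt0.
    by rewrite /f /=; field.
  rewrite (integral_itvco_closed w0 dF); last first.
    have c1 : {in `[0, r ^+ 2 - z ^+ 2], continuous (fun s : R => f (s, z))}.
      move=> s /[!in_itv] /= /andP[s0 _]; rewrite /f /=.
      apply: cvgV; first by rewrite gt_eqF// sqrtr_gt0 ltr_wpDl.
      have cs : continuous (fun s : R => Num.sqrt (s + (q - z) ^+ 2)).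
        by apply: continuous_sqrt_comp => t; apply: is_derive_continuous; der.
      exact: cs.
    by apply: continuous_in_subspaceT => s; rewrite inE; exact: c1.
  rewrite -EFinM; congr EFin; rewrite /g add0r sqrtr_sqr distrC.
  have -> : r ^+ 2 - z ^+ 2 + (q - z) ^+ 2 = r ^+ 2 + q ^+ 2 - 2 * z * q by ring.
  by ring.
have r1 : - r <= r by lra.
pose S (z : R) := Num.sqrt (r ^+ 2 + q ^+ 2 - 2 * z * q).
pose N (z : R) := `|z - q|.
have iS : mu.-integrable `[- r, r]%classic (EFin \o S).
  apply: continuous_compact_integrable; first exact: segment_compact.
  exact: continuous_subspaceT.
have iN : mu.-integrable `[- r, r]%classic (EFin \o N).
  apply: continuous_compact_integrable; first exact: segment_compact.
  apply: continuous_subspaceT => z.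
  by apply: cvg_norm; apply: cvgB; [exact: cvg_id|exact: cvg_cst].
rewrite /g; under eq_integral do rewrite EFinM.
rewrite integralZl//; last first.
  exact: (integrableB _ iS iN).
rewrite integralB_EFin// integral_sqrt_shift// integral_norm_shift ?ltW//.
by rewrite -EFinB -EFinM; congr EFin; field.
Qed.

End BallPotential.

Section BallCoulomb.
Context {R : realType}.
Notation mu := (@lebesgue_measure R).
Notation T1 := (measurableTypeR R).
Notation T3 := (R3 (measurableTypeR R)).

Definition ball_kernel (r : R) (x y : T3) : R :=
  if eucl y ^+ 2 < r ^+ 2 then (eucl (x - y))^-1 else 0.

Lemma measurable_eucl : measurable_fun [set: T3] (@eucl R : T3 -> R).
Proof.
have ms := continuous_measurable_fun (@sqrt_continuous R).
apply: (measurableT_comp ms).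
by apply: measurable_funD; [apply: measurable_funD|]; apply: measurable_funX;
  [exact: measurable_x1|exact: measurable_x2|exact: measurable_x3].
Qed.

Lemma measurable_inv_dist (x : T3) :
  measurable_fun [set: T3] (fun y : T3 => (eucl (x - y))^-1).
Proof.
apply: measurable_inv_sqrt.
apply: measurable_funD; [apply: measurable_funD|]; apply: measurable_funX;
  apply: measurable_funB; try exact: measurable_cst.
- exact: measurable_x1.
- exact: measurable_x2.
- exact: measurable_x3.
Qed.

Lemma measurable_ball_kernel r x :
  measurable_fun [set: T3] (fun y => (ball_kernel r x y)%:E).
Proof.
apply/measurable_EFinP; apply: measurable_fun_ifT.
- apply: measurable_fun_ltr; last exact: measurable_cst.
  by apply: measurable_funX; exact: measurable_eucl.
- exact: measurable_inv_dist.
- exact: measurable_cst.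
Qed.

Lemma ball_kernel_ge0 r x y : (0 <= (ball_kernel r x y)%:E)%E.
Proof.
by rewrite lee_fin /ball_kernel; case: ifP => // _; rewrite invr_ge0 sqrtr_ge0.
Qed.

Lemma integral_ball_kernel_isometry (r : R) (T : T3 -> T3) x :
  (forall f : T3 -> \bar R, measurable_fun [set: T3] f ->
    (forall x, 0 <= f x)%E -> (\int[vol3 R]_x f (T x) = \int[vol3 R]_x f x)%E) ->
  (forall y, eucl (T y) ^+ 2 = eucl y ^+ 2) ->
  (forall y, T x - T y = T (x - y)) ->
  (\int[vol3 R]_y (ball_kernel r (T x) y)%:E = \int[vol3 R]_y (ball_kernel r x y)%:E)%E.
Proof.
move=> hT isoT linT.
rewrite -(hT _ (measurable_ball_kernel r (T x)) (ball_kernel_ge0 r (T x))).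
apply: eq_integral => y _; rewrite /ball_kernel isoT linT; congr EFin; case: ifP => // _.
congr (_^-1); apply/eqP; rewrite -(@eqrXn2 _ 2)// ?sqrtr_ge0//.
by rewrite isoT.
Qed.

Lemma eucl_sqr (y : T3) : eucl y ^+ 2 = y.1.1 ^+ 2 + y.1.2 ^+ 2 + y.2 ^+ 2.
Proof. by rewrite sqr_sqrtr// !addr_ge0 ?sqr_ge0. Qed.

Lemma rotation_to_axis (u v : R) : exists a b,
  [/\ 0 <= a, a ^+ 2 + b ^+ 2 = 1 & a * u + b * v = 0].
Proof.
have [p0|p0] := eqVneq (u ^+ 2 + v ^+ 2) 0.
  exists 1, 0; split=> //; first by rewrite expr0n expr1n addr0.
  have : u ^+ 2 == 0 by move/eqP: p0; rewrite paddr_eq0 ?sqr_ge0// => /andP[].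
  by rewrite sqrf_eq0 => /eqP ->; rewrite mulr0 mul0r addr0.
have pp : 0 < u ^+ 2 + v ^+ 2 by rewrite lt0r p0 addr_ge0 ?sqr_ge0.
have s0 : Num.sqrt (u ^+ 2 + v ^+ 2) != 0 by rewrite gt_eqF// sqrtr_gt0.
have ss : Num.sqrt (u ^+ 2 + v ^+ 2) ^+ 2 = u ^+ 2 + v ^+ 2 by rewrite sqr_sqrtr// ltW.
set s := Num.sqrt _ in s0 ss.
have [v0|v0] := leP 0 v.
  exists (v / s), (- u / s); split; first by rewrite divr_ge0 ?sqrtr_ge0.
    by rewrite !exprMn sqrrN exprVn -mulrDl addrC ss divff.
  by field.
exists (- v / s), (u / s); split; first by rewrite divr_ge0 ?sqrtr_ge0// oppr_ge0 ltW.
  by rewrite !exprMn sqrrN exprVn -mulrDl addrC ss divff.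
by field.
Qed.

(** Two rotations, about two coordinate axes, carry [x] to the third axis. *)
Lemma ball_potential (r : R) (x : T3) : eucl x ^+ 2 < r ^+ 2 -> 0 <= r ->
  (\int[vol3 R]_y (ball_kernel r x y)%:E =
   (2 * pi * (r ^+ 2 - eucl x ^+ 2 / 3))%:E)%E.
Proof.
move=> xr r0.
have [a [b [a0 ab ux]]] := rotation_to_axis x.1.1 x.2.
pose T1x := fun y : T3 => swap12 (rot23 a b (swap12 y)).
have iso1 (y : T3) : eucl (T1x y) ^+ 2 = eucl y ^+ 2.
  rewrite !eucl_sqr /= -[y.1.1 ^+ 2 + _ + _]addrAC -[y.1.1 ^+ 2 + _]mul1r -ab; ring.
have e1 : (\int[vol3 R]_y (ball_kernel r (T1x x) y)%:E =
           \int[vol3 R]_y (ball_kernel r x y)%:E)%E.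
  apply: integral_ball_kernel_isometry => //.
    move=> f mf f0; rewrite /T1x -[RHS](integral_swap12 mf f0).
    have m1 := measurableT_comp mf (@measurable_swap12 R).
    rewrite -[RHS](integral_rot23 a0 ab m1 (fun x => f0 _)).
    have m2 := measurableT_comp m1 (measurable_rot23 a b).
    by rewrite -[RHS](integral_swap12 m2 (fun x => f0 _)).
  by move=> y; rewrite /T1x /swap12 /rot23 /=; congr (_, _, _) => /=; ring.
have x1 : (T1x x).1.1 = 0 by exact: ux.
rewrite -e1 -iso1; move: xr; rewrite -iso1; move: (T1x x) x1 => {x e1 iso1 ux T1x a b a0 ab} x x1 xr.
have [a [b [a0 ab ux]]] := rotation_to_axis x.1.2 x.2.
have iso2 (y : T3) : eucl (rot23 a b y) ^+ 2 = eucl y ^+ 2.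
  rewrite !eucl_sqr /= -!addrA; congr (_ + _).
  by rewrite -[y.1.2 ^+ 2 + _]mul1r -ab; ring.
have e2 : (\int[vol3 R]_y (ball_kernel r (rot23 a b x) y)%:E =
           \int[vol3 R]_y (ball_kernel r x y)%:E)%E.
  apply: integral_ball_kernel_isometry => //.
    by move=> f mf f0; exact: integral_rot23.
  by move=> y; rewrite /rot23 /=; congr (_, _, _) => /=; ring.
rewrite -e2 -iso2; move: xr; rewrite -iso2.
pose q := (rot23 a b x).2.
have -> : rot23 a b x = (0, 0, q) by rewrite /q /rot23 /= x1 ux.
have eq2 : eucl ((0, 0, q) : T3) ^+ 2 = q ^+ 2 by rewrite eucl_sqr /= expr0n !add0r.
rewrite eq2 => qr; apply: ball_potential_axis.
by rewrite -(ger0_norm r0) -ltr_sqr ?nnegrE// !real_normK ?num_real.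
Qed.

Definition ball_indic (r : R) (x : T3) : R := if eucl x ^+ 2 < r ^+ 2 then 1 else 0.

Lemma mass_ball (r : R) : 0 <= r -> mass (ball_indic r) = (4 / 3 * pi * r ^+ 3)%:E.
Proof.
move=> r0; have h := @integral_ball_quadratic R r 1 0 r0 (lexx _) _.
transitivity (4 * pi * r ^+ 3 * (1 / 3 - 0 * r ^+ 2 / 5))%:E; last by congr EFin; field.
rewrite -h; last by rewrite mul0r.
by apply: eq_integral => x _; rewrite /ball_indic mul0r subr0.
Qed.

(** The potential inside the ball is quadratic in [|x|], so the energy is the
integral of a quadratic polynomial over the ball. *)
Lemma coulomb_ball (r : R) : 0 <= r ->
  coulomb (ball_indic r) = (32 / 15 * pi ^+ 2 * r ^+ 5)%:E.
Proof.
move=> r0; have h := @integral_ball_quadratic R r (2 * pi * r ^+ 2) (2 * pi / 3) r0.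
transitivity (4 * pi * r ^+ 3 * (2 * pi * r ^+ 2 / 3 - 2 * pi / 3 * r ^+ 2 / 5))%:E; last by congr EFin; field.
have p0 : 0 <= 2 * pi :> R by rewrite mulr_ge0 ?pi_ge0.
rewrite -h; last 2 first.
- by rewrite divr_ge0.
- by have := mulr_ge0 p0 (sqr_ge0 r); set t := 2 * pi * _ => t0; rewrite mulrAC -/t; lra.
apply: eq_integral => x _; rewrite {1}/ball_indic.
case: ifPn => xr; last by rewrite integral0_eq// => y _; rewrite !mul0r.
transitivity (\int[vol3 R]_y (ball_kernel r x y)%:E)%E.
  apply: eq_integral => y _; rewrite mul1r /ball_indic /ball_kernel.
  by case: ifP; rewrite ?mul1r ?mul0r.
by rewrite (ball_potential xr r0); congr EFin; ring.
Qed.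

End BallCoulomb.

(** * Integrals of derivatives of compactly supported functions *)

Section LineIntegral.
Context {R : realType}.
Notation mu := (@lebesgue_measure R).
Notation T1 := (measurableTypeR R).
Notation T3 := (R3 (measurableTypeR R)).
Notation leb2 := (sfprod mu mu).
Notation leb3 := (sfprod leb2 mu).

Definition box (L : R) : set (R3 R) :=
  [set x | [/\ `|x.1.1| <= L, `|x.1.2| <= L & `|x.2| <= L] ].

Lemma boxE L : box L = (`[- L, L] `*` `[- L, L]) `*` `[- L, L].
Proof.
by apply/seteqP; split => x /=; rewrite /box /= !in_itv /= -!ler_norml;
  [case=> ? ? ?|case=> -[? ?] ?].
Qed.

Lemma measurable_box L : measurable (box L : set T3).
Proof. by rewrite boxE; apply: measurableX; [apply: measurableX|]; exact: measurable_itv. Qed.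

Lemma vol3_box (L : R) : (vol3 R (box L) < +oo)%E.
Proof.
rewrite boxE; pose I : set T1 := `[- L, L]%classic.
have mI : measurable I by exact: measurable_itv.
have h1 := @product_measure1E _ _ _ _ _ leb2 mu (I `*` I) I (measurableX mI mI) mI.
have h2 := @product_measure1E _ _ _ _ _ mu mu I I mI mI.
change ((leb2 \x mu) ((I `*` I) `*` I) < +oo)%E.
rewrite h1; change ((mu \x mu) (I `*` I) * mu I < +oo)%E.
have hI : mu I \is a fin_num.
  by rewrite ge0_fin_numE// lebesgue_measure_itv /=; case: ifP => _; rewrite ltry.
by rewrite h2 ltey_eq !fin_numM.
Qed.

Lemma compact_box L : compact (box L).
Proof. by rewrite boxE; apply: compact_setX; [apply: compact_setX|]; exact: segment_compact. Qed.

Lemma continuous_bounded_box (f : R3 R -> R) L : continuous f ->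
  exists2 M, 0 <= M & forall x, box L x -> `|f x| <= M.
Proof.
move=> cf; have := @continuous_compact _ _ f (box L) (continuous_subspaceT cf) (@compact_box L).
move=> /compact_bounded [M [_ /(_ (`|M| + 1))]].
rewrite (le_lt_trans (ler_norm _)) ?ltrDl// => /(_ isT) h.
by exists (`|M| + 1) => // x Lx; apply: h; exists x.
Qed.

Lemma integrable_bounded_box (f : T3 -> R) (M L : R) : measurable_fun [set: T3] f ->
  (forall x, `|f x| <= M) -> (forall x, ~ box L x -> f x = 0) ->
  (vol3 R).-integrable setT (EFin \o f).
Proof.
move=> mf fM f0.
have mB := @measurable_box L.
have h : (vol3 R).-integrable (box L) (EFin \o f).
  apply: measurable_bounded_integrable => //; first exact: vol3_box.
    exact: measurable_funTS.
  exists M; split; first exact: num_real.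
  by move=> y My x _; exact: le_trans (fM x) (ltW My).
have -> : EFin \o f = (EFin \o f) \_ (box L).
  apply/funext => x; rewrite patchE; case: ifPn => // xB.
  by rewrite /= f0//; move/negP: xB; apply: contra_not => ?; rewrite inE.
exact/(integrable_mkcond _ mB).1.
Qed.

Lemma continuous_integrable_box (f : R3 R -> R) (L : R) : continuous f ->
  (forall x, ~ box L x -> f x = 0) -> (vol3 R).-integrable setT (EFin \o (f : T3 -> R)).
Proof.
move=> cf f0; have [M M0 fM] := continuous_bounded_box L cf.
apply: (@integrable_bounded_box _ M L) => //; first exact: continuous_measurable3.
by move=> x; have [/fM//|/f0 ->] := pselect (box L x); rewrite normr0.
Qed.

End LineIntegral.

Section ContinuityOfPairs.
Context {U V W : topologicalType}.

Lemma continuous_mkpair (f : U -> V) (g : U -> W) : continuous f -> continuous g ->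
  continuous (fun x => (f x, g x)).
Proof. by move=> cf cg x; exact: (cvg_pair (cf x) (cg x)). Qed.

Lemma continuous_pr1 : continuous (fst : V * W -> V).
Proof. by move=> x; exact: cvg_fst. Qed.

Lemma continuous_pr2 : continuous (snd : V * W -> W).
Proof. by move=> x; exact: cvg_snd. Qed.

Lemma continuous_o (f : V -> W) (g : U -> V) : continuous f -> continuous g ->
  continuous (fun x => f (g x)).
Proof. by move=> cf cg x; exact: continuous_comp (cg x) (cf (g x)). Qed.

End ContinuityOfPairs.

Section IntegrationByParts.
Context {R : realType}.
Notation mu := (@lebesgue_measure R).
Notation T1 := (measurableTypeR R).
Notation T3 := (R3 (measurableTypeR R)).
Notation leb2 := (sfprod mu mu).
Notation leb3 := (sfprod leb2 mu).

(** Directional derivatives are derivatives of the restriction to a line; this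
turns rules of calculus in one variable into rules for [R3]. *)
Lemma is_derive_line (f : R3 R -> R) (x e : R3 R) (l : R) :
  is_derive (0 : R) 1 (fun t : R => f (t *: e + x)) l -> is_derive x e f l.
Proof.
move=> h; have dh := der_derivable h; case: h => _ hl.
have E : (fun h : R => h^-1 *: (((fun t : R => f (t *: e + x)) \o shift 0) (h *: (1 : R)) - f (0 *: e + x)))
   = (fun h : R => h^-1 *: ((f \o shift x) (h *: e) - f x)).
  apply/funext => h /=; rewrite addr0 scale0r add0r.
  by rewrite (_ : h *: (1 : R) = h)// /GRing.scale /= mulr1.
move: dh; rewrite /derivable E => dh; split => //.
by rewrite -hl /derive E.
Qed.

Lemma is_derive_line_inv (f : R3 R -> R) (x e : R3 R) (l : R) :
  is_derive x e f l -> is_derive (0 : R) 1 (fun t : R => f (t *: e + x)) l.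
Proof.
move=> [dh hl].
have E : (fun h : R => h^-1 *: (((fun t : R => f (t *: e + x)) \o shift 0) (h *: (1 : R)) - f (0 *: e + x)))
   = (fun h : R => h^-1 *: ((f \o shift x) (h *: e) - f x)).
  apply/funext => h /=; rewrite addr0 scale0r add0r.
  by rewrite (_ : h *: (1 : R) = h)// /GRing.scale /= mulr1.
split; first by rewrite /derivable E.
by rewrite /derive E -hl.
Qed.

Lemma is_derive_shift1 (f : R -> R) (x l : R) :
  is_derive (0 : R) 1 (fun t => f (t + x)) l -> is_derive x 1 f l.
Proof.
move=> h.
have d0 : is_derive x 1 (fun t => t - x) (1 + - 0) by der.
have xx : x - x = 0 by rewrite subrr.
rewrite -xx in h.
have := isd_comp d0 h.
rewrite oppr0 addr0 mulr1.
by congr is_derive; apply/funext => t /=; rewrite subrK.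
Qed.

(** By Fubini the integral reduces to lines parallel to the third axis, on each
of which it is the difference of two boundary values that vanish. *)
Lemma integral_derive3 (G H : R3 R -> R) (L : R) : 0 <= L ->
  (forall x, is_derive x (e3 R) G (H x)) ->
  continuous H ->
  (forall x, ~ box L x -> G x = 0) -> (forall x, ~ box L x -> H x = 0) ->
  (\int[vol3 R]_x (H x)%:E = 0)%E.
Proof.
move=> L0 dG cH G0 H0.
have iH := continuous_integrable_box cH H0.
rewrite integral_vol3E.
rewrite -[LHS](@integral12_prod_meas1 _ _ _ _ _ leb2 mu (EFin \o (H : T3 -> R)) iH).
apply: integral0_eq => -[a b] _.
change (\int[mu]_c (H (a, b, c))%:E = 0)%E.
pose g (c : R) := G (a, b, c); pose h (c : R) := H (a, b, c).
have dg (c : R) : is_derive c 1 g (h c).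
  apply: is_derive_shift1.
  have := is_derive_line_inv (dG (a, b, c)).
  congr is_derive; apply/funext => t; rewrite /g /e3; congr G.
  change ((t * 0 + a, t * 0 + b, t * 1 + c) = (a, b, t + c)).
  by rewrite !mulr0 mulr1 !add0r.
pose M := L + 1.
have M0 : - M <= M by rewrite /M; lra.
have LM : L < M by rewrite /M ltrDl.
have out (c : R) : ~~ (`|c| <= L) -> ~ box L (a, b, c).
  by move=> /negP cL [_ _ /= cL'].
have mh : continuous h.
  apply: (continuous_o cH); apply: continuous_mkpair => c; first exact: cvg_cst.
  exact: cvg_id.
transitivity (\int[mu]_(c in `[(- M)%R, M]) (h c)%:E)%E.
  rewrite [RHS]integral_mkcond; apply: eq_integral => c _.
  rewrite patchE mem_setE in_itv /= -ler_norml; case: ifPn => // cM.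
  by rewrite H0//; apply: out; apply: contra cM => cL; rewrite (le_trans cL)// ltW.
rewrite (@ftc _ g h _ _ M0 (fun x _ => dg x)); last exact: continuous_subspaceT.
rewrite /g !G0 ?subrr//; apply: out; rewrite -ltNge ?normrN (lt_le_trans LM)// ler_norm//.
Qed.

Lemma continuous_x1 : continuous (fun x : R3 R => x.1.1).
Proof. exact: (continuous_o continuous_pr1 continuous_pr1). Qed.

Lemma continuous_x2 : continuous (fun x : R3 R => x.1.2).
Proof. exact: (continuous_o continuous_pr2 continuous_pr1). Qed.

Lemma continuous_x3 : continuous (fun x : R3 R => x.2).
Proof. exact: continuous_pr2. Qed.

Lemma continuous_swap12 : continuous (swap12 : R3 R -> R3 R).
Proof.
apply: continuous_mkpair continuous_x3.
exact: continuous_mkpair continuous_x2 continuous_x1.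
Qed.

Lemma continuous_swap23 : continuous (swap23 : R3 R -> R3 R).
Proof.
apply: continuous_mkpair continuous_x2.
exact: continuous_mkpair continuous_x1 continuous_x3.
Qed.

Lemma is_derive_linear (G : R3 R -> R) (T : R3 R -> R3 R) (x e e' : R3 R) (l : R) :
  (forall h : R, T (h *: e + x) = h *: e' + T x) ->
  is_derive (T x) e' G l -> is_derive x e (G \o T) l.
Proof.
move=> hT h; apply: is_derive_line; have := is_derive_line_inv h.
by congr is_derive; apply/funext => t /=; rewrite hT.
Qed.

Lemma box_swap12 (L : R) x : box L (swap12 x) = box L x :> Prop.
Proof. by apply/propext; split => -[? ? ?]. Qed.

Lemma box_swap23 (L : R) x : box L (swap23 x) = box L x :> Prop.
Proof. by apply/propext; split => -[? ? ?]. Qed.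

Lemma integral_derive2 (G H : R3 R -> R) (L : R) : 0 <= L ->
  (forall x, is_derive x (e2 R) G (H x)) ->
  continuous H ->
  (forall x, ~ box L x -> G x = 0) -> (forall x, ~ box L x -> H x = 0) ->
  (\int[vol3 R]_x (H x)%:E = 0)%E.
Proof.
move=> L0 dG cH G0 H0.
have mH : measurable_fun [set: T3] (EFin \o (H : T3 -> R)).
  by apply/measurable_EFinP; exact: (continuous_measurable3 cH).
have h := integral_preserved_signed (@integral_swap23 R) mH.
transitivity (\int[vol3 R]_x (H (swap23 x))%:E)%E; first exact: (esym h).
apply: (@integral_derive3 (G \o swap23) (H \o swap23) L L0).
- move=> x; apply: is_derive_linear (dG _) => t.
  by rewrite /swap23 /=; congr (_, _, _).
- exact: continuous_o continuous_swap23.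
- by move=> x; rewrite -box_swap23 => /G0.
- by move=> x; rewrite -box_swap23 => /H0.
Qed.

Lemma integral_derive1 (G H : R3 R -> R) (L : R) : 0 <= L ->
  (forall x, is_derive x (e1 R) G (H x)) ->
  continuous H ->
  (forall x, ~ box L x -> G x = 0) -> (forall x, ~ box L x -> H x = 0) ->
  (\int[vol3 R]_x (H x)%:E = 0)%E.
Proof.
move=> L0 dG cH G0 H0.
have mH : measurable_fun [set: T3] (EFin \o (H : T3 -> R)).
  by apply/measurable_EFinP; exact: (continuous_measurable3 cH).
have h := integral_preserved_signed (@integral_swap12 R) mH.
transitivity (\int[vol3 R]_x (H (swap12 x))%:E)%E; first exact: (esym h).
apply: (@integral_derive2 (G \o swap12) (H \o swap12) L L0).
- move=> x; apply: is_derive_linear (dG _) => t.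
  by rewrite /swap12 /=; congr (_, _, _).
- exact: continuous_o continuous_swap12.
- by move=> x; rewrite -box_swap12 => /G0.
- by move=> x; rewrite -box_swap12 => /H0.
Qed.

End IntegrationByParts.

Section C1Continuity.
Context {R : realType}.
Implicit Types (f : R3 R -> R) (x e : R3 R).

Lemma is_derive_along f x e (t l : R) : is_derive (t *: e + x) e f l ->
  is_derive t 1 (fun s : R => f (s *: e + x)) l.
Proof.
move=> h; apply: is_derive_shift1.
have := is_derive_line_inv h.
by congr is_derive; apply/funext => s; congr f; rewrite scalerDl addrA.
Qed.

Lemma is_derive_lipschitz (g dg : R -> R) (M d : R) :
  (forall t : R, is_derive t 1 g (dg t)) -> (forall t : R, `|t| <= `|d| -> `|dg t| <= M) ->
  `|g d - g 0| <= M * `|d|.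
Proof.
move=> hg DM.
have cg : continuous g by move=> t; exact: is_derive_continuous (hg t).
have [d0|d0|->] := ltgtP d 0; last by rewrite subrr !normr0 mulr0.
- have [c /[!in_itv] /= /andP[c1 c2] E] :=
    @MVT _ g dg d 0 d0 (fun t _ => hg t) (continuous_subspaceT cg).
  rewrite distrC E sub0r normrM normrN ler_wpM2r// DM//.
  by rewrite !ltr0_norm// lerN2 ltW.
- have [c /[!in_itv] /= /andP[c1 c2] E] :=
    @MVT _ g dg 0 d d0 (fun t _ => hg t) (continuous_subspaceT cg).
  rewrite E subr0 normrM ler_wpM2r// DM//.
  by rewrite !gtr0_norm// ltW.
Qed.

Lemma line_lipschitz f e x (M d : R) :
  (forall y, derivable f y e) ->
  (forall t : R, `|t| <= `|d| -> `|'D_e f (t *: e + x)| <= M) ->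
  `|f (d *: e + x) - f x| <= M * `|d|.
Proof.
move=> df DM.
have -> : f x = f (0 *: e + x) by rewrite scale0r add0r.
apply: (@is_derive_lipschitz (fun s : R => f (s *: e + x)) (fun s : R => 'D_e f (s *: e + x))) => //.
by move=> t; apply: is_derive_along; apply: DeriveDef; first exact: df.
Qed.

(** Only partial derivatives are assumed to exist in [C1].  On a bounded box they
are bounded, so a coordinate path between two points controls the increment. *)
Lemma C1_continuous f : C1 f -> continuous f.
Proof.
move=> hf.
have [d1 c1] := hf (e1 R) (or_introl erefl).
have [d2 c2] := hf (e2 R) (or_intror (or_introl erefl)).
have [d3 c3] := hf (e3 R) (or_intror (or_intror erefl)).
move=> [[a b] c].
pose L := `|a| + `|b| + `|c| + 1.
have [M1 M10 hM1] := continuous_bounded_box L c1.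
have [M2 M20 hM2] := continuous_bounded_box L c2.
have [M3 M30 hM3] := continuous_bounded_box L c3.
pose M := M1 + M2 + M3 + 1.
have M0 : 0 < M by rewrite ltr_wpDl// !addr_ge0.
have inL (u v : R) : `|u - v| <= 1 -> `|u| <= `|v| + 1.
  by move=> uv; rewrite -(subrK v u) (le_trans (ler_normD _ _))// addrC lerD2l.
have key (y : R3 R) : `|y.1.1 - a| <= 1 -> `|y.1.2 - b| <= 1 -> `|y.2 - c| <= 1 ->
  `|f y - f (a, b, c)| <= M1 * `|y.1.1 - a| + M2 * `|y.1.2 - b| + M3 * `|y.2 - c|.
  case: y => -[u v] w /= ua vb wc.
  have E1 (t : R) : t *: e1 R + (a, b, c) = (t + a, b, c).
    change ((t * 1 + a, t * 0 + b, t * 0 + c) = (t + a, b, c)).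
    by rewrite !mulr0 mulr1 !add0r.
  have E2 (t : R) : t *: e2 R + (u, b, c) = (u, t + b, c).
    change ((t * 0 + u, t * 1 + b, t * 0 + c) = (u, t + b, c)).
    by rewrite !mulr0 mulr1 !add0r.
  have E3 (t : R) : t *: e3 R + (u, v, c) = (u, v, t + c).
    change ((t * 0 + u, t * 0 + v, t * 1 + c) = (u, v, t + c)).
    by rewrite !mulr0 mulr1 !add0r.
  have na := normr_ge0 a; have nb := normr_ge0 b; have nc := normr_ge0 c.
  have uL := inL _ _ ua; have vL := inL _ _ vb; have wL := inL _ _ wc.
  have tL (t z d : R) : `|t| <= `|d| -> `|d| <= 1 -> `|t + z| <= `|z| + 1.
    move=> td d1'; rewrite (le_trans (ler_normD _ _))// addrC lerD2l.
    exact: le_trans td d1'.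
  have b1 : `|f (u, b, c) - f (a, b, c)| <= M1 * `|u - a|.
    have := @line_lipschitz f (e1 R) (a, b, c) M1 (u - a) d1.
    rewrite E1 subrK; apply => t tu; apply: hM1; rewrite E1; split => /=.
    + by have := tL _ a _ tu ua; rewrite /L; lra.
    + by rewrite /L; lra.
    + by rewrite /L; lra.
  have b2 : `|f (u, v, c) - f (u, b, c)| <= M2 * `|v - b|.
    have := @line_lipschitz f (e2 R) (u, b, c) M2 (v - b) d2.
    rewrite E2 subrK; apply => t tu; apply: hM2; rewrite E2; split => /=.
    + by rewrite /L; lra.
    + by have := tL _ b _ tu vb; rewrite /L; lra.
    + by rewrite /L; lra.
  have b3 : `|f (u, v, w) - f (u, v, c)| <= M3 * `|w - c|.
    have := @line_lipschitz f (e3 R) (u, v, c) M3 (w - c) d3.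
    rewrite E3 subrK; apply => t tu; apply: hM3; rewrite E3; split => /=.
    + by rewrite /L; lra.
    + by rewrite /L; lra.
    + by have := tL _ c _ tu wc; rewrite /L; lra.
  have -> : f (u, v, w) - f (a, b, c) = (f (u, b, c) - f (a, b, c)) +
    (f (u, v, c) - f (u, b, c)) + (f (u, v, w) - f (u, v, c)) by ring.
  apply: le_trans (ler_normD _ _) _; apply: lerD b3.
  by apply: le_trans (ler_normD _ _) _; exact: lerD b1 b2.
apply/cvgrPdist_lt => eps eps0.
pose dl := Num.min 1 (eps / M).
have dl0 : 0 < dl by rewrite lt_min ltr01 divr_gt0.
have dl1 : dl <= 1 by rewrite ge_min lexx.
have dle : dl * M <= eps by rewrite -ler_pdivlMr// ge_min lexx orbT.
have nb : nbhs ((a, b, c) : R3 R) (ball ((a, b, c) : R3 R) dl) by exact: (nbhsx_ballx ((a, b, c) : R3 R) dl dl0).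
apply: filterS nb => y; rewrite distrC => -[[/= h1 h2] /= h3].
move: h1 h2 h3; rewrite /ball /= => h1 h2 h3.
rewrite distrC in h1; rewrite distrC in h2; rewrite distrC in h3.
apply: (le_lt_trans (key y _ _ _)); rewrite ?(le_trans (ltW _) dl1)//.
apply: lt_le_trans dle; rewrite /M.
have q1 : M1 * `|y.1.1 - a| <= M1 * dl by rewrite ler_wpM2l// ltW.
have q2 : M2 * `|y.1.2 - b| <= M2 * dl by rewrite ler_wpM2l// ltW.
have q3 : M3 * `|y.2 - c| <= M3 * dl by rewrite ler_wpM2l// ltW.
by move: q1 q2 q3; clear -dl0; nra.
Qed.

End C1Continuity.

(** * The perimeter of a ball *)

Section BallPerimeter.
Context {R : realType}.
Notation mu := (@lebesgue_measure R).
Notation T3 := (R3 (measurableTypeR R)).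
Notation vol := (vol3 R).

(** Equal to [1] up to [a] and to [0] from [b] on, nonincreasing; squaring the
positive parts makes it continuously differentiable. *)
Definition cutoff (a b s : R) : R :=
  Num.max (1 - Num.max ((s - a) / (b - a)) 0 ^+ 2) 0 ^+ 2.

Definition dcutoff (a b s : R) : R :=
  2 * Num.max (1 - Num.max ((s - a) / (b - a)) 0 ^+ 2) 0 *
  (0 + - (2 * Num.max ((s - a) / (b - a)) 0 * ((1 + - 0) * (b - a)^-1 + (s - a) * 0))).

Lemma is_derive_cutoff (a b s : R) : is_derive s 1 (cutoff a b) (dcutoff a b s).
Proof.
rewrite /cutoff /dcutoff.
by notypeclasses refine (@isd_sqpos _ (fun s => 1 - Num.max ((s - a) / (b - a)) 0 ^+ 2) _ _ _);
  notypeclasses refine (isd_add (isd_cst _ _) (isd_opp (@isd_sqpos _ (fun s => (s - a) / (b - a)) _ _ _))); der.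
Qed.

Lemma continuous_sqr (T : topologicalType) (f : T -> R) : continuous f ->
  continuous (fun x => f x ^+ 2).
Proof.
move=> cf; have -> : (fun x => f x ^+ 2) = (fun x => f x * f x) by apply/funext.
by move=> x; apply: cvgM; exact: cf.
Qed.

Lemma continuous_max0 (T : topologicalType) (f : T -> R) : continuous f ->
  continuous (fun x => Num.max (f x) 0).
Proof.
move=> cf; have -> : (fun x => Num.max (f x) 0) = (fun x => (f x + `|f x|) / 2).
  apply/funext => x; case: (leP 0 (f x)) => h.
    by rewrite ger0_norm//; field.
  by rewrite ltr0_norm// subrr mul0r.
move=> x; apply: cvgM; last exact: cvg_cst.
by apply: cvgD; [exact: cf|exact: cvg_norm (cf x)].
Qed.

Lemma continuous_cutoff (a b : R) : continuous (cutoff a b).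
Proof. by move=> s; exact: is_derive_continuous (is_derive_cutoff a b s). Qed.

Lemma continuous_dcutoff (a b : R) : continuous (dcutoff a b).
Proof.
have c1 : continuous (fun s : R => Num.max ((s - a) / (b - a)) 0).
  by apply: continuous_max0 => s; apply: is_derive_continuous; der.
have c2 : continuous (fun s : R => Num.max (1 - Num.max ((s - a) / (b - a)) 0 ^+ 2) 0).
  apply: continuous_max0 => s; apply: cvgB; first exact: cvg_cst.
  exact: (continuous_sqr c1).
have c3 : continuous (fun s : R => (1 + - 0) * (b - a)^-1 + (s - a) * 0).
  by move=> s; apply: is_derive_continuous; der.
move=> s; apply: cvgM.
  by apply: cvgM; [exact: cvg_cst|exact: c2].
apply: cvgD; first exact: cvg_cst.
apply: cvgN; apply: cvgM.
  by apply: cvgM; [exact: cvg_cst|exact: c1].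
exact: c3.
Qed.

Section CutoffFacts.
Variables (a b : R).
Hypothesis ab : a < b.

Let ba0 : 0 < b - a. Proof. by rewrite subr_gt0. Qed.

Lemma cutoff_le (s : R) : s <= a -> cutoff a b s = 1 /\ dcutoff a b s = 0.
Proof.
move=> sa; have u0 : (s - a) / (b - a) <= 0.
  by rewrite pmulr_lle0 ?invr_gt0// subr_le0.
rewrite /cutoff /dcutoff (max_r u0) expr0n subr0 (max_l ler01) expr1n; split=> //.
by rewrite mulr0 mul0r oppr0 addr0 mulr0.
Qed.

Lemma cutoff_ge (s : R) : b <= s -> cutoff a b s = 0 /\ dcutoff a b s = 0.
Proof.
move=> bs; have u1 : 1 <= (s - a) / (b - a).
  by rewrite ler_pdivlMr// mul1r lerB.
have u0 : 0 <= (s - a) / (b - a) by exact: le_trans ler01 u1.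
have v0 : 1 - ((s - a) / (b - a)) ^+ 2 <= 0 by rewrite subr_le0 exprn_ege1.
by rewrite /cutoff /dcutoff (max_l u0) (max_r v0) expr0n mulr0 mul0r.
Qed.

Lemma cutoff_bounds (s : R) : 0 <= cutoff a b s <= 1.
Proof.
rewrite sqr_ge0 /= /cutoff; set u := Num.max (_ / _) 0.
have v1 : 1 - u ^+ 2 <= 1 by rewrite gerBl sqr_ge0.
by rewrite exprn_ile1// ?le_max ?lexx ?orbT// ge_max v1 ler01.
Qed.

Lemma dcutoff_le0 (s : R) : dcutoff a b s <= 0.
Proof.
rewrite /dcutoff; set u := Num.max (_ / _) 0; set v := Num.max _ 0.
have u0 : 0 <= u by rewrite /u le_max lexx orbT.
have v0 : 0 <= v by rewrite /v le_max lexx orbT.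
rewrite add0r mulr0 addr0 oppr0 addr0 mul1r mulrN oppr_le0.
by rewrite !mulr_ge0// invr_ge0 ltW.
Qed.

End CutoffFacts.

Definition sqn (x : R3 R) : R := x.1.1 ^+ 2 + x.1.2 ^+ 2 + x.2 ^+ 2.

Lemma continuous_sqn : continuous sqn.
Proof.
move=> x; apply: cvgD; first apply: cvgD.
- exact: (continuous_sqr continuous_x1).
- exact: (continuous_sqr continuous_x2).
- exact: (continuous_sqr continuous_x3).
Qed.

Lemma is_derive_sqn_dir (h : R -> R) (l a b c : R) (x : R3 R) : is_derive (sqn x) 1 h l ->
  is_derive x (a, b, c) (fun x => h (sqn x)) (l * (2 * (x.1.1 * a + x.1.2 * b + x.2 * c))).
Proof.
case: x => -[p q] s dhP; rewrite /=; apply: is_derive_line.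
change (is_derive (0 : R) 1
    (fun t : R => h ((t * a + p) ^+ 2 + (t * b + q) ^+ 2 + (t * c + s) ^+ 2))
    (l * (2 * (p * a + q * b + s * c)))).
have d1 : is_derive (0 : R) 1
  (fun t : R => (t * a + p) ^+ 2 + (t * b + q) ^+ 2 + (t * c + s) ^+ 2)
  (2 * (p * a + q * b + s * c)) by dereq; rewrite /=; ring.
have d2 : is_derive ((0 * a + p) ^+ 2 + (0 * b + q) ^+ 2 + (0 * c + s) ^+ 2) 1 h l.
  by rewrite !mul0r !add0r; exact: dhP.
exact: isd_comp d1 d2.
Qed.

Lemma is_derive_sqn (h : R -> R) (l : R) (x : R3 R) : is_derive (sqn x) 1 h l ->
  [/\ is_derive x (e1 R) (fun x => h (sqn x)) (l * (2 * x.1.1)),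
      is_derive x (e2 R) (fun x => h (sqn x)) (l * (2 * x.1.2)) &
      is_derive x (e3 R) (fun x => h (sqn x)) (l * (2 * x.2))].
Proof.
move=> dh; split.
- by have := is_derive_sqn_dir 1 0 0 dh; rewrite mulr1 !mulr0 !addr0.
- by have := is_derive_sqn_dir 0 1 0 dh; rewrite mulr1 !mulr0 addr0 add0r.
- by have := is_derive_sqn_dir 0 0 1 dh; rewrite mulr1 !mulr0 !add0r.
Qed.

Lemma sqn_box (r : R) (x : R3 R) : 0 <= r -> ~ box r x -> r ^+ 2 <= sqn x.
Proof.
move=> r0 nb; rewrite leNgt; apply/negP => sr; apply: nb.
have H (t : R) : t ^+ 2 <= sqn x -> `|t| <= r.
  move=> ts; rewrite -(ger0_norm r0) -ler_sqr ?nnegrE// !real_normK ?num_real//.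
  exact: le_trans ts (ltW sr).
have p1 := sqr_ge0 x.1.1; have p2 := sqr_ge0 x.1.2; have p3 := sqr_ge0 x.2.
by split; apply: H; rewrite /sqn; lra.
Qed.

Lemma continuous_mulf (T : topologicalType) (u v : T -> R) :
  continuous u -> continuous v -> continuous (fun x => u x * v x).
Proof. by move=> cu cv x; apply: cvgM; [exact: cu|exact: cv]. Qed.

Lemma continuous_addf (T : topologicalType) (u v : T -> R) :
  continuous u -> continuous v -> continuous (fun x => u x + v x).
Proof. by move=> cu cv x; apply: cvgD; [exact: cu|exact: cv]. Qed.

(** The integrand is the divergence of the compactly supported field
[cutoff (|x|^2) phi x]. *)
Lemma integral_cutoff_div (phi : R3 R -> R3 R) (a r : R) : 0 <= r -> a < r ^+ 2 ->
  C1 (fun y => (phi y).1.1) -> C1 (fun y => (phi y).1.2) -> C1 (fun y => (phi y).2) ->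
  let H x := cutoff a (r ^+ 2) (sqn x) * div3 phi x +
    dcutoff a (r ^+ 2) (sqn x) * (2 * (x.1.1 * (phi x).1.1 + x.1.2 * (phi x).1.2 + x.2 * (phi x).2)) in
  vol.-integrable setT (EFin \o H) /\ (\int[vol]_x (H x)%:E = 0)%E.
Proof.
move=> r0 ar h1 h2 h3 H.
have hd1 := h1 (e1 R) (or_introl erefl).
have hd2 := h2 (e2 R) (or_intror (or_introl erefl)).
have hd3 := h3 (e3 R) (or_intror (or_intror erefl)).
pose f x := cutoff a (r ^+ 2) (sqn x); pose df x := dcutoff a (r ^+ 2) (sqn x).
have cf : continuous f := continuous_o (@continuous_cutoff a (r ^+ 2)) continuous_sqn.
have cdf : continuous df := continuous_o (@continuous_dcutoff a (r ^+ 2)) continuous_sqn.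
have out x : ~ box r x -> f x = 0 /\ df x = 0.
  by move=> /(sqn_box r0); exact: cutoff_ge.
pose K (e : R3 R) (xi ui : R3 R -> R) x := f x * 'D_e ui x + df x * (2 * xi x) * ui x.
have cK e xi ui : continuous xi -> C1 ui -> continuous (fun x => 'D_e ui x) ->
    continuous (K e xi ui).
  move=> cxi cui cdui; apply: continuous_addf; first exact: continuous_mulf.
  apply: continuous_mulf (C1_continuous cui); apply: continuous_mulf cdf _.
  by apply: continuous_mulf cxi => x; exact: cvg_cst.
have oK e xi ui x : ~ box r x -> K e xi ui x = 0.
  by move=> /out [fx dfx]; rewrite /K fx dfx !mul0r addr0.
have iK e xi ui : continuous xi -> C1 ui -> continuous (fun x => 'D_e ui x) ->
    vol.-integrable setT (EFin \o K e xi ui).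
  by move=> cxi cui cdui; exact: continuous_integrable_box (cK e _ _ cxi cui cdui) (oK e xi ui).
have dK e xi ui x : (forall x, derivable ui x e) ->
    is_derive x e f (df x * (2 * xi x)) ->
    is_derive x e (fun x => f x * ui x) (K e xi ui x).
  move=> dui dfx; have dux : is_derive x e ui ('D_e ui x) by apply: DeriveDef; first exact: dui.
  apply: is_derive_line.
  have p1 := is_derive_line_inv dfx; have p2 := is_derive_line_inv dux.
  have := isd_mul p1 p2; rewrite scale0r add0r.
  by rewrite /K addrC.
have o2 ui x : ~ box r x -> f x * ui x = 0 by move=> /out [-> _]; rewrite mul0r.
have I1 : (\int[vol]_x (K (e1 R) (fun x => x.1.1) (fun y => (phi y).1.1) x)%:E = 0)%E.
  apply: (integral_derive1 r0 _ _ (o2 (fun y => (phi y).1.1)) (oK _ _ _)).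
    by move=> x; apply: dK; [exact: hd1.1|have [] := is_derive_sqn (is_derive_cutoff a (r ^+ 2) (sqn x))].
  by apply: cK; [exact: continuous_x1|exact: h1|exact: hd1.2].
have I2 : (\int[vol]_x (K (e2 R) (fun x => x.1.2) (fun y => (phi y).1.2) x)%:E = 0)%E.
  apply: (integral_derive2 r0 _ _ (o2 (fun y => (phi y).1.2)) (oK _ _ _)).
    by move=> x; apply: dK; [exact: hd2.1|have [] := is_derive_sqn (is_derive_cutoff a (r ^+ 2) (sqn x))].
  by apply: cK; [exact: continuous_x2|exact: h2|exact: hd2.2].
have I3 : (\int[vol]_x (K (e3 R) (fun x => x.2) (fun y => (phi y).2) x)%:E = 0)%E.
  apply: (integral_derive3 r0 _ _ (o2 (fun y => (phi y).2)) (oK _ _ _)).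
    by move=> x; apply: dK; [exact: hd3.1|have [] := is_derive_sqn (is_derive_cutoff a (r ^+ 2) (sqn x))].
  by apply: cK; [exact: continuous_x3|exact: h3|exact: hd3.2].
have J1 := iK (e1 R) _ _ continuous_x1 h1 hd1.2.
have J2 := iK (e2 R) _ _ continuous_x2 h2 hd2.2.
have J3 := iK (e3 R) _ _ continuous_x3 h3 hd3.2.
have J12 := integrableD measurableT J1 J2.
have HE : EFin \o H = (fun x => (((EFin \o K (e1 R) (fun x => x.1.1) (fun y => (phi y).1.1)) x +
  (EFin \o K (e2 R) (fun x => x.1.2) (fun y => (phi y).1.2)) x) +
  (EFin \o K (e3 R) (fun x => x.2) (fun y => (phi y).2)) x)%E).
  apply/funext => x; rewrite /= -!EFinD; congr EFin.
  by rewrite /H /K /div3 -/(f x) -/(df x); ring.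
split; first by rewrite HE; exact: integrableD.
transitivity (\int[vol]_x ((EFin \o H) x))%E; first by [].
rewrite HE (integralD measurableT J12 J3) (integralD measurableT J1 J2).
change (\int[vol]_x (K (e1 R) (fun x => x.1.1) (fun y => (phi y).1.1) x)%:E +
  \int[vol]_x (K (e2 R) (fun x => x.1.2) (fun y => (phi y).1.2) x)%:E +
  \int[vol]_x (K (e3 R) (fun x => x.2) (fun y => (phi y).2) x)%:E = 0)%E.
by rewrite I1 I2 I3 !adde0.
Qed.

End BallPerimeter.

Section BallFlux.
Context {R : realType}.
Notation mu := (@lebesgue_measure R).
Notation T3 := (R3 (measurableTypeR R)).
Notation vol := (vol3 R).

Lemma eucl_sqn (x : R3 R) : eucl x ^+ 2 = sqn x.
Proof. exact: eucl_sqr. Qed.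

Lemma eucl_ge0 (x : R3 R) : 0 <= eucl x. Proof. exact: sqrtr_ge0. Qed.

Lemma dot_le (x y : R3 R) :
  x.1.1 * y.1.1 + x.1.2 * y.1.2 + x.2 * y.2 <= eucl x * eucl y.
Proof.
apply: (le_trans (ler_norm _)); rewrite -ler_sqr ?nnegrE ?mulr_ge0 ?eucl_ge0//.
rewrite exprMn !eucl_sqn real_normK ?num_real// /sqn -subr_ge0.
have -> : (x.1.1 ^+ 2 + x.1.2 ^+ 2 + x.2 ^+ 2) * (y.1.1 ^+ 2 + y.1.2 ^+ 2 + y.2 ^+ 2) -
  (x.1.1 * y.1.1 + x.1.2 * y.1.2 + x.2 * y.2) ^+ 2 =
  (x.1.1 * y.1.2 - x.1.2 * y.1.1) ^+ 2 + (x.1.2 * y.2 - x.2 * y.1.2) ^+ 2 +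
  (x.2 * y.1.1 - x.1.1 * y.2) ^+ 2 by ring.
by rewrite !addr_ge0 ?sqr_ge0.
Qed.

Lemma is_derive_coord (x : R3 R) (a b c : R) (u v w : R) :
  is_derive x (a, b, c) (fun y : R3 R => u * y.1.1 + v * y.1.2 + w * y.2) (u * a + v * b + w * c).
Proof.
apply: is_derive_line; case: x => -[p q] s.
change (is_derive (0 : R) 1 (fun t : R => u * (t * a + p) + v * (t * b + q) + w * (t * c + s)) (u * a + v * b + w * c)).
by dereq; rewrite /=; ring.
Qed.

Lemma C1_coord (u v w : R) : C1 (fun y : R3 R => u * y.1.1 + v * y.1.2 + w * y.2).
Proof.
move=> [[a b] c] _; split=> [x|].
  by have [] := is_derive_coord x a b c u v w.
have -> : (fun x : R3 R => 'D_(a, b, c) (fun y : R3 R => u * y.1.1 + v * y.1.2 + w * y.2) x) =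
    cst (u * a + v * b + w * c).
  by apply/funext => x; have [_ ->] := is_derive_coord x a b c u v w.
by move=> x; exact: cvg_cst.
Qed.

Lemma coord1E : (fun y : R3 R => y.1.1) = (fun y : R3 R => 1 * y.1.1 + 0 * y.1.2 + 0 * y.2).
Proof. by apply/funext => y; rewrite mul1r !mul0r !addr0. Qed.
Lemma coord2E : (fun y : R3 R => y.1.2) = (fun y : R3 R => 0 * y.1.1 + 1 * y.1.2 + 0 * y.2).
Proof. by apply/funext => y; rewrite mul1r !mul0r addr0 add0r. Qed.
Lemma coord3E : (fun y : R3 R => y.2) = (fun y : R3 R => 0 * y.1.1 + 0 * y.1.2 + 1 * y.2).
Proof. by apply/funext => y; rewrite mul1r !mul0r !add0r. Qed.

Lemma div3_id (x : R3 R) : div3 id x = 3.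
Proof.
rewrite /div3 coord1E coord2E coord3E.
rewrite (@derive_val _ _ _ _ _ _ _ (is_derive_coord x 1 0 0 1 0 0)).
rewrite (@derive_val _ _ _ _ _ _ _ (is_derive_coord x 0 1 0 0 1 0)).
rewrite (@derive_val _ _ _ _ _ _ _ (is_derive_coord x 0 0 1 0 0 1)).
by ring.
Qed.

Lemma measurable_ball_indic (r : R) : measurable_fun [set: T3] (ball_indic r : T3 -> R).
Proof.
apply: measurable_fun_ifT; [|exact: measurable_cst|exact: measurable_cst].
apply: measurable_fun_ltr; last exact: measurable_cst.
by apply: measurable_funX; exact: measurable_eucl.
Qed.

Lemma ball_indic_box (r : R) (x : R3 R) : 0 <= r -> ~ box r x -> ball_indic r x = 0.
Proof. by move=> r0 /(sqn_box r0) h; rewrite /ball_indic eucl_sqn ltNge h. Qed.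

Lemma ball_indic_bound (r : R) (x : R3 R) : `|ball_indic r x| <= 1.
Proof. by rewrite /ball_indic; case: ifP => _; rewrite ?normr1 ?normr0. Qed.

Lemma integrable_ball_indic (r : R) : 0 <= r -> vol.-integrable setT (EFin \o ball_indic r).
Proof.
move=> r0; apply: (@integrable_bounded_box R _ 1 r).
- exact: measurable_ball_indic.
- exact: ball_indic_bound.
- by move=> x; exact: ball_indic_box.
Qed.

Lemma continuous_div3 (phi : R3 R -> R3 R) :
  C1 (fun y => (phi y).1.1) -> C1 (fun y => (phi y).1.2) -> C1 (fun y => (phi y).2) ->
  continuous (div3 phi).
Proof.
move=> h1 h2 h3; rewrite /div3; apply: continuous_addf; first apply: continuous_addf.
- exact: (h1 (e1 R) (or_introl erefl)).2.
- exact: (h2 (e2 R) (or_intror (or_introl erefl))).2.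
- exact: (h3 (e3 R) (or_intror (or_intror erefl))).2.
Qed.

(** The cut-off integration by parts trades the flux of [phi] for the integral of
[- cutoff' * 2 x . phi], and [x . phi x <= |x| <= |x|^2 / (th r)] on the shell
[th r <= |x| <= r] where the derivative of the cut-off lives.  The same identity for
the field [x], whose divergence is [3], evaluates what is left.  The last term is the
error made by replacing the indicator by the cut-off on the shell. *)
Lemma flux_ball_le (phi : R3 R -> R3 R) (r th M : R) : 0 < r -> 0 < th < 1 ->
  test_field phi -> (forall x, box r x -> `|div3 phi x| <= M) ->
  (\int[vol]_x (ball_indic r x * div3 phi x)%:E <=
   (4 * pi * r ^+ 2 / th + M * (4 / 3 * pi * r ^+ 3 * (1 - th ^+ 3)))%:E)%E.
Proof.
move=> r0 /andP[th0 th1] [[h1 [h2 h3]] _ phi1] hM.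
have rr : 0 <= r := ltW r0.
have tr0 : 0 < th * r by rewrite mulr_gt0.
pose a := (th * r) ^+ 2.
have ar : a < r ^+ 2.
  by rewrite /a exprMn gtr_pMl ?exprn_gt0// exprn_ilt1// ltW.
pose f x := cutoff a (r ^+ 2) (sqn x); pose df x := dcutoff a (r ^+ 2) (sqn x).
pose A x := f x * div3 phi x + df x * (2 * (x.1.1 * (phi x).1.1 + x.1.2 * (phi x).1.2 + x.2 * (phi x).2)).
pose B (x : R3 R) := f x * div3 id x + df x * (2 * (x.1.1 * x.1.1 + x.1.2 * x.1.2 + x.2 * x.2)).
have [iA IA] : vol.-integrable setT (EFin \o A) /\ (\int[vol]_x (A x)%:E = 0)%E.
  exact: integral_cutoff_div.
have [iB IB] : vol.-integrable setT (EFin \o B) /\ (\int[vol]_x (B x)%:E = 0)%E.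
  apply: (@integral_cutoff_div R id) => //.
  - by rewrite coord1E; exact: C1_coord.
  - by rewrite coord2E; exact: C1_coord.
  - by rewrite coord3E; exact: C1_coord.
have i1 := integrable_ball_indic rr.
have i2 := integrable_ball_indic (ltW tr0).
pose k := (th * r)^-1.
have k0 : 0 < k by rewrite invr_gt0.
have point x : ball_indic r x * div3 phi x <=
    A x - k * B x + (3 * k * ball_indic r x + M * (ball_indic r x - ball_indic (th * r) x)).
  have fb := cutoff_bounds a (r ^+ 2) (sqn x); have dfn := dcutoff_le0 ar (sqn x).
  rewrite -/(f x) in fb; rewrite -/(df x) in dfn.
  have dot := dot_le x (phi x); have p1 := phi1 x; have ex := eucl_ge0 x.
  set d := x.1.1 * (phi x).1.1 + _ + _ in dot.
  have dx : d <= eucl x by apply: (le_trans dot); rewrite ler_piMr.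
  have dA : A x = f x * div3 phi x + df x * (2 * d) by [].
  have dB : B x = 3 * f x + df x * (2 * eucl x ^+ 2).
    by rewrite /B div3_id eucl_sqn /sqn; ring.
  have key : df x * (2 * eucl x ^+ 2) * k <= df x * (2 * d).
    have [dx0|dx0] := eqVneq (df x) 0; first by rewrite dx0 !mul0r.
    have ltx : th * r <= eucl x.
      rewrite leNgt; apply/negP => xt; move/eqP: dx0; apply.
      apply: (proj2 (cutoff_le ar _)); rewrite -eucl_sqn /a.
      by rewrite ler_sqr ?nnegrE// ltW.
    rewrite -mulrA ler_wnM2l// -mulrA ler_pM2l// (le_trans dx)//.
    by rewrite /k ler_pdivlMr// expr2 ler_wpM2l.
  rewrite dA dB; have [xr|xr] := leP (r ^+ 2) (sqn x).
    have [f0 d0] := cutoff_ge ar xr; rewrite -/(f x) in f0; rewrite -/(df x) in d0.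
    have b0 : ball_indic r x = 0 by rewrite /ball_indic eucl_sqn ltNge xr.
    have b1 : ball_indic (th * r) x = 0.
      by rewrite /ball_indic eucl_sqn ltNge (le_trans (ltW ar) xr).
    by rewrite b0 b1 f0 d0 subrr !(mul0r, mulr0, addr0, subr0).
  have b0 : ball_indic r x = 1 by rewrite /ball_indic eucl_sqn xr.
  have Mx : `|div3 phi x| <= M.
    by apply: hM; apply: contrapT => /(sqn_box rr); rewrite leNgt xr.
  rewrite b0 !mulr1.
  have [xt|xt] := ltP (sqn x) a.
    have [f1 _] := cutoff_le ar (ltW xt); rewrite -/(f x) in f1.
    have b1 : ball_indic (th * r) x = 1 by rewrite /ball_indic eucl_sqn xt.
    rewrite b1 f1; move: key; clear; nra.
  have b1 : ball_indic (th * r) x = 0 by rewrite /ball_indic eucl_sqn ltNge xt.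
  rewrite b1 subr0 mulr1.
  move: Mx; rewrite ler_norml => /andP[m1 m2].
  move: fb => /andP[f0 f1].
  have q1 : (1 - f x) * div3 phi x <= M.
    apply: (@le_trans _ _ ((1 - f x) * M)); first by rewrite ler_wpM2l// subr_ge0.
    by rewrite ler_piMl ?gerBl//; move: m1 m2; clear; lra.
  have q2 : k * (3 * f x) <= 3 * k.
    by rewrite mulrC mulrAC ler_piMr// mulr_ge0// ltW.
  move: key q1 q2; clear; nra.
have mchi := measurable_ball_indic r.
have cdiv := continuous_div3 h1 h2 h3.
have iX : vol.-integrable setT (EFin \o (fun x : T3 => ball_indic r x * div3 phi x)).
  apply: (@integrable_bounded_box R _ `|M| r).
  - by apply: measurable_funM; [exact: mchi|exact: continuous_measurable3].
  - move=> x; have [xb|/(ball_indic_box rr) ->] := pselect (box r x).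
      rewrite normrM (le_trans (ler_piMl _ (ball_indic_bound r x)))//.
      by rewrite (le_trans (hM x xb))// ler_norm.
    by rewrite mul0r normr0.
  - by move=> x /(ball_indic_box rr) ->; rewrite mul0r.
have ikB : vol.-integrable setT (fun x => ((EFin \o A) x - k%:E * (EFin \o B) x)%E).
  by apply: integrableB => //; exact: integrableZl.
have i3 : vol.-integrable setT (fun x => ((3 * k)%:E * (EFin \o ball_indic r) x)%E).
  exact: integrableZl.
have i12 : vol.-integrable setT (fun x => ((EFin \o ball_indic r) x - (EFin \o ball_indic (th * r)) x)%E).
  exact: integrableB.
have i4 : vol.-integrable setT (fun x => (M%:E * ((EFin \o ball_indic r) x - (EFin \o ball_indic (th * r)) x))%E).
  exact: integrableZl.
have i34 := integrableD measurableT i3 i4.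
have iR := integrableD measurableT ikB i34.
apply: le_trans (le_integral measurableT iX iR _) _ => [x _|].
  by have := point x; rewrite -lee_fin.
rewrite (integralD measurableT ikB i34) (integralD measurableT i3 i4).
rewrite (integralB measurableT iA (integrableZl measurableT k iB)).
rewrite !integralZl// (integralB measurableT i1 i2).
change (\int[vol]_x (A x)%:E - k%:E * \int[vol]_x (B x)%:E + ((3 * k)%:E * mass (ball_indic r) +
  M%:E * (mass (ball_indic r) - mass (ball_indic (th * r)))) <=
  (4 * pi * r ^+ 2 / th + M * (4 / 3 * pi * r ^+ 3 * (1 - th ^+ 3)))%:E)%E.
rewrite IA IB mule0 sube0 add0e (mass_ball rr) (mass_ball (ltW tr0)).
have -> : 4 * pi * r ^+ 2 / th + M * (4 / 3 * pi * r ^+ 3 * (1 - th ^+ 3)) =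
  3 * k * (4 / 3 * pi * r ^+ 3) + M * (4 / 3 * pi * r ^+ 3 - 4 / 3 * pi * (th * r) ^+ 3).
  by rewrite /k; field; rewrite !gt_eqF.
exact: lexx.
Qed.

(** Let [th] tend to [1] in [flux_ball_le]. *)
Lemma TV_ball (r : R) : 0 < r -> (TV3 (ball_indic r) <= (4 * pi * r ^+ 2)%:E)%E.
Proof.
move=> r0; apply: ge_ereal_sup => _ [phi tphi <-].
have [[h1 [h2 h3]] _ _] := tphi.
have [M M0 hM] := continuous_bounded_box r (continuous_div3 h1 h2 h3).
apply/lee_addgt0Pr => eps eps0; rewrite -EFinD.
pose c := 4 * pi * r ^+ 2.
have p4 : 0 <= 4 * pi :> R by rewrite mulr_ge0 ?pi_ge0.
have c0 : 0 <= c := mulr_ge0 p4 (sqr_ge0 r).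
have r3 : 0 <= r ^+ 3 by rewrite exprn_ge0// ltW.
pose D := 2 * c + M * (4 * pi * r ^+ 3).
have D0 : 0 <= D by rewrite addr_ge0// mulr_ge0// mulr_ge0.
pose dl := Num.min (1 / 2) (eps / (D + 1)).
have dl0 : 0 < dl by rewrite lt_min divr_gt0//= divr_gt0// ltr_wpDl.
have dl1 : dl <= 1 / 2 by rewrite ge_min lexx.
have dlD : dl * D <= eps.
  have : dl * (D + 1) <= eps by rewrite -ler_pdivlMr ?ltr_wpDl// ge_min lexx orbT.
  by apply: le_trans; rewrite ler_wpM2l ?(ltW dl0)// lerDl.
pose th := 1 - dl.
have th01 : 0 < th < 1 by rewrite /th; apply/andP; split; lra.
apply: le_trans (flux_ball_le r0 th01 tphi hM) _; rewrite lee_fin.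
rewrite -/c; have th0 : 0 < th by case/andP: th01.
have e1 : c / th <= c + 2 * c * dl.
  rewrite ler_pdivrMr// -subr_ge0.
  have -> : (c + 2 * c * dl) * th - c = c * (dl * (1 - 2 * dl)) by rewrite /th; ring.
  by rewrite mulr_ge0// mulr_ge0 ?(ltW dl0)//; move: dl1; clear; lra.
have e2 : 1 - th ^+ 3 <= 3 * dl.
    rewrite -subr_ge0.
    have -> : 3 * dl - (1 - th ^+ 3) = dl ^+ 2 * (3 - dl) by rewrite /th; ring.
    by rewrite mulr_ge0 ?sqr_ge0//; move: dl1; clear; lra.
have e3 : M * (4 / 3 * pi * r ^+ 3 * (1 - th ^+ 3)) <= M * (4 * pi * r ^+ 3) * dl.
  rewrite -[leRHS]mulrA; apply: ler_wpM2l => //.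
  have p0 : 0 <= 4 / 3 * pi * r ^+ 3 by rewrite mulr_ge0// mulr_ge0 ?pi_ge0// divr_ge0.
  apply: (le_trans (ler_wpM2l p0 e2)); rewrite le_eqVlt; apply/orP; left; apply/eqP.
  by field.
have -> : c + eps = c + 2 * c * dl + M * (4 * pi * r ^+ 3) * dl + (eps - dl * D).
  by rewrite /D; ring.
by move: e1 e3 dlD; clear; lra.
Qed.

End BallFlux.

(** * The constants and the upper bound *)

Section Constants.
Context {R : realType}.
Notation mu := (@lebesgue_measure R).

Lemma sigmaE : sigma R = Num.sqrt (8 / 9).
Proof.
have s2 : 0 < Num.sqrt 2 :> R by rewrite sqrtr_gt0.
have s22 : Num.sqrt 2 ^+ 2 = 2 :> R by rewrite sqr_sqrtr.
have -> : sigma R = \int[mu]_(s in `[(-1 : R), 1]) ((1 - s ^+ 2) / Num.sqrt 2).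
  apply: eq_Rintegral => s; rewrite inE /= in_itv /= => /andP[s1 s3].
  have w0 : 0 <= 1 - s ^+ 2 by nra.
  rewrite /W; have -> : 2 * (4^-1 * (1 - s ^+ 2) ^+ 2) = ((1 - s ^+ 2) / Num.sqrt 2) ^+ 2.
    by rewrite exprMn exprVn s22; field.
  by rewrite sqrtr_sqr ger0_norm// divr_ge0// ltW.
have d (s : R) : -1 <= s <= 1 -> is_derive s 1
    (fun s => (s - s ^+ 3 / 3) / Num.sqrt 2) ((1 - s ^+ 2) / Num.sqrt 2).
  by move=> _; dereq; rewrite /=; field; rewrite gt_eqF.
have c1 : continuous (fun s : R => (1 - s ^+ 2) / Num.sqrt 2).
  by move=> s; apply: is_derive_continuous; der.
have m11 : -1 <= 1 :> R by lra.
rewrite /Rintegral (ftc m11 d); last exact: continuous_subspaceT.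
have -> : 8 / 9 = (4 / 3 / Num.sqrt 2) ^+ 2 :> R.
  by rewrite !exprMn !exprVn s22; field.
rewrite sqrtr_sqr ger0_norm ?divr_ge0 ?ltW//=.
by field; rewrite gt_eqF.
Qed.

Lemma kappa_sqr : kappa R ^+ 2 = 1 / 2.
Proof.
have dW (x : R) : is_derive x 1 (@W R) (x ^+ 3 - x).
  by rewrite /W; dereq; rewrite /=; field.
have W1 : derive1 (@W R) = (fun x => x ^+ 3 - x).
  by apply/funext => x; exact: der_derive1 (dW x).
have W2 : ((@W R)^`(2))%classic 1 = 2.
  rewrite derive1Sn /derive1n /= W1.
  have d2 : is_derive (1 : R) 1 (fun x => x ^+ 3 - x) 2 by dereq; rewrite /=; ring.
  exact: der_derive1 d2.
by rewrite /kappa W2 exprVn sqr_sqrtr// mul1r.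
Qed.

Lemma prefactorE :
  2 `^ (- 3^-1) * sigma R `^ (2 / 3) * kappa R ^+ 2 = 18 `^ (- 3^-1).
Proof.
rewrite kappa_sqr sigmaE.
have -> : Num.sqrt (8 / 9) `^ (2 / 3) = (8 / 9) `^ (3^-1) :> R.
  rewrite -powR12_sqrt ?divr_ge0// -powRrM; congr powR; by field.
have inv (x : R) : 0 < x -> x `^ (- 3^-1) = (x^-1) `^ (3^-1).
  by move=> x0; rewrite -[in RHS](powR_inv1 (ltW x0)) -powRrM mulN1r.
rewrite !inv//.
have -> : 1 / 2 = (8^-1) `^ (3^-1) :> R.
  have -> : 8^-1 = (1 / 2) `^ 3 :> R.
    by rewrite (powR_mulrn 3) ?divr_ge0//; field.
  by rewrite -powRrM divff ?powRr1 ?divr_ge0.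
rewrite -!powRM ?invr_ge0 ?divr_ge0 ?mulr_ge0 ?invr_ge0//.
by congr powR; field.
Qed.

Lemma BV01_ball (r : R) : 0 < r -> BV01 (ball_indic r).
Proof.
move=> r0; split.
- by move=> x; rewrite /ball_indic; case: ifP => _; [right|left].
- by apply: integrable_ball_indic; exact: ltW.
- by apply: le_lt_trans (TV_ball r0) _; rewrite ltry.
Qed.

Lemma f_star_le_ball (r : R) : 0 < r -> (f_star R <= (3 / r + r ^+ 2 / 5)%:E)%E.
Proof.
move=> r0; have rr := ltW r0; have p0 := pi_gt0 R.
have m0 : 0 < 4 / 3 * pi * r ^+ 3 by rewrite !mulr_gt0 ?exprn_gt0.
apply: (@le_trans _ _ (E_infty (ball_indic r) / mass (ball_indic r))%E).
  apply: ereal_inf_lbound; exists (ball_indic r) => //; split; first exact: BV01_ball.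
  by rewrite mass_ball// lte_fin.
rewrite /E_infty coulomb_ball// mass_ball// inver gt_eqF//.
rewrite -EFinM.
have -> : 3 / r + r ^+ 2 / 5 =
  (4 * pi * r ^+ 2 + (8 * pi)^-1 * (32 / 15 * pi ^+ 2 * r ^+ 5)) / (4 / 3 * pi * r ^+ 3).
  have pn : (pi : R) != 0 by rewrite gt_eqF.
  have rn : r != 0 by rewrite gt_eqF.
  by move: (pi : R) pn => p pn; field; rewrite pn rn.
rewrite [X in (_ <= X)%E]EFinM; apply: lee_wpmul2r; first by rewrite lee_fin invr_ge0 ltW.
by rewrite EFinD; apply: leeD => //; exact: TV_ball.
Qed.

(** The radius with [r^3 = 15/2] minimizes [3/r + r^2/5]. *)
Lemma lambda_c_upper : (lambda_c R <= (3 / (2 * 5 `^ (3^-1)))%:E)%E.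
Proof.
rewrite /lambda_c prefactorE.
pose r : R := (15 / 2) `^ (3^-1).
have r0 : 0 < r by rewrite powR_gt0// divr_gt0.
have r3 : r ^+ 3 = 15 / 2.
  by rewrite /r -powR_mulrn ?powR_ge0// -powRrM mulVf// powRr1.
apply: (@le_trans _ _ ((18 `^ (- 3^-1))%:E * (3 / r + r ^+ 2 / 5)%:E)%E).
  by apply: lee_wpmul2l; [rewrite lee_fin powR_ge0|exact: f_star_le_ball].
rewrite -EFinM lee_fin.
have -> : 3 / r + r ^+ 2 / 5 = 9 / 2 / r.
  apply: (@mulIf _ r); first by rewrite gt_eqF.
  rewrite mulrDl !divfK ?gt_eqF//.
  have -> : r ^+ 2 / 5 * r = r ^+ 3 / 5 by ring.
  by rewrite r3; field.
have c18 : 18 `^ (- 3^-1) * r^-1 = (3 * 5 `^ (3^-1))^-1 :> R.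
  rewrite powRN -invfM; congr (_^-1); rewrite /r -powRM ?divr_ge0//.
  have -> : 18 * (15 / 2) = (3 `^ 3) * 5 :> R.
    by rewrite (powR_mulrn 3)//; field.
  by rewrite powRM ?powR_ge0// -powRrM divff ?powRr1.
rewrite le_eqVlt; apply/orP; left; apply/eqP.
rewrite mulrCA c18; field.
by rewrite gt_eqF// powR_gt0.
Qed.

End Constants.

(** * Reflections, translations and spherical integrals *)

Section Isometries.
Context {R : realType}.
Notation mu := (@lebesgue_measure R).
Notation T1 := (measurableTypeR R).
Notation T3 := (R3 (measurableTypeR R)).
Notation leb2 := (sfprod mu mu).
Notation leb3 := (sfprod leb2 mu).

Definition preserves_volume (s : T3 -> T3) :=
  measurable_fun [set: T3] s /\
  forall f : T3 -> \bar R, measurable_fun [set: T3] f -> (forall x, 0 <= f x)%E ->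
    (\int[vol3 R]_x f (s x) = \int[vol3 R]_x f x)%E.

Lemma preserves_volume_comp (s t : T3 -> T3) :
  preserves_volume s -> preserves_volume t -> preserves_volume (fun x => s (t x)).
Proof.
move=> [ms hs] [mt ht]; split; first exact: measurableT_comp ms mt.
move=> f mf f0; rewrite -(hs f mf f0).
exact: (ht _ (measurableT_comp mf ms) (fun x => f0 (s x))).
Qed.

Lemma preserves_volume_swap12 : preserves_volume swap12.
Proof. by split; [exact: measurable_swap12|exact: integral_swap12]. Qed.

Lemma preserves_volume_swap23 : preserves_volume swap23.
Proof. by split; [exact: measurable_swap23|exact: integral_swap23]. Qed.

Definition refl1 (x : T3) : T3 := (- x.1.1, x.1.2, x.2).
Definition refl2 (x : T3) : T3 := (x.1.1, - x.1.2, x.2).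
Definition refl3 (x : T3) : T3 := (x.1.1, x.1.2, - x.2).

(** A quarter turn followed by an exchange of coordinates is a reflection. *)
Lemma preserves_volume_refl3 : preserves_volume refl3.
Proof.
have -> : refl3 = (fun x => rot23 0 1 (swap23 x)).
  by apply/funext => x; rewrite /rot23 /swap23 /= /refl3; congr (_, _, _); ring.
apply: preserves_volume_comp preserves_volume_swap23.
split; first exact: measurable_rot23.
by move=> f; apply: integral_rot23 => //; rewrite expr0n expr1n add0r.
Qed.

Lemma preserves_volume_refl2 : preserves_volume refl2.
Proof.
have -> : refl2 = (fun x => swap23 (refl3 (swap23 x))) by [].
apply: preserves_volume_comp preserves_volume_swap23 _.
exact: preserves_volume_comp preserves_volume_refl3 preserves_volume_swap23.
Qed.

Lemma preserves_volume_refl1 : preserves_volume refl1.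
Proof.
have -> : refl1 = (fun x => swap12 (refl2 (swap12 x))) by [].
apply: preserves_volume_comp preserves_volume_swap12 _.
exact: preserves_volume_comp preserves_volume_refl2 preserves_volume_swap12.
Qed.

Lemma preserves_volume_shift3 (c : R) :
  preserves_volume (fun x => (x.1.1, x.1.2, x.2 + c)).
Proof.
have ms : measurable_fun [set: T3] (fun x : T3 => (x.1.1, x.1.2, x.2 + c) : T3).
  apply: measurable_fun_pair.
    by apply: measurable_fun_pair; [exact: measurable_x1|exact: measurable_x2].
  by apply: measurable_funD; [exact: measurable_x3|exact: measurable_cst].
split=> // f mf f0; rewrite (tonelli3 mf f0).
have mfs := measurableT_comp mf ms.
rewrite (tonelli3 mfs (fun x => f0 _)).
apply: eq_integral => a _; apply: eq_integral => b _.
apply: (@integral_shift _ c (fun z => f (a, b, z))) => //.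
apply: (measurableT_comp mf); apply: measurable_fun_pair; last exact: measurable_id.
by apply: measurable_fun_pair; exact: measurable_cst.
Qed.

Lemma preserves_volume_sub (c : R3 R) : preserves_volume (fun y => c - y).
Proof.
pose t3 (u : R) (x : T3) : T3 := (x.1.1, x.1.2, x.2 + u).
have -> : (fun y : T3 => c - y : T3) = (fun x => t3 c.2 (swap23 (t3 c.1.2 (swap23
    (swap12 (swap23 (t3 c.1.1 (swap23 (swap12 (refl1 (refl2 (refl3 x)))))))))))).
  apply/funext => -[[x y] z]; case: c => -[c1 c2] c3.
  by congr (_, _, _); rewrite /= addrC.
have h3 u : preserves_volume (t3 u) := preserves_volume_shift3 u.
have h12 := preserves_volume_swap12; have h23 := preserves_volume_swap23.
have r1 := preserves_volume_refl1; have r2 := preserves_volume_refl2.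
have r3 := preserves_volume_refl3.
apply: (preserves_volume_comp (h3 _)); apply: (preserves_volume_comp h23).
apply: (preserves_volume_comp (h3 _)); apply: (preserves_volume_comp h23).
apply: (preserves_volume_comp h12); apply: (preserves_volume_comp h23).
apply: (preserves_volume_comp (h3 _)); apply: (preserves_volume_comp h23).
apply: (preserves_volume_comp h12); apply: (preserves_volume_comp r1).
exact: (preserves_volume_comp r2 r3).
Qed.

Lemma measure_sq_le (s : R) : mu [set z : T1 | z ^+ 2 <= s] = (2 * Num.sqrt s)%:E.
Proof.
have [s0|s0] := leP 0 s; last first.
  rewrite ltr0_sqrtr// mulr0 [X in mu X](_ : _ = set0) ?measure0//.
  by apply/seteqP; split => y //=; rewrite leNgt (lt_le_trans s0)// sqr_ge0.
have -> : [set z : T1 | z ^+ 2 <= s] = `[(- Num.sqrt s), (Num.sqrt s)]%classic.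
  by apply/seteqP; split => y /=; rewrite in_itv /= -ler_norml -sqrtr_sqr ler_sqrt.
rewrite lebesgue_measure_itv /= lte_fin -EFinB.
have := sqrtr_ge0 s; rewrite le_eqVlt => /predU1P[<-|q0].
  by rewrite oppr0 ltxx mulr0.
by rewrite gtrN// ?q0; congr EFin; ring.
Qed.

(** The level set [|x|^2 = s] is sliced at height [z]; the heights that occur form
an interval of length [2 sqrt s], so the weight [pi * 2 sqrt s] comes from
cylindrical coordinates and one exchange of integrals.  Since [sqrt] vanishes on
negative numbers, the integral in [s] may run over the whole line. *)
Lemma integral_spherical (f : T1 -> \bar R) : measurable_fun [set: T1] f ->
  (forall s, 0 <= f s)%E ->
  (\int[vol3 R]_x f (sqn x) = \int[mu]_s ((2 * pi * Num.sqrt s)%:E * f s))%E.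
Proof.
move=> mf f0.
have madd : measurable_fun [set: T1 * T1] (fun p : T1 * T1 => p.1 + p.2 ^+ 2 : T1).
  by apply: measurable_funD; [exact: measurable_fst|apply: measurable_funX; exact: measurable_snd].
have mh := measurableT_comp mf madd.
rewrite (integral_cylindrical mh (fun x => f0 _)) /=.
pose k (p : T1 * T1) : \bar R := (if (p.1 ^+ 2 <= p.2)%R then f p.2 else 0)%E.
have mk : measurable_fun [set: T1 * T1] k.
  apply: measurable_fun_ifT; last exact: measurable_cst.
    apply: measurable_fun_ler; last exact: measurable_snd.
    by apply: measurable_funX; exact: measurable_fst.
  exact: (measurableT_comp mf measurable_snd).
have k0 p : (0 <= k p)%E by rewrite /k; case: ifP.
have inner (z : T1) : (\int[mu]_(s in `[0%R, +oo[) f (s + z ^+ 2)%R = \int[mu]_s k (z, s))%E.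
  have mkz : measurable_fun [set: T1] (fun s : T1 => k (z, s)).
    by apply: (measurableT_comp mk); apply: measurable_fun_pair; [exact: measurable_cst|exact: measurable_id].
  rewrite -(integral_shift (z ^+ 2) mkz (fun s => k0 _)) integral_mkcond.
  apply: eq_integral => s _; rewrite patchE mem_setE in_itv /= andbT /k /=.
  by rewrite lerDr.
under eq_integral do rewrite inner.
rewrite ge0_integralZl; first last.
- by rewrite lee_fin pi_ge0.
- by move=> z _; apply: integral_ge0.
- exact: (@measurable_fun_fubini_tonelli_F _ _ _ _ _ mu k mk k0).
- exact: measurableT.
have h := @fubini_tonelli _ _ _ _ _ mu mu k mk k0; rewrite h.
have E (s : T1) : (\int[mu]_z k (z, s) = (2 * Num.sqrt s)%:E * f s)%E.
  have mB : measurable [set z : T1 | z ^+ 2 <= s].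
    rewrite -[X in measurable X]setTI; apply: (measurable_fun_ler _ _ measurableT (Y := [set true])) => //.
  rewrite -measure_sq_le muleC -(integral_cst mu mB) integral_mkcond.
  apply: eq_integral => z _; rewrite patchE /k /= mem_setE.
  by [].
under eq_integral do rewrite E.
rewrite -ge0_integralZl.
- by apply: eq_integral => s _; rewrite muleA -EFinM; congr (_%:E * _)%E; ring.
- exact: measurableT.
- apply: emeasurable_funM => //; apply/measurable_EFinP.
  apply: measurable_funM; first exact: measurable_cst.
  exact: continuous_measurable_fun (@sqrt_continuous R).
- by move=> s _; rewrite mule_ge0// lee_fin mulr_ge0// sqrtr_ge0.
- by rewrite lee_fin pi_ge0.
Qed.

End Isometries.

(** * Convolution with compactly supported functions *)

Section Convolution.
Context {R : realType}.
Notation T3 := (R3 (measurableTypeR R)).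
Notation vol := (vol3 R).
Implicit Types (K G k : R3 R -> R) (x y z e : R3 R) (r L w : R).

Definition conv K G x : R := \int[vol]_y (K (x - y) * G y).

Lemma continuous_reflect_translate K x : continuous K -> continuous (fun y => K (x - y)).
Proof.
by move=> cK; apply: (continuous_o cK) => y; apply: cvgB; [exact: cvg_cst|exact: cvg_id].
Qed.

Lemma integrable_mul_compact k G L : continuous k -> continuous G ->
  (forall y, ~ box L y -> G y = 0) ->
  vol.-integrable setT (EFin \o (fun y : T3 => k y * G y)).
Proof.
move=> ck cG G0; apply: (@continuous_integrable_box _ _ L); first exact: continuous_mulf.
by move=> y /G0 ->; rewrite mulr0.
Qed.

Lemma le_Rintegral_mul k G L w : continuous k -> continuous G ->
  (forall y, ~ box L y -> G y = 0) -> (forall y, `|k y| <= w) ->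
  `|\int[vol]_y (k y * G y)| <= w * \int[vol]_y `|G y|.
Proof.
move=> ck cG G0 kw; have ikG := integrable_mul_compact ck cG G0.
have cnG : continuous (fun y => `|G y|) by move=> y; exact: cvg_norm (cG y).
have inG : vol.-integrable setT (EFin \o (fun y : T3 => `|G y|)).
  by apply: (@continuous_integrable_box _ _ L cnG) => y /G0 ->; rewrite normr0.
apply: (le_trans (le_normr_Rintegral measurableT ikG)).
rewrite -RintegralZl//.
apply: le_Rintegral => //.
- have := integrable_mul_compact ck cG G0; move/integrable_norm.
  by [].
- exact: (integrableZl measurableT w inG).
- by move=> y _; rewrite normrM ler_wpM2r.
Qed.

(** Compactness of a slightly larger box gives uniformity there; outside of it
both values vanish. *)
Lemma uniformly_continuous_compact K r w : continuous K -> (forall y, ~ box r y -> K y = 0) ->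
  0 < w -> \forall h \near (0 : R3 R), forall z, `|K (h + z) - K z| <= w.
Proof.
move=> cK K0 w0; have cB := @compact_box R (r + 1).
have /(_ _ (nbhs (0 : R3 R)) (fun h z => `|K (h + z) - K z| <= w) _) H :=
  (compact_near_coveringP _).1 cB.
have near1 : \forall h \near (0 : R3 R), forall z, ~ box (r + 1) z -> `|K (h + z) - K z| <= w.
  have nb : nbhs (0 : R3 R) (ball (0 : R3 R) 1) by exact: (nbhsx_ballx (0 : R3 R) 1 ltr01).
  apply: filterS nb => h; rewrite /ball /= => -[[]]; rewrite /ball /= !sub0r !normrN => h1 h2 h3.
  move=> z nz; rewrite !K0 ?subrr ?normr0 ?(ltW w0)//.
    by apply: contra_not nz => -[z1 z2 z3]; split; rewrite ?(le_trans z1) ?(le_trans z2) ?(le_trans z3)// lerDl.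
  apply: contra_not nz => -[/= z1 z2 z3].
  have T (u v : R) : `|u| < 1 -> `|u + v| <= r -> `|v| <= r + 1.
    move=> u1 uv; rewrite (_ : v = (u + v) - u); last by ring.
    by rewrite (le_trans (ler_normB _ _))// lerD// ltW.
  by split; [exact: T h1 z1|exact: T h2 z2|exact: T h3 z3].
suff near2 : \forall h \near (0 : R3 R), box (r + 1) `<=` [set z | `|K (h + z) - K z| <= w].
  apply: filterS2 near1 near2 => h h1 h2 z.
  by have [/h2|/h1] := pselect (box (r + 1) z).
apply: H => x _.
pose q (p : R3 R * R3 R) := `|K (p.2 + p.1) - K p.1|.
have cadd : continuous (fun p : R3 R * R3 R => p.2 + p.1).
  by move=> p; apply: cvgD; [exact: continuous_pr2|exact: continuous_pr1].
have ck2 : continuous (fun p : R3 R * R3 R => K (p.2 + p.1)) := continuous_o cK cadd.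
have ck1 : continuous (fun p : R3 R * R3 R => K p.1) := continuous_o cK continuous_pr1.
have cq : continuous q by move=> p; apply: cvg_norm; apply: cvgB; [exact: ck2|exact: ck1].
have q0 : q (x, 0) = 0 by rewrite /q /= add0r subrr normr0.
have c0 : q @ nbhs ((x, 0) : R3 R * R3 R) --> 0 by rewrite -q0; exact: cq.
apply: (c0 [set u | u <= w]).
by apply: filterS (@lt_nbhsl _ 0 w w0) => u /ltW.
Qed.

Lemma continuous_conv K G r L : continuous K -> (forall y, ~ box r y -> K y = 0) ->
  continuous G -> (forall y, ~ box L y -> G y = 0) -> continuous (conv K G).
Proof.
move=> cK K0 cG G0 x; pose I := \int[vol]_y `|G y|.
have I0 : 0 <= I by apply: Rintegral_ge0.
apply/cvgrPdist_le => w w0.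
have I1 : 0 < I + 1 by rewrite ltr_wpDl.
have h := uniformly_continuous_compact cK K0 (divr_gt0 w0 I1).
have cs : (fun x' : R3 R => x' - x) @ x --> (0 : R3 R).
  by rewrite -[X in _ --> X](subrr x); apply: cvgB; [exact: cvg_id|exact: cvg_cst].
near=> x'; have hx' : forall z, `|K ((x' - x) + z) - K z| <= w / (I + 1).
  by near: x'; exact: (cs _ h).
have ck x0 := continuous_reflect_translate (x := x0) cK.
rewrite distrC /conv -RintegralB//; last 2 first.
- exact: integrable_mul_compact (ck x') cG G0.
- exact: integrable_mul_compact (ck x) cG G0.
have -> : \int[vol]_y (K (x' - y) * G y - K (x - y) * G y) =
  \int[vol]_y ((K (x' - y) - K (x - y)) * G y) by apply: eq_Rintegral => y _; rewrite mulrBl.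
apply: (@le_trans _ _ (w / (I + 1) * I)).
  apply: (le_Rintegral_mul _ cG G0) => y; first exact: cvgB (ck x' y) (ck x y).
  by have := hx' (x - y); rewrite addrA subrK.
by rewrite mulrAC ler_pdivrMr// ler_wpM2l ?(ltW w0)// lerDl.
Unshelve. all: end_near. Qed.

(** By the mean value theorem and the uniform continuity of [DK], the increment of
[K] along [t e] differs from [t DK] by [o(t)] uniformly in the base point, so
the estimate survives integration against [G]. *)
Lemma is_derive_conv K DK G e r L x : (forall y, is_derive y e K (DK y)) ->
  continuous K -> continuous DK -> (forall y, ~ box r y -> DK y = 0) ->
  continuous G -> (forall y, ~ box L y -> G y = 0) -> is_derive x e (conv K G) (conv DK G x).
Proof.
move=> dK cK cDK DK0 cG G0; pose I := \int[vol]_y `|G y|.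
have I0 : 0 <= I by apply: Rintegral_ge0.
have I1 : 0 < I + 1 by rewrite ltr_wpDl.
have ck x0 := continuous_reflect_translate (x := x0) cK.
have cdk x0 := continuous_reflect_translate (x := x0) cDK.
have main : (fun t : R => t^-1 *: ((conv K G \o shift x) (t *: e) - conv K G x)) @ 0^' --> conv DK G x.
  apply/cvgrPdist_le => w w0.
  have h := uniformly_continuous_compact cDK DK0 (divr_gt0 w0 I1).
  have cs : (fun t : R => t *: e) @ (0 : R) --> (0 : R3 R).
    by rewrite -[X in _ --> X](scale0r e); apply: cvgZr_tmp; exact: cvg_id.
  have /nbhs_ballP[d /= d0 hd] := cs _ h.
  near=> t; have t0 : t != 0 by near: t; exact: nbhs_dnbhs_neq.
  have td : `|t| < d by near: t; exact: dnbhs0_lt.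
  have td' (s : R) : `|s| <= `|t| -> forall z, `|DK (s *: e + z) - DK z| <= w / (I + 1).
    move=> st; apply: hd; rewrite /ball /= sub0r normrN.
    exact: le_lt_trans st td.
  have E : t * conv DK G x - (conv K G (t *: e + x) - conv K G x) =
     \int[vol]_y ((t * DK (x - y) - (K (t *: e + x - y) - K (x - y))) * G y).
    have i1 := integrable_mul_compact (cdk x) cG G0.
    have i2 := integrable_mul_compact (ck (t *: e + x)) cG G0.
    have i3 := integrable_mul_compact (ck x) cG G0.
    rewrite /conv -RintegralZl// -RintegralB// -RintegralB//.
    + by apply: eq_Rintegral => y _; ring.
    + exact: (integrableZl measurableT t i1).
    + exact: (integrableB measurableT i2 i3).
  have -> : conv DK G x - t^-1 *: ((conv K G \o shift x) (t *: e) - conv K G x) =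
      t^-1 * (t * conv DK G x - (conv K G (t *: e + x) - conv K G x)).
    by rewrite /= /GRing.scale /=; field.
  rewrite E normrM normfV ler_pdivrMl ?normr_gt0//.
  apply: (@le_trans _ _ ((w / (I + 1) * `|t|) * I)); last first.
    rewrite mulrAC mulrC ler_wpM2l// mulrAC ler_pdivrMr// ler_wpM2l ?(ltW w0)//.
    by rewrite lerDl.
  apply: (le_Rintegral_mul _ cG G0) => y.
    apply: cvgB; first by apply: cvgM; [exact: cvg_cst|exact: cdk].
    by apply: cvgB; [exact: ck|exact: ck].
  pose g (s : R) := K (s *: e + (x - y)) - s * DK (x - y).
  have dg (s : R) : is_derive s 1 g (DK (s *: e + (x - y)) + - (1 * DK (x - y) + s * 0)).
    notypeclasses refine (isd_add _ (isd_opp (isd_mul (isd_id s) (isd_cst _ _)))).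
    exact: is_derive_along (dK _).
  have := is_derive_lipschitz dg (M := w / (I + 1)) (d := t) _.
  rewrite /g scale0r add0r mul0r subr0 addrA distrC opprB addrCA.
  rewrite [X in _ -> `|_ + X| <= _]opprB.
  apply => s st; rewrite mul1r mulr0 addr0; exact: td'.
split; first by apply/cvg_ex; exists (conv DK G x).
exact: cvg_lim main.
Unshelve. all: end_near. Qed.

End Convolution.

(** * The regularized radial kernel *)

Lemma isd_inv (R : realType) (f : R -> R) (x a : R) : f x != 0 -> is_derive x 1 f a ->
  is_derive x 1 (fun t => (f t)^-1) (- a / f x ^+ 2).
Proof.
move=> fx df; have D := der_derivable df.
split; first exact: derivableV.
by rewrite deriveV// (@derive_val _ _ _ _ _ _ _ df) /GRing.scale /= mulNr mulrC mulNr.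
Qed.

Lemma continuous_expf (R : realType) (T : topologicalType) (f : T -> R) (n : nat) : continuous f ->
  continuous (fun x => f x ^+ n).
Proof.
move=> cf; elim: n => [|n IH].
  by rewrite (_ : (fun x => f x ^+ 0) = cst 1)//; move=> x; exact: cvg_cst.
rewrite (_ : (fun x => f x ^+ n.+1) = (fun x => f x * f x ^+ n)); first exact: continuous_mulf.
by apply/funext => x; rewrite exprS.
Qed.

Lemma continuous_cstf (R : realType) (T : topologicalType) (k : R) : continuous (fun _ : T => k).
Proof. by move=> x; exact: cvg_cst. Qed.

Section RadialKernel.
Context {R : realType}.
Notation mu := (@lebesgue_measure R).
Notation T1 := (measurableTypeR R).
Notation T3 := (R3 (measurableTypeR R)).
Notation vol := (vol3 R).
Implicit Types (x y z : R3 R) (s u v w a b c : R).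
Variables (e r : R).
Hypotheses (e0 : 0 < e) (r0 : 0 < r).

(** The inverse of the regularized distance, as a function of [s = |z|^2]. *)
Definition isig s : R := (Num.sqrt (s + e ^+ 2))^-1.
Definition taper s : R := Num.max (1 - (s + e ^+ 2) / r ^+ 2) 0.
(** The field [K z = prof (|z|^2) z] is a regularization of [z / |z|^3], cut off at
distance [r].  Its components are [ker 1 0 0], [ker 0 1 0] and [ker 0 0 1]. *)
Definition prof s : R := isig s ^+ 3 * taper s ^+ 2.
Definition dprof s : R := - (3 / 2) * isig s ^+ 5 * taper s ^+ 2 - 2 / r ^+ 2 * isig s ^+ 3 * taper s.

Lemma sige_gt0 s : 0 <= s -> 0 < s + e ^+ 2.
Proof. by move=> s0; rewrite ltr_wpDl// exprn_gt0. Qed.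

Lemma isig_gt0 s : 0 <= s -> 0 < isig s.
Proof. by move=> s0; rewrite invr_gt0 sqrtr_gt0 sige_gt0. Qed.

Lemma isig2 s : 0 <= s -> isig s ^+ 2 * (s + e ^+ 2) = 1.
Proof.
move=> s0; have p := sige_gt0 s0; rewrite /isig exprVn sqr_sqrtr ?ltW// mulVf//.
by rewrite gt_eqF.
Qed.

Lemma taper_ge0 s : 0 <= taper s. Proof. by rewrite le_max lexx orbT. Qed.

Lemma taper_le1 s : 0 <= s -> taper s <= 1.
Proof.
move=> s0; rewrite ge_max ler01 andbT gerBl divr_ge0 ?sqr_ge0//.
exact/ltW/sige_gt0.
Qed.

Lemma taper_out s : r ^+ 2 <= s -> taper s = 0.
Proof.
move=> rs; apply/max_idPr; rewrite subr_le0 ler_pdivlMr ?exprn_gt0// mul1r.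
by rewrite ler_wpDr// sqr_ge0.
Qed.

Lemma prof_ge0 s : 0 <= s -> 0 <= prof s.
Proof. by move=> s0; rewrite mulr_ge0 ?sqr_ge0// exprn_ge0// ltW// isig_gt0. Qed.

Lemma is_derive_isig s : 0 <= s -> is_derive s 1 isig (- (1 / 2) * isig s ^+ 3).
Proof.
move=> s0; have p := sige_gt0 s0.
have d1 : is_derive s 1 (fun s => s + e ^+ 2) 1 by dereq; rewrite addr0.
have q0 : Num.sqrt (s + e ^+ 2) != 0 by rewrite gt_eqF// sqrtr_gt0.
have d2 := @isd_sqrt R (fun s => s + e ^+ 2) s 1 p d1.
apply: (isd_eq (isd_inv (f := fun s => Num.sqrt (s + e ^+ 2)) q0 d2)); rewrite /isig.
by field.
Qed.

Lemma is_derive_prof s : 0 <= s -> is_derive s 1 prof (dprof s).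
Proof.
move=> s0.
have d1 : is_derive s 1 (fun s => 1 - (s + e ^+ 2) / r ^+ 2) (- (1 / r ^+ 2)).
  by dereq; rewrite /=; ring.
notypeclasses refine (isd_eq (isd_mul (isd_exp _ (is_derive_isig s0)) (isd_sqpos d1)) _).
by rewrite /dprof /taper /=; field; rewrite gt_eqF.
Qed.

Lemma sqn_ge0 z : 0 <= sqn z. Proof. by rewrite !addr_ge0 ?sqr_ge0. Qed.

Lemma continuous_isig_sqn : continuous (fun z => isig (sqn z)).
Proof.
move=> z; apply: (@continuous_comp _ _ _ (@sqn R) isig); first exact: continuous_sqn.
exact: is_derive_continuous (is_derive_isig (sqn_ge0 z)).
Qed.

Lemma continuous_taper_sqn : continuous (fun z => taper (sqn z)).
Proof.
apply: continuous_max0 => z; apply: cvgB; first exact: cvg_cst.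
apply: cvgM; last exact: cvg_cst.
by apply: cvgD; [exact: continuous_sqn|exact: cvg_cst].
Qed.

Lemma continuous_prof_sqn : continuous (fun z => prof (sqn z)).
Proof.
by apply: continuous_mulf; apply: continuous_expf;
  [exact: continuous_isig_sqn|exact: continuous_taper_sqn].
Qed.

Lemma continuous_dprof_sqn : continuous (fun z => dprof (sqn z)).
Proof.
have ci n := @continuous_expf _ _ _ n continuous_isig_sqn.
have ct := continuous_taper_sqn.
move=> z; apply: cvgB.
  apply: continuous_mulf (@continuous_expf _ _ _ 2 ct) z.
  exact: continuous_mulf (@continuous_cstf _ _ _) (ci 5).
apply: continuous_mulf ct z.
exact: continuous_mulf (@continuous_cstf _ _ _) (ci 3).
Qed.

Definition lin u v w z : R := u * z.1.1 + v * z.1.2 + w * z.2.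
Definition ker u v w z : R := lin u v w z * prof (sqn z).
(** The derivative of [ker u v w] in the direction [(a, b, c)]. *)
Definition dker u v w a b c z : R :=
  (u * a + v * b + w * c) * prof (sqn z) + lin u v w z * (dprof (sqn z) * (2 * lin a b c z)).

Lemma continuous_lin u v w : continuous (lin u v w).
Proof. exact: C1_continuous (@C1_coord R u v w). Qed.

Lemma continuous_ker u v w : continuous (ker u v w).
Proof. exact: continuous_mulf (@continuous_lin u v w) continuous_prof_sqn. Qed.

Lemma continuous_dker u v w a b c : continuous (dker u v w a b c).
Proof.
apply: continuous_addf.
  exact: continuous_mulf (@continuous_cstf _ _ _) continuous_prof_sqn.
apply: continuous_mulf; first exact: continuous_lin.
apply: continuous_mulf continuous_dprof_sqn _.
exact: continuous_mulf (@continuous_cstf _ _ _) (@continuous_lin a b c).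
Qed.

Lemma is_derive_ker u v w a b c z :
  is_derive z (a, b, c) (ker u v w) (dker u v w a b c z).
Proof.
apply: is_derive_line.
have p1 := is_derive_line_inv (is_derive_coord z a b c u v w).
have p2 := is_derive_line_inv (is_derive_sqn_dir a b c (is_derive_prof (sqn_ge0 z))).
have := isd_mul p1 p2; rewrite scale0r add0r.
by rewrite /dker /lin /= ![z.1.1 * _]mulrC ![z.1.2 * _]mulrC ![z.2 * _]mulrC.
Qed.

Lemma ker_out u v w z : ~ box r z -> ker u v w z = 0.
Proof. by move=> /(sqn_box (ltW r0))/taper_out h; rewrite /ker /prof h expr0n !mulr0. Qed.

Lemma dker_out u v w a b c z : ~ box r z -> dker u v w a b c z = 0.
Proof.
move=> /(sqn_box (ltW r0))/taper_out h; rewrite /dker /prof /dprof h expr0n /=.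
by rewrite !mulr0 subrr mul0r mulr0 addr0.
Qed.

(** The part of the divergence of the kernel that concentrates at the origin as
[e] tends to [0], with total mass tending to [4 pi]. *)
Definition core z : R := 3 * e ^+ 2 * isig (sqn z) ^+ 5 * taper (sqn z) ^+ 2.
(** The part of the divergence of the kernel produced by the cut-off at distance
[r]; up to sign, a kernel dominated by the Coulomb kernel. *)
Definition tail z : R := 4 / r ^+ 2 * sqn z * isig (sqn z) ^+ 3 * taper (sqn z).

Lemma div_ker z : dker 1 0 0 1 0 0 z + dker 0 1 0 0 1 0 z + dker 0 0 1 0 0 1 z =
  core z - tail z.
Proof.
have h := isig2 (sqn_ge0 z).
have -> : core z = 3 * (isig (sqn z) ^+ 3 - sqn z * isig (sqn z) ^+ 5) * taper (sqn z) ^+ 2.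
  rewrite /core; have -> : isig (sqn z) ^+ 3 = isig (sqn z) ^+ 3 * (isig (sqn z) ^+ 2 * (sqn z + e ^+ 2)).
    by rewrite h mulr1.
  by ring.
have E : lin 1 0 0 z * lin 1 0 0 z + lin 0 1 0 z * lin 0 1 0 z + lin 0 0 1 z * lin 0 0 1 z = sqn z.
  by rewrite /lin /sqn; ring.
rewrite /dker /tail /dprof /prof; move: E.
move: (taper (sqn z)) (isig (sqn z)) (lin 1 0 0 z) (lin 0 1 0 z) (lin 0 0 1 z) (sqn z) => m i p q t s <-.
by field; rewrite gt_eqF.
Qed.

Lemma core_ge0 z : 0 <= core z.
Proof.
have i0 := ltW (isig_gt0 (sqn_ge0 z)).
rewrite /core; apply: mulr_ge0 (sqr_ge0 _); apply: mulr_ge0 (exprn_ge0 _ i0).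
by apply: mulr_ge0 (sqr_ge0 _).
Qed.

(** Also true at the origin, where both sides vanish because [0^-1 = 0]. *)
Lemma tail_le z : tail z <= 4 / r ^+ 2 * (eucl z)^-1.
Proof.
have -> : tail z = 4 / r ^+ 2 * (sqn z * (isig (sqn z) ^+ 3 * taper (sqn z))).
  by rewrite /tail; ring.
rewrite ler_wpM2l ?divr_ge0 ?sqr_ge0//.
have s0 := sqn_ge0 z.
have [z0|z0] := eqVneq (eucl z) 0.
  by rewrite -eucl_sqn z0 expr0n mul0r invr0.
have z1 : 0 < eucl z by rewrite lt0r z0 eucl_ge0.
have i0 := isig_gt0 s0.
have ie : isig (sqn z) <= (eucl z)^-1.
  rewrite /isig lef_pV2 ?posrE ?z1 ?sqrtr_gt0 ?sige_gt0//.
  have le_s : sqn z <= sqn z + e ^+ 2 by rewrite lerDl sqr_ge0.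
  exact: ler_wsqrtr le_s.
rewrite -eucl_sqn; rewrite -eucl_sqn in ie i0 s0.
have t1 := taper_le1 s0; have t0 := taper_ge0 (eucl z ^+ 2).
apply: (@le_trans _ _ (eucl z ^+ 2 * isig (eucl z ^+ 2) ^+ 3)).
  by rewrite ler_wpM2l// ler_piMr// exprn_ge0// ltW.
apply: (@le_trans _ _ (eucl z ^+ 2 * (eucl z)^-1 ^+ 3)).
  apply: ler_wpM2l => //; apply: lerXn2r ie; rewrite nnegrE; first exact: ltW.
  by rewrite invr_ge0 ltW.
by rewrite le_eqVlt; apply/orP; left; apply/eqP; field.
Qed.

End RadialKernel.

(** * Integrals of the radial kernel *)

Section KernelIntegrals.
Context {R : realType}.
Notation mu := (@lebesgue_measure R).
Notation T1 := (measurableTypeR R).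
Notation T3 := (R3 (measurableTypeR R)).
Notation vol := (vol3 R).
Implicit Types (x y z : R3 R) (u v w : R).

Lemma Rintegral_preserved (s : T3 -> T3) (f : T3 -> R) : preserves_volume s ->
  measurable_fun [set: T3] f -> \int[vol]_x f (s x) = \int[vol]_x f x.
Proof.
move=> [ms hs] mf; congr fine.
exact: (integral_preserved_signed hs (f := EFin \o f) (proj2 (measurable_EFinP _ _) mf)).
Qed.

Section SecondMoment.
Variables (T : R -> R) (r : R).
Hypotheses (cT : continuous (fun z => T (sqn z))) (T0 : forall z, ~ box r z -> T (sqn z) = 0).

Let J (q : R3 R -> R) := \int[vol]_z (q z * T (sqn z)).

Let iJ (q : R3 R -> R) : continuous q -> vol.-integrable setT (EFin \o (fun z : T3 => q z * T (sqn z))).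
Proof. by move=> cq; exact: integrable_mul_compact cq cT T0. Qed.

Let mJ (q : R3 R -> R) : continuous q -> measurable_fun [set: T3] (fun z : T3 => q z * T (sqn z)).
Proof. by move=> cq; apply: continuous_measurable3; exact: continuous_mulf. Qed.

Let JD (q1 q2 : R3 R -> R) : continuous q1 -> continuous q2 -> J (fun z => q1 z + q2 z) = J q1 + J q2.
Proof.
move=> c1 c2; rewrite /J -(RintegralD measurableT (iJ c1) (iJ c2)).
by apply: eq_Rintegral => z _; rewrite mulrDl.
Qed.

Let JZ (k : R) (q : R3 R -> R) : continuous q -> J (fun z => k * q z) = k * J q.
Proof.
move=> cq; rewrite /J -(RintegralZl k measurableT (iJ cq)).
by apply: eq_Rintegral => z _; rewrite mulrA.
Qed.

Let Jiso (s : T3 -> T3) (q : R3 R -> R) : preserves_volume s -> (forall z, sqn (s z) = sqn z) ->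
  continuous q -> J (fun z => q (s z)) = J q.
Proof.
move=> hs sE cq; rewrite /J -(Rintegral_preserved hs (mJ cq)).
by apply: eq_Rintegral => z _; rewrite sE.
Qed.

Let csq u v w : continuous (fun z => lin u v w z ^+ 2) :=
  @continuous_expf _ _ _ 2 (@continuous_lin R u v w).

(** By reflection symmetry the mixed products of coordinates integrate to [0], and
by exchange symmetry the three squares have the same integral.  The parallelogram
identity lets one coordinate at a time be split off. *)
Lemma second_moment u v w :
  3 * \int[vol]_z (lin u v w z ^+ 2 * T (sqn z)) =
  (u ^+ 2 + v ^+ 2 + w ^+ 2) * \int[vol]_z (sqn z * T (sqn z)).
Proof.
have sE1 z : sqn (refl1 z) = sqn z by rewrite /sqn /= sqrrN.
have sE2 z : sqn (refl2 z) = sqn z by rewrite /sqn /= sqrrN.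
have s12 z : sqn (swap12 z) = sqn z by rewrite /sqn /=; ring.
have s23 z : sqn (swap23 z) = sqn z by rewrite /sqn /=; ring.
have step1 (a b c : R) : J (fun z => lin a b c z ^+ 2) =
    a ^+ 2 * J (fun z => lin 1 0 0 z ^+ 2) + J (fun z => lin 0 b c z ^+ 2).
  have e1 := Jiso (preserves_volume_refl1) sE1 (@csq a b c).
  have e2 : J (fun z => lin a b c z ^+ 2) + J (fun z => lin a b c (refl1 z) ^+ 2) =
    2 * (a ^+ 2 * J (fun z => lin 1 0 0 z ^+ 2) + J (fun z => lin 0 b c z ^+ 2)).
    have -> : (fun z => lin a b c (refl1 z) ^+ 2) = (fun z => lin (- a) b c z ^+ 2).
      by apply/funext => z; congr (_ ^+ 2); rewrite /lin /=; ring.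
    have c1 : continuous (fun z : R3 R => a ^+ 2 * lin 1 0 0 z ^+ 2).
      exact: continuous_mulf (@continuous_cstf _ _ _) (@csq 1 0 0).
    rewrite -JD// -JZ// -JD// -JZ; last exact: continuous_addf c1 (@csq 0 b c).
    by congr J; apply/funext => z; rewrite /lin; ring.
  by move: e2; rewrite e1; move: (J _) (J _) (J _) => p q t; lra.
have step2 (b c : R) : J (fun z => lin 0 b c z ^+ 2) =
    b ^+ 2 * J (fun z => lin 0 1 0 z ^+ 2) + c ^+ 2 * J (fun z => lin 0 0 1 z ^+ 2).
  have e1 := Jiso (preserves_volume_refl2) sE2 (@csq 0 b c).
  have e2 : J (fun z => lin 0 b c z ^+ 2) + J (fun z => lin 0 b c (refl2 z) ^+ 2) =
    2 * (b ^+ 2 * J (fun z => lin 0 1 0 z ^+ 2) + c ^+ 2 * J (fun z => lin 0 0 1 z ^+ 2)).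
    have -> : (fun z => lin 0 b c (refl2 z) ^+ 2) = (fun z => lin 0 (- b) c z ^+ 2).
      by apply/funext => z; congr (_ ^+ 2); rewrite /lin /=; ring.
    have c1 : continuous (fun z : R3 R => b ^+ 2 * lin 0 1 0 z ^+ 2).
      exact: continuous_mulf (@continuous_cstf _ _ _) (@csq 0 1 0).
    have c2 : continuous (fun z : R3 R => c ^+ 2 * lin 0 0 1 z ^+ 2).
      exact: continuous_mulf (@continuous_cstf _ _ _) (@csq 0 0 1).
    rewrite -JD// -!JZ// -JD// -JZ; last exact: continuous_addf c1 c2.
    by congr J; apply/funext => z; rewrite /lin; ring.
  by move: e2; rewrite e1; move: (J _) (J _) (J _) => p q t; lra.
have M12 : J (fun z => lin 0 1 0 z ^+ 2) = J (fun z => lin 1 0 0 z ^+ 2).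
  rewrite -(Jiso (preserves_volume_swap12) s12 (@csq 1 0 0)).
  by congr J; apply/funext => z; congr (_ ^+ 2); rewrite /lin /=; ring.
have M23 : J (fun z => lin 0 0 1 z ^+ 2) = J (fun z => lin 0 1 0 z ^+ 2).
  rewrite -(Jiso (preserves_volume_swap23) s23 (@csq 0 1 0)).
  by congr J; apply/funext => z; congr (_ ^+ 2); rewrite /lin /=; ring.
have E : J (@sqn R) = 3 * J (fun z => lin 1 0 0 z ^+ 2).
  rewrite (_ : @sqn R = (fun z => lin 1 0 0 z ^+ 2 + (lin 0 1 0 z ^+ 2 + lin 0 0 1 z ^+ 2))).
    rewrite !JD//; last exact: continuous_addf (@csq 0 1 0) (@csq 0 0 1).
    by rewrite M23 M12; ring.
  by apply/funext => z; rewrite /sqn /lin; ring.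
rewrite -/(J (fun z => lin u v w z ^+ 2)) -/(J (@sqn R)) E step1 step2 M23 M12; ring.
Qed.

End SecondMoment.

Variables (e r : R).
Hypotheses (e0 : 0 < e) (er : e < r).
Let r0 : 0 < r := lt_trans e0 er.

Let Tw s : R := isig e s ^+ 2 * taper e r s ^+ 2.

Lemma continuous_weight n : continuous (fun z => isig e (sqn z) ^+ n * taper e r (sqn z) ^+ 2).
Proof.
by apply: continuous_mulf; apply: continuous_expf;
  [exact: continuous_isig_sqn|exact: continuous_taper_sqn].
Qed.

Lemma weight_out n z : ~ box r z -> isig e (sqn z) ^+ n * taper e r (sqn z) ^+ 2 = 0.
Proof. by move=> /(sqn_box (ltW r0))/(taper_out e r0) ->; rewrite expr0n mulr0. Qed.

(** In spherical coordinates, using [sqrt s * isig s <= 1] to remove the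
non-elementary factor, the integrand becomes the derivative of a polynomial in
[sqrt (s + e^2)]. *)
Lemma integral_weight_le :
  \int[vol]_z (isig e (sqn z) ^+ 2 * taper e r (sqn z) ^+ 2) <= 32 / 15 * pi * r.
Proof.
have re : 0 <= r ^+ 2 - e ^+ 2.
  by rewrite subr_ge0; apply: lerXn2r; rewrite ?nnegrE ?ltW.
have tE s : 0 <= s -> s <= r ^+ 2 - e ^+ 2 -> taper e r s = 1 - (s + e ^+ 2) / r ^+ 2.
  move=> s0 sr; apply/max_idPl; rewrite subr_ge0 ler_pdivrMr ?exprn_gt0// mul1r.
  by rewrite -lerBrDr.
have tE0 s : r ^+ 2 - e ^+ 2 < s -> taper e r s = 0.
  move=> sr; apply/max_idPr; rewrite subr_le0 ler_pdivlMr ?exprn_gt0// mul1r.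
  by rewrite -lerBlDr ltW.
pose F s := 2 * (Num.sqrt (s + e ^+ 2) - 2 / 3 / r ^+ 2 * Num.sqrt (s + e ^+ 2) ^+ 3 +
  1 / 5 / r ^+ 4 * Num.sqrt (s + e ^+ 2) ^+ 5).
have dF s : 0 <= s <= r ^+ 2 - e ^+ 2 -> is_derive s 1 F (isig e s * taper e r s ^+ 2).
  move=> /andP[s0 sr]; have p := sige_gt0 e0 s0.
  have d1 : is_derive s 1 (fun s => s + e ^+ 2) 1 by dereq; rewrite addr0.
  have d2 := @isd_sqrt R (fun s => s + e ^+ 2) s 1 p d1.
  notypeclasses refine (isd_eq (isd_mul (isd_cst _ _) (isd_add (isd_add d2 (isd_opp
    (isd_mul (isd_cst _ _) (isd_exp 3 d2)))) (isd_mul (isd_cst _ _) (isd_exp 5 d2)))) _).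
  have -> : taper e r s = 1 - Num.sqrt (s + e ^+ 2) ^+ 2 / r ^+ 2.
    by rewrite (tE s s0 sr) sqr_sqrtr ?ltW.
  have q0 : Num.sqrt (s + e ^+ 2) != 0 by rewrite gt_eqF// sqrtr_gt0.
  rewrite /isig /=; move: (Num.sqrt _) q0 => q q0.
  by field; rewrite q0 gt_eqF.
have b1 (s : T1) : ((2 * pi * Num.sqrt s)%:E * (if 0 <= s then Tw s else 0)%:E <=
    (2 * pi)%:E * ((fun s => (isig e s * taper e r s ^+ 2)%:E) \_ `[0%R, (r ^+ 2 - e ^+ 2)%R]) s)%E.
  rewrite patchE mem_setE in_itv /= -EFinM.
  have p0 : 0 <= 2 * pi :> R by rewrite mulr_ge0 ?pi_ge0.
  have [s0|s0] := leP 0 s; last by rewrite mulr0 mule0.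
  have [sr|sr] := leP s (r ^+ 2 - e ^+ 2); last by rewrite /Tw (tE0 _ sr) expr0n !mulr0 mule0.
  rewrite /= -EFinM lee_fin.
  have -> : 2 * pi * Num.sqrt s * Tw s =
      2 * pi * (Num.sqrt s * isig e s * (isig e s * taper e r s ^+ 2)) by rewrite /Tw; ring.
  apply: ler_wpM2l => //; apply: ler_piMl.
    by apply: mulr_ge0 (sqr_ge0 _); exact: ltW (isig_gt0 e0 s0).
  rewrite /isig ler_pdivrMr ?sqrtr_gt0 ?sige_gt0// mul1r.
  by apply: ler_wsqrtr; rewrite lerDl sqr_ge0.
have mS : measurable_fun [set: T1] (fun s : T1 => (if 0 <= s then Tw s else 0)%:E).
  apply/measurable_EFinP; apply: measurable_fun_ifT; last exact: measurable_cst.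
    by apply: measurable_fun_ler; [exact: measurable_cst|exact: measurable_id].
  have mse : measurable_fun [set: T1] (fun s : T1 => s + e ^+ 2).
    by apply: measurable_funD; [exact: measurable_id|exact: measurable_cst].
  apply: measurable_funM; apply: measurable_funX; first exact: measurable_inv_sqrt.
  apply: measurable_maxr; last exact: measurable_cst.
  apply: measurable_funB; first exact: measurable_cst.
  by apply: measurable_funM => //; exact: measurable_cst.
have S0 (s : T1) : (0 <= (if 0 <= s then Tw s else 0)%:E)%E.
  by rewrite lee_fin; case: ifP => // s0; rewrite mulr_ge0 ?sqr_ge0.
have h : (\int[vol]_z (isig e (sqn z) ^+ 2 * taper e r (sqn z) ^+ 2)%:E <= (32 / 15 * pi * r)%:E)%E.
  have -> : (\int[vol]_z (isig e (sqn z) ^+ 2 * taper e r (sqn z) ^+ 2)%:E =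
      \int[vol]_z (if (0 <= sqn z)%R then Tw (sqn z) else 0)%:E)%E.
    by apply: eq_integral => z _; rewrite sqn_ge0.
  rewrite (integral_spherical mS S0).
  have mP : measurable (`[0%R, (r ^+ 2 - e ^+ 2)%R]%classic : set T1) by exact: measurable_itv.
  have cf : {within `[0%R, (r ^+ 2 - e ^+ 2)%R], continuous (fun s => isig e s * taper e r s ^+ 2)}.
    apply: derivable_within_continuous => s; rewrite in_itv /= => sr.
    case/andP: (sr) => s0 _.
    apply: der_derivable (isd_mul (is_derive_isig e0 s0) (isd_sqpos (f := fun s => 1 - (s + e ^+ 2) / r ^+ 2) _)).
  apply: (@le_trans _ _ (\int[mu]_s ((2 * pi)%:E * ((fun s => (isig e s * taper e r s ^+ 2)%:E) \_ `[0%R, (r ^+ 2 - e ^+ 2)%R]) s))%E).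
    apply: ge0_le_integral => //.
    - by move=> s _; rewrite mule_ge0// lee_fin mulr_ge0 ?sqrtr_ge0// mulr_ge0 ?pi_ge0.
    - apply: emeasurable_funM => //; apply/measurable_EFinP.
      apply: measurable_funM; first exact: measurable_cst.
      exact: continuous_measurable_fun (@sqrt_continuous R).
    - apply: emeasurable_funM; first exact: measurable_cst.
      apply/(measurable_restrictT _ mP)/measurable_EFinP.
      exact: subspace_continuous_measurable_fun.
  rewrite ge0_integralZl//; first last.
  - by rewrite lee_fin mulr_ge0 ?pi_ge0.
  - move=> s _; rewrite patchE mem_setE in_itv /=; case: ifP => // /andP[s0 _].
    by rewrite lee_fin mulr_ge0 ?sqr_ge0// ltW// isig_gt0.
  - apply/(measurable_restrictT _ mP)/measurable_EFinP.
    exact: subspace_continuous_measurable_fun.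
  rewrite -integral_mkcond (ftc re dF cf) -EFinM lee_fin.
  rewrite /F subrK add0r !sqrtr_sqr !ger0_norm ?(ltW e0) ?(ltW r0)//.
  have -> : 32 / 15 * pi * r = 2 * pi * (2 * (r - 2 / 3 / r ^+ 2 * r ^+ 3 + 1 / 5 / r ^+ 4 * r ^+ 5)).
    by move: (pi : R) => p; field; rewrite gt_eqF.
  rewrite ler_wpM2l ?mulr_ge0 ?pi_ge0// gerBl mulr_ge0//.
  have -> : e - 2 / 3 / r ^+ 2 * e ^+ 3 + 1 / 5 / r ^+ 4 * e ^+ 5 =
     e * (4 / 9 + 1 / 5 * (5 / 3 - (e / r) ^+ 2) ^+ 2) by field; rewrite gt_eqF.
  apply: mulr_ge0 (ltW e0) _; apply: addr_ge0; first by rewrite divr_ge0.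
  by apply: mulr_ge0 (sqr_ge0 _); rewrite divr_ge0.
have i1 := continuous_integrable_box (@continuous_weight 2) (@weight_out 2).
by rewrite -lee_fin fineK//; exact: integrable_fin_num.
Qed.

(** The modulus of a linear form [l] is at most [1/4 * d + l^2 / d], where [d] is
the regularized distance, and the square averages to a third of [|z|^2].  The
exact integral of the modulus is smaller by a constant factor; this bound only
needs second moments. *)
Lemma integral_abs_ker_le u v w : u ^+ 2 + v ^+ 2 + w ^+ 2 = 1 ->
  \int[vol]_z `|ker e r u v w z| <= 56 / 45 * pi * r.
Proof.
move=> uvw.
pose A z := isig e (sqn z) ^+ 2 * taper e r (sqn z) ^+ 2.
pose B z := lin u v w z ^+ 2 * (isig e (sqn z) ^+ 4 * taper e r (sqn z) ^+ 2).
have iA : vol.-integrable setT (EFin \o (A : T3 -> R)).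
  exact: continuous_integrable_box (@continuous_weight 2) (@weight_out 2).
have iB : vol.-integrable setT (EFin \o (B : T3 -> R)).
  have cl : continuous (fun z => lin u v w z ^+ 2) := @continuous_expf _ _ _ 2 (@continuous_lin R u v w).
  exact: integrable_mul_compact cl (@continuous_weight 4) (@weight_out 4).
have cK := @continuous_ker R e r e0 u v w.
have iK : vol.-integrable setT (EFin \o (fun z : T3 => `|ker e r u v w z|)).
  apply: (@continuous_integrable_box _ _ r) => [z|z /(@ker_out R e r r0 u v w) ->].
    exact: cvg_norm (cK z).
  by rewrite normr0.
have pt z : `|ker e r u v w z| <= 1 / 4 * A z + B z.
  have s0 := sqn_ge0 z; have i0 := isig_gt0 e0 s0; have t0 := taper_ge0 e r (sqn z).
  rewrite /ker /A /B normrM (ger0_norm (prof_ge0 r e0 s0)) /prof.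
  rewrite -[lin u v w z ^+ 2]real_normK ?num_real//.
  move: (`|lin u v w z|) (isig _ _) (taper _ _ _) i0 t0 => l i t i0 t0.
  rewrite -subr_ge0 (_ : _ - _ = (l * i ^+ 2 * t - 1 / 2 * i * t) ^+ 2); last by field.
  exact: sqr_ge0.
have step : \int[vol]_z `|ker e r u v w z| <= 1 / 4 * \int[vol]_z A z + \int[vol]_z B z.
  rewrite -(RintegralZl (1 / 4) measurableT iA) -RintegralD//; last exact: (integrableZl measurableT (1 / 4) iA).
  apply: le_Rintegral => //.
  exact: (integrableD measurableT (integrableZl measurableT (1 / 4) iA) iB).
have BA : 3 * \int[vol]_z B z <= \int[vol]_z A z.
  rewrite (@second_moment (fun s => isig e s ^+ 4 * taper e r s ^+ 2) r (@continuous_weight 4) (@weight_out 4)).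
  rewrite uvw mul1r; apply: le_Rintegral => //.
    exact: integrable_mul_compact (@continuous_sqn R) (@continuous_weight 4) (@weight_out 4).
  move=> z _; have s0 := sqn_ge0 z; have i2 := isig2 e0 s0.
  rewrite /A mulrA ler_wpM2r ?sqr_ge0//.
  have -> : sqn z * isig e (sqn z) ^+ 4 =
     isig e (sqn z) ^+ 2 * (isig e (sqn z) ^+ 2 * sqn z) by ring.
  rewrite ler_piMr ?sqr_ge0// -i2 ler_wpM2l ?sqr_ge0// lerDl sqr_ge0//.
have := integral_weight_le; rewrite -/A; move: step BA.
have -> : 32 / 15 * pi * r = 32 / 15 * (pi * r) by rewrite mulrA.
have -> : 56 / 45 * pi * r = 56 / 45 * (pi * r) by rewrite mulrA.
move: (pi * r) (Rintegral _ _ _) (Rintegral _ _ _) (Rintegral _ _ _) => p a b c; lra.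
Qed.

Lemma integral_ker u v w : \int[vol]_z ker e r u v w z = 0.
Proof.
have cK := @continuous_ker R e r e0 u v w.
have mK := continuous_measurable3 cK.
have h := Rintegral_preserved (preserves_volume_sub 0) mK.
have E : \int[vol]_z ker e r u v w (0 - z) = - \int[vol]_z ker e r u v w z.
  rewrite -mulN1r -RintegralZl//; last exact: continuous_integrable_box cK (@ker_out R e r r0 u v w).
  apply: eq_Rintegral => z _; rewrite sub0r /ker.
  have -> : sqn (- z) = sqn z by rewrite /sqn /= !sqrrN.
  by rewrite /lin /=; ring.
by move: h; rewrite E; lra.
Qed.

Lemma conv_reflect (K G : R3 R -> R) x : continuous K -> continuous G ->
  conv K G x = \int[vol]_z (K z * G (x - z)).
Proof.
move=> cK cG; have cGx := continuous_reflect_translate (x := x) cG.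
have m := continuous_measurable3 (continuous_mulf cK cGx).
rewrite -(Rintegral_preserved (preserves_volume_sub x) m).
by apply: eq_Rintegral => y _; rewrite subKr.
Qed.

(** Since the kernel is odd, [G] may be replaced by [G - 1/2], which is at most
[1/2] in modulus. *)
Lemma conv_ker_le (G : R3 R -> R) x u v w : u ^+ 2 + v ^+ 2 + w ^+ 2 = 1 ->
  continuous G -> (forall y, 0 <= G y <= 1) ->
  conv (ker e r u v w) G x <= 28 / 45 * pi * r.
Proof.
move=> uvw cG G01; have cK := @continuous_ker R e r e0 u v w.
have cGx := continuous_reflect_translate (x := x) cG.
have kout := @ker_out R e r r0 u v w.
have iK : vol.-integrable setT (EFin \o (ker e r u v w : T3 -> R)).
  exact: continuous_integrable_box cK kout.
have inK : vol.-integrable setT (EFin \o (fun z : T3 => `|ker e r u v w z|)).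
  apply: (@continuous_integrable_box _ _ r) => [z|z /kout ->]; first exact: cvg_norm (cK z).
  by rewrite normr0.
have iKG : vol.-integrable setT (EFin \o (fun z : T3 => ker e r u v w z * G (x - z))).
  apply: (@continuous_integrable_box _ _ r); first exact: continuous_mulf.
  by move=> z /kout ->; rewrite mul0r.
(* The subtracted integral is [0]; the weight [G - 1/2] is thus introduced for
   free. *)
rewrite conv_reflect//.
have : \int[vol]_z (ker e r u v w z * G (x - z)) - 1 / 2 * \int[vol]_z ker e r u v w z <=
    1 / 2 * \int[vol]_z `|ker e r u v w z|.
  rewrite -(RintegralZl (1 / 2) measurableT iK) -(RintegralZl (1 / 2) measurableT inK).
  rewrite -RintegralB//; last exact: (integrableZl measurableT (1 / 2) iK).
  apply: le_Rintegral => //.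
  - exact: (integrableB measurableT iKG (integrableZl measurableT (1 / 2) iK)).
  - exact: (integrableZl measurableT (1 / 2) inK).
  - move=> z _; have /andP[g0 g1] := G01 (x - z).
    move: (ker _ _ _ _ _ z) (G _) g0 g1 => k g g0 g1.
    have := ler_norm k; have : - k <= `|k| by rewrite -normrN ler_norm.
    by move: g0 g1; nra.
have := integral_abs_ker_le uvw; rewrite integral_ker.
have -> : 56 / 45 * pi * r = 56 / 45 * (pi * r) by rewrite mulrA.
have -> : 28 / 45 * pi * r = 28 / 45 * (pi * r) by rewrite mulrA.
move: (pi * r) (Rintegral _ _ _) (Rintegral _ _ _) => p a b; lra.
Qed.

(** The integrand has the primitive [4 pi (sqrt s * isig s)^3], which increases from
[0] to [4 pi] when [s] runs through the positive numbers. *)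
Lemma integral_core_itv : e <= 1 ->
  (((1 - 3 * e) * (4 * pi))%:E <= \int[vol]_z
    (if (e ^+ 4 <= sqn z <= e)%R then 3 * e ^+ 2 * isig e (sqn z) ^+ 5 else 0)%:E)%E.
Proof.
move=> e1; pose f s := if (e ^+ 4 <= s <= e)%R then 3 * e ^+ 2 * isig e s ^+ 5 else 0.
have e4 : 0 < e ^+ 4 by rewrite exprn_gt0.
(* The lower endpoint [e^4] stays away from [0], where [sqrt] is not
   differentiable, and is small enough for the primitive to be at most
   [4 pi e] there. *)
have e41 : e ^+ 4 <= e by rewrite exprS ler_piMr ?(ltW e0)// exprn_ile1// ltW.
have mse : measurable_fun [set: T1] (fun s : T1 => s + e ^+ 2).
  by apply: measurable_funD; [exact: measurable_id|exact: measurable_cst].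
have mf : measurable_fun [set: T1] (fun s : T1 => (f s)%:E).
  apply/measurable_EFinP; apply: measurable_fun_ifT; last exact: measurable_cst.
    by apply: measurable_and; apply: measurable_fun_ler; (exact: measurable_cst || exact: measurable_id).
  apply: measurable_funM; first exact: measurable_cst.
  by apply: measurable_funX; exact: measurable_inv_sqrt.
have f0 (s : T1) : (0 <= (f s)%:E)%E.
  rewrite lee_fin /f; case: ifP => // /andP[s0 _].
  apply: mulr_ge0; first by apply: mulr_ge0 (sqr_ge0 _).
  by apply/exprn_ge0/ltW/isig_gt0 => //; exact: le_trans (ltW e4) s0.
rewrite (integral_spherical mf f0).
pose F s := 4 * pi * (Num.sqrt s * isig e s) ^+ 3.
have dF s : e ^+ 4 <= s <= e -> is_derive s 1 F (2 * pi * Num.sqrt s * (3 * e ^+ 2 * isig e s ^+ 5)).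
  move=> /andP[s0 _]; have sp : 0 < s := lt_le_trans e4 s0.
  have d1 := @isd_sqrt R id s 1 sp (isd_id s).
  have d2 := isd_mul d1 (is_derive_isig e0 (ltW sp)).
  notypeclasses refine (isd_eq (isd_mul (isd_cst _ _) (isd_exp 3 d2)) _).
  have i2 := isig2 e0 (ltW sp); have q0 : Num.sqrt s != 0 by rewrite gt_eqF// sqrtr_gt0.
  have qs : s = Num.sqrt s ^+ 2 by rewrite sqr_sqrtr// ltW.
  have -> : isig e s ^+ 5 = isig e s ^+ 3 * isig e s ^+ 2 by ring.
  have E : e ^+ 2 * isig e s ^+ 2 = 1 - Num.sqrt s ^+ 2 * isig e s ^+ 2.
    by rewrite -qs -i2; ring.
  rewrite [RHS](_ : _ = 6 * pi * Num.sqrt s * isig e s ^+ 3 * (e ^+ 2 * isig e s ^+ 2)); last by ring.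
  rewrite E /=; move: (Num.sqrt s) (isig e s) (pi : R) q0 => q i p q0.
  by field.
have cf : {within `[(e ^+ 4), e], continuous (fun s => 2 * pi * Num.sqrt s * (3 * e ^+ 2 * isig e s ^+ 5))}.
  apply: derivable_within_continuous => s; rewrite in_itv /= => /andP[s0 _].
  have sp : 0 < s := lt_le_trans e4 s0.
  have d1 := @isd_sqrt R id s 1 sp (isd_id s).
  apply: der_derivable (isd_mul (isd_mul (isd_cst _ _) d1) (isd_mul (isd_cst _ _) (isd_exp 5 (is_derive_isig e0 (ltW sp))))).
have -> : (\int[mu]_s ((2 * pi * Num.sqrt s)%:E * (f s)%:E) =
   \int[mu]_(s in `[(e ^+ 4)%R, e]) (2 * pi * Num.sqrt s * (3 * e ^+ 2 * isig e s ^+ 5))%:E)%E.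
  rewrite [RHS]integral_mkcond; apply: eq_integral => s _.
  by rewrite patchE mem_setE in_itv /= /f; case: ifP => _; rewrite ?mule0.
rewrite (ftc e41 dF cf) lee_fin /F -mulrBr mulrC ler_wpM2l ?mulr_ge0 ?pi_ge0//.
have -> : Num.sqrt (e ^+ 4) = e ^+ 2.
  by rewrite (_ : e ^+ 4 = (e ^+ 2) ^+ 2) ?sqrtr_sqr ?ger0_norm ?sqr_ge0// -exprM.
have s4 : (e ^+ 2 * isig e (e ^+ 4)) ^+ 3 <= e.
  have i0 := ltW (isig_gt0 e0 (ltW e4)).
  have ie : e * isig e (e ^+ 4) <= 1.
    have i2 := isig2 e0 (ltW e4).
    have : (e * isig e (e ^+ 4)) ^+ 2 <= 1.
      rewrite -i2 exprMn mulrC ler_wpM2l ?sqr_ge0// lerDr ltW//.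
    by rewrite expr_le1// mulr_ge0// ltW.
  have -> : (e ^+ 2 * isig e (e ^+ 4)) ^+ 3 = e * (e ^+ 2 * (e * isig e (e ^+ 4)) ^+ 3) by ring.
  have ei0 : 0 <= e * isig e (e ^+ 4) by rewrite mulr_ge0// ltW.
  rewrite ler_piMr ?(ltW e0)//; apply: mulr_ile1; rewrite ?sqr_ge0 ?exprn_ge0//.
    by rewrite exprn_ile1// ltW.
  exact: exprn_ile1.
have s1 : 1 - 2 * e <= (Num.sqrt e * isig e e) ^+ 3.
  have i2 := isig2 e0 (ltW e0); have i0 := ltW (isig_gt0 e0 (ltW e0)).
  set q := Num.sqrt e * isig e e.
  have q0 : 0 <= q by rewrite mulr_ge0 ?sqrtr_ge0.
  have q2 : q ^+ 2 * (1 + e) = 1.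
    rewrite /q exprMn sqr_sqrtr ?(ltW e0)// -[RHS]i2; ring.
  have q1 : q <= 1.
    have : q ^+ 2 <= 1 by rewrite -q2 ler_peMr ?sqr_ge0// lerDl ltW.
    by rewrite expr_le1.
  have q4 : q ^+ 4 <= q ^+ 3 by rewrite exprS ler_piMl ?exprn_ge0.
  apply: le_trans q4.
  have -> : q ^+ 4 = (q ^+ 2) ^+ 2 by rewrite -exprM.
  move: (q ^+ 2) (sqr_ge0 q) q2 => t t0 te.
  have p1 : 0 < 1 + e by rewrite ltr_wpDr// ltW.
  have t1 : 1 - e <= t by move: te t0; nra.
  by move: te t0 t1; nra.
by move: s1 s4; move: (_ ^+ 3) (_ ^+ 3) => a b; lra.
Qed.

Lemma continuous_core : continuous (core e r).
Proof.
apply: continuous_mulf; last exact: (@continuous_expf _ _ _ 2 (@continuous_taper_sqn R e r)).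
apply: continuous_mulf; first exact: continuous_cstf.
exact: (@continuous_expf _ _ _ 5 (@continuous_isig_sqn R e e0)).
Qed.

Lemma core_out z : ~ box r z -> core e r z = 0.
Proof. by move=> /(sqn_box (ltW r0))/(taper_out e r0) h; rewrite /core h expr0n mulr0. Qed.

(** The taper is close to [1] on the ball [|z|^2 <= e] and the core has almost all
its mass there. *)
Lemma conv_core_ge (G : R3 R -> R) (k : R) x : e <= 1 ->
  continuous G -> (forall y, 0 <= G y) -> (forall z, sqn z <= e -> k <= G (x - z)) ->
  0 <= 1 - (4 / r ^+ 2 + 3) * e ->
  k * ((1 - (4 / r ^+ 2 + 3) * e) * (4 * pi)) <= conv (core e r) G x.
Proof.
move=> e1 cG G0 kG m0.
have c0 : 0 <= conv (core e r) G x.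
  by apply: Rintegral_ge0 => y _; rewrite mulr_ge0// core_ge0.
have p0 : 0 <= 4 * pi :> R by rewrite mulr_ge0 ?pi_ge0.
have [k0|k0] := leP 0 k; last first.
  by apply: le_trans c0; rewrite mulr_le0_ge0 ?(ltW k0)// mulr_ge0.
have cc := continuous_core.
have cGx := continuous_reflect_translate (x := x) cG.
have iC : vol.-integrable setT (EFin \o (fun z : T3 => core e r z * G (x - z))).
  apply: (@continuous_integrable_box _ _ r); first exact: continuous_mulf.
  by move=> z /core_out ->; rewrite mul0r.
rewrite conv_reflect//.
pose phi z : R := if (e ^+ 4 <= sqn z <= e)%R then 3 * e ^+ 2 * isig e (sqn z) ^+ 5 else 0.
(* On [|z|^2 <= e] the taper is at least [1 - (e + e^2)/r^2], hence at least
   [1 - x0]. *)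
pose x0 := 2 * e / r ^+ 2.
have x00 : 0 <= x0 by rewrite divr_ge0 ?sqr_ge0// mulr_ge0// ltW.
have x0E : (4 / r ^+ 2 + 3) * e = 2 * x0 + 3 * e by rewrite /x0; ring.
have x01 : x0 <= 1 by move: m0; rewrite x0E; have := ltW e0; move: (x0) => t; lra.
have tau z : sqn z <= e -> (1 - x0) ^+ 2 <= taper e r (sqn z) ^+ 2.
  move=> ze; have t1 : 1 - x0 <= taper e r (sqn z).
    rewrite le_max; apply/orP; left; rewrite lerB// /x0 ler_wpM2r ?invr_ge0 ?sqr_ge0//.
    have : e ^+ 2 <= e by rewrite expr2 ler_piMl// ltW.
    by move: ze; lra.
  by apply: lerXn2r t1; rewrite nnegrE ?taper_ge0// subr_ge0.
have phi0 z : 0 <= phi z.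
  rewrite /phi; case: ifP => // _; apply: mulr_ge0; first by apply: mulr_ge0 (sqr_ge0 _).
  by apply/exprn_ge0/ltW/isig_gt0/sqn_ge0.
have mphi : measurable_fun [set: T3] (phi : T3 -> R).
  have ms := continuous_measurable3 (@continuous_sqn R).
  apply: measurable_fun_ifT; last exact: measurable_cst.
    by apply: measurable_and; apply: measurable_fun_ler; (exact: measurable_cst || exact: ms).
  apply: continuous_measurable3; apply: continuous_mulf; first exact: continuous_cstf.
  exact: (@continuous_expf _ _ _ 5 (@continuous_isig_sqn R e e0)).
have pt z : k * (1 - x0) ^+ 2 * phi z <= core e r z * G (x - z).
  rewrite /phi; case: ifPn => [/andP[_ ze]|_]; last by rewrite mulr0 mulr_ge0// core_ge0.
  have := kG z ze; have := tau z ze; rewrite /core.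
  have : 0 <= 3 * e ^+ 2 * isig e (sqn z) ^+ 5.
    apply: mulr_ge0; first by apply: mulr_ge0 (sqr_ge0 _).
    by apply/exprn_ge0/ltW/isig_gt0/sqn_ge0.
  move: (_ * isig _ _ ^+ 5) (taper _ _ _ ^+ 2) (G _) => a t g a0 t1 g1.
  have q0 := sqr_ge0 (1 - x0).
  rewrite (_ : k * (1 - x0) ^+ 2 * a = (a * (1 - x0) ^+ 2) * k); last by ring.
  apply: ler_pM => //; first exact: mulr_ge0.
  by apply: ler_wpM2l.
have key : ((k * (1 - x0) ^+ 2 * ((1 - 3 * e) * (4 * pi)))%:E <= \int[vol]_z (core e r z * G (x - z))%:E)%E.
  have kq0 : 0 <= k * (1 - x0) ^+ 2 by rewrite mulr_ge0 ?sqr_ge0.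
  apply: (@le_trans _ _ (\int[vol]_z ((k * (1 - x0) ^+ 2)%:E * (phi z)%:E))%E).
    rewrite ge0_integralZl//; last 2 first.
    - by apply/measurable_EFinP.
    - by move=> z _; rewrite lee_fin.
    by rewrite EFinM lee_wpmul2l// integral_core_itv.
  apply: ge0_le_integral => //.
  - by move=> z _; rewrite -EFinM lee_fin mulr_ge0.
  - by apply: emeasurable_funM; [exact: measurable_cst|apply/measurable_EFinP].
  - exact: (measurable_int _ iC).
  - by move=> z _; rewrite -EFinM lee_fin.
rewrite -lee_fin fineK; last exact: integrable_fin_num.
apply: le_trans key; rewrite lee_fin -[leRHS]mulrA ler_wpM2l// [leRHS]mulrA ler_wpM2r//.
rewrite x0E; have t0 : 0 <= 1 - 3 * e by move: m0; rewrite x0E; lra.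
rewrite -subr_ge0.
have -> : (1 - x0) ^+ 2 * (1 - 3 * e) - (1 - (2 * x0 + 3 * e)) =
   x0 ^+ 2 * (1 - 3 * e) + 6 * (e * x0) by ring.
apply: addr_ge0; first exact: mulr_ge0 (sqr_ge0 _) t0.
by apply: mulr_ge0 => //; exact: mulr_ge0 (ltW e0) x00.
Qed.

End KernelIntegrals.

(** * The flux of the convolved field *)

Section FluxLowerBound.
Context {R : realType}.
Notation mu := (@lebesgue_measure R).
Notation T3 := (R3 (measurableTypeR R)).
Notation leb2 := (sfprod mu mu).
Notation leb3 := (sfprod leb2 mu).
Notation vol := (vol3 R).
Implicit Types (x y z : R3 R).

Definition coulomb2 (f g : R3 R -> R) : \bar R :=
  (\int[vol]_x \int[vol]_y (f x * g y / eucl (x - y))%:E)%E.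

Lemma measurable_coulomb_kernel (f g : T3 -> R) : measurable_fun [set: T3] f ->
  measurable_fun [set: T3] g ->
  measurable_fun [set: T3 * T3] (fun p : T3 * T3 => (f p.1 * g p.2 / eucl (p.1 - p.2))%:E).
Proof.
move=> mf mg; apply/measurable_EFinP; apply: measurable_funM.
  by apply: measurable_funM; [exact: measurableT_comp mf measurable_fst|
    exact: measurableT_comp mg measurable_snd].
apply: measurable_inv_sqrt.
have m1 := measurableT_comp measurable_x1 (@measurable_fst _ _ T3 T3).
have m2 := measurableT_comp measurable_x2 (@measurable_fst _ _ T3 T3).
have m3 := measurableT_comp measurable_x3 (@measurable_fst _ _ T3 T3).
have n1 := measurableT_comp measurable_x1 (@measurable_snd _ _ T3 T3).
have n2 := measurableT_comp measurable_x2 (@measurable_snd _ _ T3 T3).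
have n3 := measurableT_comp measurable_x3 (@measurable_snd _ _ T3 T3).
by apply: measurable_funD; [apply: measurable_funD|]; apply: measurable_funX;
  [exact: measurable_funB m1 n1|exact: measurable_funB m2 n2|exact: measurable_funB m3 n3].
Qed.

Lemma measurable_coulomb_inner (f g : T3 -> R) : measurable_fun [set: T3] f ->
  measurable_fun [set: T3] g -> (forall x, 0 <= f x) -> (forall x, 0 <= g x) ->
  measurable_fun [set: T3] (fun x : T3 => (\int[vol]_y (f x * g y / eucl (x - y))%:E)%E).
Proof.
move=> mf mg f0 g0.
apply: (@measurable_fun_fubini_tonelli_F _ _ _ _ _ leb3 _ (measurable_coulomb_kernel mf mg)).
by move=> p; rewrite lee_fin divr_ge0 ?mulr_ge0// eucl_ge0.
Qed.

Lemma closure_support_compact (phi : R3 R -> R3 R) L : (forall x, ~ box L x -> phi x = 0) ->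
  compact (closure [set x | phi x != 0]).
Proof.
move=> h; have cB := @compact_box R L.
have clB : closed (box L : set (R3 R)) by apply: compact_closed cB; exact: norm_hausdorff.
apply: (@subclosed_compact _ _ (box L)) => //; first exact: closed_closure.
rewrite [X in _ `<=` X]((closure_id _).1 clB).
apply: closure_subset => x /= xn; apply: contrapT => /h x0.
by move: xn; rewrite x0 eqxx.
Qed.

Variables (e r L : R) (G : R3 R -> R).
Hypotheses (e0 : 0 < e) (er : e < r) (e_le1 : e <= 1).
Hypotheses (cG : continuous G) (G01 : forall y, 0 <= G y <= 1)
  (GL : forall y, ~ box L y -> G y = 0).
Let r0 : 0 < r := lt_trans e0 er.

Lemma conv_out (K : R3 R -> R) x : (forall z, ~ box r z -> K z = 0) ->
  ~ box (r + L) x -> conv K G x = 0.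
Proof.
move=> Kr nx; rewrite /conv /Rintegral integral0_eq// => y _; congr EFin.
have [ry|/Kr ->] := pselect (box r (x - y)); last by rewrite mul0r.
have [Ly|/GL ->] := pselect (box L y); last by rewrite mulr0.
case: nx; case: ry => /= a1 a2 a3; case: Ly => b1 b2 b3.
have tri (s t : R) : `|s - t| <= r -> `|t| <= L -> `|s| <= r + L.
  by move=> st tL; rewrite -(subrK t s) (le_trans (ler_normD _ _))// lerD.
by split; [exact: tri a1 b1|exact: tri a2 b2|exact: tri a3 b3].
Qed.

Lemma C1_conv_ker u v w : C1 (conv (ker e r u v w) G).
Proof.
have cK := @continuous_ker R e r e0 u v w.
move=> [[a b] c] _.
have cD := @continuous_dker R e r e0 u v w a b c.
have oD := @dker_out R e r r0 u v w a b c.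
have d x := @is_derive_conv R _ _ G (a, b, c) r L x
  (fun y => @is_derive_ker R e r e0 r0 u v w a b c y) cK cD oD cG GL.
split=> [x|]; first by have [] := d x.
rewrite (_ : (fun x => 'D_(a, b, c) _ x) = conv (dker e r u v w a b c) G).
  exact: continuous_conv cD oD cG GL.
by apply/funext => x; have [_] := d x.
Qed.

Lemma D_conv_ker u v w a b c x :
  'D_(a, b, c) (conv (ker e r u v w) G) x = conv (dker e r u v w a b c) G x.
Proof.
have cK := @continuous_ker R e r e0 u v w.
have cD := @continuous_dker R e r e0 u v w a b c.
have oD := @dker_out R e r r0 u v w a b c.
by have [_] := @is_derive_conv R _ _ G (a, b, c) r L x
  (fun y => @is_derive_ker R e r e0 r0 u v w a b c y) cK cD oD cG GL.
Qed.

Definition potential_field x : R3 R :=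
  (conv (ker e r 1 0 0) G x, conv (ker e r 0 1 0) G x, conv (ker e r 0 0 1) G x).

Lemma continuous_tail : continuous (tail e r).
Proof.
apply: continuous_mulf (@continuous_taper_sqn R e r).
apply: continuous_mulf (@continuous_expf _ _ _ 3 (@continuous_isig_sqn R e e0)).
exact: continuous_mulf (@continuous_cstf _ _ _) (@continuous_sqn R).
Qed.

Lemma tail_out z : ~ box r z -> tail e r z = 0.
Proof. by move=> /(sqn_box (ltW r0))/(taper_out e r0) h; rewrite /tail h mulr0. Qed.

Lemma tail_ge0 z : 0 <= tail e r z.
Proof.
apply: mulr_ge0 (taper_ge0 e r _); apply: mulr_ge0; last first.
  by apply/exprn_ge0/ltW/isig_gt0/sqn_ge0.
by apply: mulr_ge0 (sqn_ge0 _); rewrite divr_ge0// sqr_ge0.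
Qed.

Let iKG (K : R3 R -> R) x : continuous K ->
  vol.-integrable setT (EFin \o (fun y : T3 => K (x - y) * G y)).
Proof.
move=> cK; exact: integrable_mul_compact (continuous_reflect_translate (x := x) cK) cG GL.
Qed.

Let convD (K1 K2 : R3 R -> R) x : continuous K1 -> continuous K2 ->
  conv (fun z => K1 z + K2 z) G x = conv K1 G x + conv K2 G x.
Proof.
move=> c1 c2; rewrite /conv -(RintegralD measurableT (iKG x c1) (iKG x c2)).
by apply: eq_Rintegral => y _; rewrite mulrDl.
Qed.

Let convZ (k : R) (K : R3 R -> R) x : continuous K ->
  conv (fun z => k * K z) G x = k * conv K G x.
Proof.
move=> cK; rewrite /conv -(RintegralZl k measurableT (iKG x cK)).
by apply: eq_Rintegral => y _; rewrite mulrA.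
Qed.

Lemma div_potential_field x :
  div3 potential_field x = conv (core e r) G x - conv (tail e r) G x.
Proof.
rewrite /div3 /potential_field /= /e1 /e2 /e3 !D_conv_ker.
have cD u v w a b c := @continuous_dker R e r e0 u v w a b c.
rewrite -convD// -convD//; last exact: continuous_addf.
rewrite -mulN1r -convZ; last exact: continuous_tail.
rewrite -convD; first last.
- exact: continuous_mulf (@continuous_cstf _ _ _) continuous_tail.
- exact: (@continuous_core R e r e0).
by congr (conv _ G x); apply/funext => z; rewrite div_ker// mulN1r.
Qed.

(** The modulus is the component in the direction of the field itself, and every
component is a convolution with some [ker u v w]. *)
Lemma potential_field_bound x : eucl (potential_field x) <= 28 / 45 * pi * r.
Proof.
set E := eucl _.
have E0 : 0 <= E := eucl_ge0 _.
have [->|En] := eqVneq E 0; first by rewrite !mulr_ge0 ?pi_ge0 ?(ltW r0).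
pose f := potential_field x.
have sE : f.1.1 ^+ 2 + f.1.2 ^+ 2 + f.2 ^+ 2 = E ^+ 2 by rewrite eucl_sqn.
pose u := f.1.1 / E; pose v := f.1.2 / E; pose w := f.2 / E.
have uvw : u ^+ 2 + v ^+ 2 + w ^+ 2 = 1.
  by rewrite /u /v /w !exprMn -!mulrDl sE exprVn divff// expf_neq0.
have cK a b c := @continuous_ker R e r e0 a b c.
have -> : E = conv (ker e r u v w) G x.
  have -> : ker e r u v w = (fun z => u * ker e r 1 0 0 z + (v * ker e r 0 1 0 z + w * ker e r 0 0 1 z)).
    by apply/funext => z; rewrite /ker /lin; ring.
  have cZ (k a b c : R) : continuous (fun z : R3 R => k * ker e r a b c z).
    exact: continuous_mulf (@continuous_cstf _ _ _) (cK a b c).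
  rewrite !convD ?convZ//; last exact: continuous_addf.
  rewrite -/(f.1.1) -/(f.1.2) -/(f.2).
  rewrite (_ : u * f.1.1 + (v * f.1.2 + w * f.2) = (f.1.1 ^+ 2 + f.1.2 ^+ 2 + f.2 ^+ 2) / E).
    by rewrite sE expr2 mulfK.
  by rewrite /u /v /w; ring.
exact: (conv_ker_le e0 er x uvw cG G01).
Qed.

Let C := 28 / 45 * pi * r.

Let C0 : 0 < C. Proof. by rewrite !mulr_gt0 ?invr_gt0 ?pi_gt0. Qed.

Let field x : R3 R := (C^-1 * (potential_field x).1.1, C^-1 * (potential_field x).1.2,
  C^-1 * (potential_field x).2).

Let deriveZ_field (f : R3 R -> R) d : C1 f -> d = e1 R \/ d = e2 R \/ d = e3 R ->
  (forall x, derivable (fun x => C^-1 * f x) x d) /\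
  (forall x, 'D_d (fun x => C^-1 * f x) x = C^-1 * 'D_d f x).
Proof.
move=> /(_ d) h /h [df _].
have D x : is_derive x d (fun x => C^-1 * f x) (C^-1 * 'D_d f x).
  have dfx : is_derive x d f ('D_d f x) by apply: DeriveDef; first exact: df.
  apply: is_derive_line; have := isd_mul (isd_cst C^-1 0) (is_derive_line_inv dfx).
  by rewrite mul0r add0r.
by split => x; have [] := D x.
Qed.

Let C1Z (f : R3 R -> R) : C1 f -> C1 (fun x => C^-1 * f x).
Proof.
move=> h d hd; have [h1 h2] := deriveZ_field h hd; split=> //.
rewrite (_ : (fun x => 'D_d _ x) = (fun x => C^-1 * 'D_d f x)); last by apply/funext.
exact: continuous_mulf (@continuous_cstf _ _ _) (h d hd).2.
Qed.

Lemma test_field_potential : test_field field.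
Proof.
split.
- by split; [|split]; apply: C1Z; exact: C1_conv_ker.
- apply: (@closure_support_compact _ (r + L)) => x nx.
  by rewrite /field /potential_field /= !conv_out ?mulr0//; apply: ker_out.
- move=> x; have -> : eucl (field x) = C^-1 * eucl (potential_field x).
    apply: (@pexpIrn _ 2) => //; rewrite ?nnegrE ?mulr_ge0 ?eucl_ge0 ?invr_ge0 ?(ltW C0)//.
    by rewrite exprMn !eucl_sqn /sqn /field /=; ring.
  rewrite ler_pdivrMl// mulr1; exact: potential_field_bound.
Qed.

Lemma div_test_field x :
  div3 field x = C^-1 * (conv (core e r) G x - conv (tail e r) G x).
Proof.
rewrite -div_potential_field /div3 /field.
have [_ ->] := deriveZ_field (C1_conv_ker 1 0 0) (or_introl erefl).
have [_ ->] := deriveZ_field (C1_conv_ker 0 1 0) (or_intror (or_introl erefl)).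
have [_ ->] := deriveZ_field (C1_conv_ker 0 0 1) (or_intror (or_intror erefl)).
by rewrite !mulrDr.
Qed.

(** The field divided by [C] is a test field, so its flux is at most the total
variation; its divergence is the convolution of [G] with [core - tail]. *)
Lemma flux_lower_bound (chi : R3 R -> R) (w : R) : BV01 chi ->
  (forall x z, sqn z <= e -> G x - w <= G (x - z)) ->
  0 <= 1 - (4 / r ^+ 2 + 3) * e ->
  (((1 - (4 / r ^+ 2 + 3) * e) * (4 * pi) * \int[vol]_x (chi x * (G x - w)))%:E <=
    C%:E * TV3 chi + (4 / r ^+ 2)%:E * coulomb2 chi G)%E.
Proof.
move=> [chi01 ichi TVfin] Gw m0.
have chi0 x : 0 <= chi x by case: (chi01 x) => ->.
have mchi : measurable_fun [set: T3] (chi : T3 -> R).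
  by have := measurable_int _ ichi => /measurable_EFinP.
have mG := continuous_measurable3 cG.
have G0 x : 0 <= G x by case/andP: (G01 x).
have ib (K : R3 R -> R) : continuous K -> (forall z, ~ box r z -> K z = 0) ->
    vol.-integrable setT (EFin \o (fun x : T3 => chi x * conv K G x)).
  move=> cK Kr; have cc := continuous_conv cK Kr cG GL.
  have [M M0 hM] := continuous_bounded_box (r + L) cc.
  apply: (@integrable_bounded_box _ _ M (r + L)).
  - by apply: measurable_funM => //; exact: continuous_measurable3.
  - move=> x; rewrite normrM (ger0_norm (chi0 x)).
    have [/hM|/(conv_out Kr) ->] := pselect (box (r + L) x); last by rewrite normr0 mulr0.
    by move=> h; apply: le_trans (h); case: (chi01 x) => ->; rewrite ?mul1r// mul0r.
  - by move=> x /(conv_out Kr) ->; rewrite mulr0.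
have ic := ib _ (@continuous_core R e r e0) (@core_out R e r e0 er).
have it := ib _ continuous_tail tail_out.
have flux : ((C^-1 * (\int[vol]_x (chi x * conv (core e r) G x) -
    \int[vol]_x (chi x * conv (tail e r) G x)))%:E <= TV3 chi)%E.
  apply: ereal_sup_ubound; exists field; first exact: test_field_potential.
  rewrite -RintegralB// -RintegralZl//; last exact: (integrableB measurableT ic it).
  rewrite fineK; last first.
    exact: integrable_fin_num (integrableZl measurableT (C^-1) (integrableB measurableT ic it)).
  apply: eq_integral => x _; congr EFin; rewrite div_test_field; ring.
have tailE : ((\int[vol]_x (chi x * conv (tail e r) G x))%:E <=
    (4 / r ^+ 2)%:E * coulomb2 chi G)%E.
  rewrite fineK; last exact: integrable_fin_num.
  have r40 : (0 <= (4 / r ^+ 2)%:E)%E by rewrite lee_fin divr_ge0 ?sqr_ge0.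
  have q0 x y : (0 <= (chi x * G y / eucl (x - y))%:E)%E.
    by rewrite lee_fin divr_ge0 ?mulr_ge0 ?eucl_ge0.
  have mI := measurable_coulomb_inner mchi mG chi0 G0.
  rewrite -ge0_integralZl//; last by move=> x _; apply: integral_ge0.
  apply: ge0_le_integral.
  - exact: measurableT.
  - move=> x _; rewrite lee_fin mulr_ge0//; apply: Rintegral_ge0 => y _.
    by rewrite mulr_ge0// tail_ge0.
  - exact: (measurable_int _ it).
  - by apply: emeasurable_funM; first exact: measurable_cst.
  - move=> x _.
    have mk : measurable_fun [set: T3] (fun y : T3 => (chi x * G y / eucl (x - y))%:E).
      apply/measurable_EFinP; apply: measurable_funM; last exact: measurable_inv_dist.
      by apply: measurable_funM; first exact: measurable_cst.
    have ix := iKG x continuous_tail.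
    rewrite EFinM fineK; last exact: integrable_fin_num.
    rewrite -ge0_integralZl//; last 3 first.
    + exact: (measurable_int _ ix).
    + by move=> y _; rewrite lee_fin mulr_ge0// tail_ge0.
    + by rewrite lee_fin.
    rewrite -ge0_integralZl//.
    apply: ge0_le_integral.
    + exact: measurableT.
    + by move=> y _; rewrite -EFinM lee_fin mulr_ge0// mulr_ge0// tail_ge0.
    + by apply: emeasurable_funM; [exact: measurable_cst|exact: (measurable_int _ ix)].
    + by apply: emeasurable_funM; first exact: measurable_cst.
    + move=> y _; rewrite -!EFinM lee_fin.
      have := tail_le r e0 (x - y); move: (tail _ _ _) (eucl _) (4 / _) => t d q td.
      rewrite (_ : q * (chi x * G y / d) = (chi x * G y) * (q / d)); last by ring.
      by rewrite (_ : chi x * (t * G y) = (chi x * G y) * t); [rewrite ler_wpM2l// mulr_ge0|ring].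
have coreE : (1 - (4 / r ^+ 2 + 3) * e) * (4 * pi) * \int[vol]_x (chi x * (G x - w)) <=
    \int[vol]_x (chi x * conv (core e r) G x).
  have iw : vol.-integrable setT (EFin \o (fun x : T3 => chi x * (G x - w))).
    have i1 : vol.-integrable setT (EFin \o (fun x : T3 => chi x * G x)).
      apply: (le_integrable measurableT _ _ ichi).
        by apply/measurable_EFinP; exact: measurable_funM.
      move=> x _ /=; rewrite lee_fin normrM ler_piMr// ger0_norm//.
      by case/andP: (G01 x).
    have i2 := integrableZl measurableT w ichi.
    have := integrableB measurableT i1 i2; congr (_.-integrable _).
    apply/funext => x.
    change ((chi x * G x - w * chi x)%:E = (chi x * (G x - w))%:E); congr EFin; ring.
  rewrite -RintegralZl//; apply: le_Rintegral => //.
  - exact: (integrableZl measurableT _ iw).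
  - move=> x _; have := @conv_core_ge R e r e0 er G (G x - w) x e_le1 cG G0 (Gw x) m0.
    move: (_ * (4 * pi)) (conv _ _ x) => a b h.
    by rewrite (_ : a * (chi x * (G x - w)) = chi x * ((G x - w) * a)); [exact: ler_wpM2l|ring].
have : ((\int[vol]_x (chi x * conv (core e r) G x))%:E <=
    C%:E * TV3 chi + (\int[vol]_x (chi x * conv (tail e r) G x))%:E)%E.
  move: flux; move: (Rintegral _ _ _) (Rintegral _ _ _) => b a ab.
  have -> : a%:E = (C%:E * (C^-1 * (a - b))%:E + b%:E)%E.
    by rewrite -EFinM -EFinD mulVKf ?gt_eqF// subrK.
  by apply: leeD => //; apply: lee_wpmul2l ab; rewrite lee_fin ltW.
move=> h; apply: (@le_trans _ _ (\int[vol]_x (chi x * conv (core e r) G x))%:E); first by rewrite lee_fin.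
by apply: le_trans h _; apply: leeD2l.
Qed.

End FluxLowerBound.

(** * Approximation of measurable sets by continuous functions *)

Section ContinuousApproximation.
Context {R : realType}.
Notation T1 := (measurableTypeR R).
Notation T3 := (R3 (measurableTypeR R)).
Notation vol := (vol3 R).
Implicit Types (f g : R3 R -> R) (A : set (R3 R)).

(** Approximation in the mean on every bounded box; the restriction to boxes makes
the class stable under complements. *)
Definition approximable f := forall L d : R, 0 < d -> exists G : R3 R -> R,
  [/\ continuous G, forall y, 0 <= G y <= 1 &
      (\int[vol]_(x in box L) (`|f x - G x|)%:E <= d%:E)%E].

Let mdist f G : measurable_fun [set: T3] (f : T3 -> R) -> continuous G -> forall L,
  measurable_fun (box L : set T3) (fun x : T3 => (`|f x - G x|)%:E).
Proof.
move=> mf cG L; apply/measurable_EFinP/measurable_funTS.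
apply: measurableT_comp => //; apply: measurable_funB => //.
exact: continuous_measurable3.
Qed.

Lemma approximable_continuous f : continuous f -> (forall y, 0 <= f y <= 1) -> approximable f.
Proof.
move=> cf f01 L d d0; exists f; split=> //.
by rewrite integral0_eq ?lee_fin ?(ltW d0)// => x _; rewrite subrr normr0.
Qed.

Lemma approximable_compl f : approximable f -> approximable (fun x => 1 - f x).
Proof.
move=> af L d /(af L)[G [cG G01 Gd]]; exists (fun x => 1 - G x); split.
- by move=> x; apply: cvgB; [exact: cvg_cst|exact: cG].
- by move=> y; have := G01 y; move=> /andP[? ?]; apply/andP; split; lra.
- apply: le_trans Gd; rewrite le_eqVlt; apply/orP; left; apply/eqP.
  by apply: eq_integral => x _; rewrite opprB addrC subrKA distrC addrC.
Qed.

Lemma approximable_max f g : measurable_fun [set: T3] (f : T3 -> R) ->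
  measurable_fun [set: T3] (g : T3 -> R) -> approximable f -> approximable g ->
  approximable (fun x => Num.max (f x) (g x)).
Proof.
move=> mf mg af ag L d d0; have d20 : 0 < d / 2 by rewrite divr_gt0.
have [F [cF F01 Fd]] := af L _ d20; have [G [cG G01 Gd]] := ag L _ d20.
exists (fun x => Num.max (F x) (G x)); split.
- have -> : (fun x => Num.max (F x) (G x)) = (fun x => Num.max (F x - G x) 0 + G x).
    by apply/funext => x; rewrite addr_maxl subrK add0r.
  have cFG : continuous (fun x => F x - G x) by move=> x; apply: cvgB; [exact: cF|exact: cG].
  exact: continuous_addf (continuous_max0 cFG) cG.
- move=> y; have /andP[a1 a2] := F01 y; have /andP[b1 b2] := G01 y.
  by rewrite le_max a1 ge_max a2 b2.
- have mB := @measurable_box R L.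
  apply: (@le_trans _ _ (\int[vol]_(x in box L) ((`|f x - F x|)%:E + (`|g x - G x|)%:E))%E).
    apply: ge0_le_integral => //.
    + apply/measurable_EFinP/measurable_funTS; apply: measurableT_comp => //.
      apply: measurable_funB; first exact: measurable_maxr.
      by apply: measurable_maxr; exact: continuous_measurable3.
    + by apply: emeasurable_funD; exact: mdist.
    + move=> x _; rewrite -EFinD lee_fin.
      move: (f x) (g x) (F x) (G x) => a b a' b'.
      have h1 := ler_norm (a - a'); have h2 := ler_norm (b - b').
      have h3 := ler_norm (- (a - a')); have h4 := ler_norm (- (b - b')).
      rewrite !normrN in h3 h4.
      have h5 := normr_ge0 (a - a'); have h6 := normr_ge0 (b - b').
      rewrite ler_norml; move: (`|a - a'|) (`|b - b'|) h1 h2 h3 h4 h5 h6 => p q h1 h2 h3 h4 h5 h6.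
      by case: (leP a b) => ab; case: (leP a' b') => ab'; apply/andP; split; lra.
  rewrite ge0_integralD//; try exact: mdist.
  by rewrite [X in (_ <= X%:E)%E](_ : d = d / 2 + d / 2); [rewrite EFinD leeD|field].
Qed.

Lemma approximable_lim (f_ : nat -> R3 R -> R) f :
  (forall n, measurable_fun [set: T3] (f_ n : T3 -> R)) ->
  measurable_fun [set: T3] (f : T3 -> R) ->
  (forall n x, 0 <= f_ n x <= 1) -> (forall x, f_ ^~ x @ \oo --> f x) ->
  (forall n, approximable (f_ n)) -> approximable f.
Proof.
move=> mf_ mf f01 ff af L d d0; have d20 : 0 < d / 2 by rewrite divr_gt0.
have mB := @measurable_box R L.
pose one : T3 -> \bar R := EFin \o (cst 1 : T3 -> R).
have i1 : vol.-integrable (box L) one.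
  apply: measurable_bounded_integrable => //; first exact: vol3_box.
  by exists 1; split; [exact: num_real|move=> y y1 x _ /=; rewrite normr1 ltW].
have mfE n : measurable_fun (box L : set T3) (fun x : T3 => (f_ n x)%:E).
  by apply/measurable_EFinP/measurable_funTS.
have mfE' : measurable_fun (box L : set T3) (fun x : T3 => (f x)%:E).
  by apply/measurable_EFinP/measurable_funTS.
have ffE : {ae vol, forall x : T3, box L x -> (fun n => (f_ n x)%:E) @ \oo --> (f x)%:E}.
  by apply: aeW => x _; apply: cvg_EFin; [exact: nearW|exact: ff].
have fbd : {ae vol, forall (x : T3) n, box L x -> (`|(f_ n x)%:E| <= one x)%E}.
  apply: aeW => x n _; have /andP[p0 p1] := f01 n x.
  by rewrite /= lee_fin ger0_norm.
have [_ dc _] := dominated_convergence mB mfE mfE' ffE i1 fbd.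
have := dc [set u | (u < (d / 2)%:E)%E] (lt_nbhsl d20).
case=> n _ /(_ n (leqnn n)) /= /ltW fnd.
have [G [cG G01 Gd]] := af n L _ d20; exists G; split=> //.
apply: (@le_trans _ _ (\int[vol]_(x in box L) ((`|f_ n x - f x|)%:E + (`|f_ n x - G x|)%:E))%E).
  have mff : measurable_fun (box L : set T3) (fun x : T3 => (`|f_ n x - f x|)%:E).
    apply/measurable_EFinP/measurable_funTS; apply: measurableT_comp => //.
    exact: measurable_funB.
  apply: ge0_le_integral => //.
  - exact: mdist.
  - by apply: emeasurable_funD => //; exact: mdist.
  - move=> x _; rewrite -EFinD lee_fin [`|f_ n x - f x|]distrC.
    by rewrite (_ : f x - G x = (f x - f_ n x) + (f_ n x - G x)) ?ler_normD// subrKA.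
rewrite ge0_integralD//; first last.
- exact: mdist.
- apply/measurable_EFinP/measurable_funTS; apply: measurableT_comp => //.
  exact: measurable_funB.
by rewrite [X in (_ <= X%:E)%E](_ : d = d / 2 + d / 2); [rewrite EFinD leeD|field].
Qed.

Definition approximable_set A := measurable (A : set T3) /\ approximable (\1_A : R3 R -> R).

(** The indicator is the limit of the truncations of [n g] to values between [0] and [1]. *)
Lemma approximable_set_pos (g : R3 R -> R) : continuous g -> approximable_set [set x | 0 < g x].
Proof.
move=> cg; have mg := continuous_measurable3 cg.
have mA : measurable ([set x | 0 < g x] : set T3).
  apply: open_measurable3; change (open (g @^-1` [set t | 0 < t])).
  by apply: open_comp; [move=> x _; exact: cg|exact: open_gt].
split=> //.
pose f_ n x := 1 - Num.max (1 - Num.max (n%:R * g x) 0) 0.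
have cf n : continuous (f_ n).
  have c1 : continuous (fun x => n%:R * g x) := continuous_mulf (@continuous_cstf _ _ _) cg.
  have c2 : continuous (fun x => 1 - Num.max (n%:R * g x) 0).
    by move=> x; apply: cvgB; [exact: cvg_cst|exact: continuous_max0 c1 x].
  by move=> x; apply: cvgB; [exact: cvg_cst|exact: continuous_max0 c2 x].
have f01 n x : 0 <= f_ n x <= 1.
  rewrite /f_ gerBl subr_ge0 ge_max ler01 gerBl andbT; apply/andP; split.
    by rewrite le_max lexx orbT.
  by rewrite le_max lexx orbT.
apply: (@approximable_lim f_) => //.
- by move=> n; exact: continuous_measurable3.
- move=> x; rewrite indicE; have [gx|gx] := ltP 0 (g x).
    rewrite mem_set//; apply: cvg_near_cst; exists (Num.bound (g x)^-1) => // n /= bn.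
    have n1 : 1 <= n%:R * g x.
      rewrite -ler_pdivrMr// div1r; apply: (@le_trans _ _ (Num.bound (g x)^-1)%:R).
        by apply/ltW/archi_boundP; rewrite invr_ge0 ltW.
      by rewrite ler_nat.
    rewrite /f_ (max_l (le_trans ler01 n1)) max_r ?subr0// subr_le0//.
  rewrite memNset ?/=; last by apply/negP; rewrite -leNgt.
  apply: cvg_near_cst; exists 0%N => // n _.
  by rewrite /f_ (max_r (mulr_ge0_le0 _ gx))// subr0 (max_l ler01) subrr.
- by move=> n; exact: approximable_continuous.
Qed.

Lemma approximable_setC A : approximable_set A -> approximable_set (~` A).
Proof.
move=> [mA aA]; split; first exact: measurableC.
have -> : (\1_(~` A) : R3 R -> R) = (fun x => 1 - \1_A x).
  apply/funext => x; rewrite !indicE in_setC; case: (x \in A) => /=; by rewrite ?subrr ?subr0.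
exact: approximable_compl.
Qed.

Lemma approximable_setU A B : approximable_set A -> approximable_set B ->
  approximable_set (A `|` B).
Proof.
move=> [mA aA] [mB aB]; split; first exact: measurableU.
have -> : (\1_(A `|` B) : R3 R -> R) = (fun x => Num.max (\1_A x) (\1_B x)).
  apply/funext => x; rewrite !indicE in_setU; case: (x \in A); case: (x \in B) => /=;
    by rewrite ?maxxx// ?(max_l ler01) ?(max_r ler01).
by apply: approximable_max => //; exact: measurable_indic.
Qed.

Lemma approximable_set0 : approximable_set set0.
Proof.
split; first exact: measurable0.
apply: approximable_continuous => [x|y]; rewrite indic0; first exact: cvg_cst.
by rewrite /= lexx ler01.
Qed.

Lemma approximable_bigcup (F : nat -> set (R3 R)) : (forall n, approximable_set (F n)) ->
  approximable_set (\bigcup_k F k).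
Proof.
move=> aF; pose U n := \big[setU/set0]_(k < n) F k.
have aU n : approximable_set (U n).
  rewrite /U; elim: n => [|n IH]; first by rewrite big_ord0; exact: approximable_set0.
  by rewrite big_ord_recr; exact: approximable_setU.
have mF : measurable (\bigcup_k F k : set T3).
  by apply: bigcupT_measurable => k; have [] := aF k.
split=> //; apply: (@approximable_lim (fun n => \1_(U n))).
- by move=> n; apply: measurable_indic; have [] := aU n.
- exact: measurable_indic.
- by move=> n x; rewrite indicE; case: (x \in U n); rewrite ?lexx ler01.
- move=> x; rewrite indicE; have [[k _ Fk]|nx] := pselect ((\bigcup_k F k) x).
    rewrite mem_set; last by exists k.
    apply: cvg_near_cst; exists k.+1 => // n /= kn; rewrite indicE mem_set//.
    by rewrite /U -bigcup_mkord; exists k.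
  rewrite memNset//; apply: cvg_near_cst; exists 0%N => // n _; rewrite indicE memNset//.
  by rewrite /U -bigcup_mkord => -[k _ Fk]; apply: nx; exists k.
- by move=> n; have [] := aU n.
Qed.

(** The approximable sets form a sigma-algebra, for which every continuous function
is measurable; hence so is the identity, seen as a map to the product space
[R * R * R], and every measurable set is approximable. *)
Lemma measurable_approximable A : measurable (A : set T3) -> approximable (\1_A : R3 R -> R).
Proof.
have sD : sigma_algebra setT approximable_set.
  split; first exact: approximable_set0.
    by move=> B aB; rewrite setTD; exact: approximable_setC.
  by move=> F aF; exact: approximable_bigcup.
pose TD := g_sigma_algebraType (approximable_set : set (set T3)).
have coord (g : R3 R -> R) : continuous g -> measurable_fun [set: TD] (g : TD -> T1).
  move=> cg; apply: (measurability _ (measurable_realfun.RGenInftyO.measurableE R)).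
  move=> _ [_ [c ->] <-]; rewrite setTI; apply: sub_sigma_algebra.
  have -> : g @^-1` `]-oo, c[ = [set x | 0 < c - g x].
    by apply/seteqP; split => x /=; rewrite in_itv /= subr_gt0.
  by apply: approximable_set_pos => x; apply: cvgB; [exact: cvg_cst|exact: cg].
have mid : measurable_fun [set: TD] (fun x : TD => (x.1.1, x.1.2, x.2) : T3).
  apply: measurable_fun_pair; last exact: (coord _ (@continuous_x3 R)).
  by apply: measurable_fun_pair; [exact: (coord _ (@continuous_x1 R))|exact: (coord _ (@continuous_x2 R))].
move=> mA; have := mid measurableT _ mA; rewrite setTI.
have -> : (fun x : TD => (x.1.1, x.1.2, x.2) : T3) @^-1` A = A.
  by apply/seteqP; split => -[[a b] c].
by rewrite (measurable_g_measurableTypeE sD) => -[].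
Qed.

End ContinuousApproximation.

(** * The lower bound *)

Section LowerBound.
Context {R : realType}.
Notation mu := (@lebesgue_measure R).
Notation T3 := (R3 (measurableTypeR R)).
Notation leb2 := (sfprod mu mu).
Notation leb3 := (sfprod leb2 mu).
Notation vol := (vol3 R).
Implicit Types (x y z : R3 R).

Lemma uniformly_continuous_sqn (G : R3 R -> R) (L w : R) : continuous G ->
  (forall y, ~ box L y -> G y = 0) -> 0 < w ->
  exists2 d : R, 0 < d & forall x z, sqn z < d -> G x - w <= G (x - z).
Proof.
move=> cG GL w0; have := uniformly_continuous_compact cG GL w0.
move=> /nbhs_ballP[d /= d0 hd]; exists (d ^+ 2); first by rewrite exprn_gt0.
move=> x z zd; have bz : ball (0 : R3 R) d (- z).
  have H (t : R) : t ^+ 2 <= sqn z -> `|t| < d.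
    move=> ts; rewrite -(gtr0_norm d0) -ltr_sqr ?nnegrE// !real_normK ?num_real//.
    exact: le_lt_trans ts zd.
  have p1 := sqr_ge0 z.1.1; have p2 := sqr_ge0 z.1.2; have p3 := sqr_ge0 z.2.
  by split; [split|]; rewrite /ball /= sub0r opprK; apply: H; rewrite /sqn; lra.
have : `|G (- z + x) - G x| <= w := hd _ bz x.
rewrite (addrC (- z)) distrC => h.
by have := le_trans (ler_norm _) h; lra.
Qed.

(** Let [e] tend to [0] in [flux_lower_bound], the scale of oscillation of [G] being
fixed. *)
Lemma mollified_lower_bound (chi G : R3 R -> R) (L r : R) : 0 < r -> BV01 chi ->
  continuous G -> (forall y, 0 <= G y <= 1) -> (forall y, ~ box L y -> G y = 0) ->
  ((4 * pi * \int[vol]_x (chi x * G x))%:E <=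
    (28 / 45 * pi * r)%:E * TV3 chi + (4 / r ^+ 2)%:E * coulomb2 chi G)%E.
Proof.
move=> r0 bchi cG G01 GL; have [chi01 ichi _] := bchi.
have chi0 x : 0 <= chi x by case: (chi01 x) => ->.
have mchi : measurable_fun [set: T3] (chi : T3 -> R).
  by have := measurable_int _ ichi => /measurable_EFinP.
have mG := continuous_measurable3 cG.
have i1 : vol.-integrable setT (EFin \o (fun x : T3 => chi x * G x)).
  apply: (le_integrable measurableT _ _ ichi).
    by apply/measurable_EFinP; exact: measurable_funM.
  move=> x _ /=; rewrite lee_fin normrM ler_piMr// ger0_norm//;
    by case/andP: (G01 x).
pose A := \int[vol]_x (chi x * G x); pose V := \int[vol]_x chi x.
have A0 : 0 <= A by apply: Rintegral_ge0 => x _; rewrite mulr_ge0//; case/andP: (G01 x).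
have V0 : 0 <= V by apply: Rintegral_ge0.
have p0 : 0 < 4 * pi :> R by rewrite mulr_gt0 ?pi_gt0.
apply/lee_addgt0Pr => eps eps0.
(* Oscillation and mass defect of at most [w] cost at most
   [4 pi w (A + V) <= eps]. *)
pose w := eps / (4 * pi * (A + V) + 1).
have D0 : 0 < 4 * pi * (A + V) + 1 by rewrite ltr_wpDl// mulr_ge0 ?addr_ge0// ltW.
have w0 : 0 < w by rewrite divr_gt0.
have we : w * (4 * pi * (A + V)) <= eps.
  by rewrite /w mulrAC ler_pdivrMr// ler_wpM2l ?(ltW eps0)// lerDl.
have [d d0 Gd] := uniformly_continuous_sqn cG GL w0.
pose k := 4 / r ^+ 2 + 3.
have k0 : 0 < k by rewrite ltr_wpDl// divr_ge0// sqr_ge0.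
pose e := Num.min (Num.min (r / 2) 1) (Num.min (d / 2) (Num.min (w / k) (1 / k))).
have e0 : 0 < e by rewrite !lt_min ltr01 !divr_gt0.
have er : e < r.
  by apply: (@le_lt_trans _ _ (r / 2)); [rewrite /e !ge_min lexx|lra].
have e1 : e <= 1 by rewrite /e !ge_min lexx orbT.
have ed : e < d.
  by apply: (@le_lt_trans _ _ (d / 2)); [rewrite /e !ge_min lexx !orbT|lra].
have ew : k * e <= w by rewrite mulrC -ler_pdivlMr// /e !ge_min lexx !orbT.
have ek : k * e <= 1 by rewrite mulrC -ler_pdivlMr// /e !ge_min lexx !orbT.
have m0 : 0 <= 1 - (4 / r ^+ 2 + 3) * e by rewrite subr_ge0.
have := @flux_lower_bound R e r L G e0 er e1 cG G01 GL chi w bchi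
  (fun x z h => Gd x z (le_lt_trans h ed)) m0.
rewrite -/k.
have -> : \int[vol]_x (chi x * (G x - w)) = A - w * V.
  rewrite /A /V -RintegralZl// -RintegralB//; last exact: (integrableZl measurableT w ichi).
  by apply: eq_Rintegral => x _; ring.
move=> h.
have ke0 : 0 <= k * e by rewrite mulr_ge0// ltW.
have real_le : 4 * pi * A <= (1 - k * e) * (4 * pi) * (A - w * V) + eps.
  have q1 : k * e * A <= w * A by rewrite ler_wpM2r.
  have q2 : 0 <= k * e * (w * V) by rewrite mulr_ge0// mulr_ge0// ltW.
  have q3 : A - w * (A + V) <= (1 - k * e) * (A - w * V).
    by move: q1 q2; move: (k * e) => t; clear -t; nra.
  have := ler_wpM2l (ltW p0) q3.
  move: we; move: (4 * pi) (1 - k * e) => p t; clear; lra.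
apply: (@le_trans _ _ (((1 - k * e) * (4 * pi) * (A - w * V))%:E + eps%:E)%E).
  by rewrite -EFinD lee_fin.
exact: leeD.
Qed.

Lemma inv_dist_potential y :
  (\int[vol]_x ((if eucl (y - x) ^+ 2 < 1 then (eucl (y - x))^-1 else 0)%R)%:E = (2 * pi)%:E)%E.
Proof.
have b := @ball_potential R 1 0.
have E0 : eucl (0 : R3 R) ^+ 2 = 0 by rewrite eucl_sqn /sqn /= !expr0n /= !addr0.
have l1 : eucl (0 : R3 R) ^+ 2 < 1 ^+ 2 by rewrite E0 expr1n.
have := b l1 ler01; rewrite E0 mul0r subr0 expr1n mulr1 => <-.
have mf := measurable_ball_kernel 1 (0 : R3 R).
rewrite -((preserves_volume_sub y).2 _ mf (fun z => ball_kernel_ge0 1 0 z)).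
apply: eq_integral => x _; rewrite /ball_kernel expr1n.
have -> // : eucl (0 - (y - x)) = eucl (y - x).
by rewrite /eucl /= !sub0r !sqrrN.
Qed.

(** The potential of [chi] is bounded: split the Coulomb kernel at distance [1].
Its inner part has integral [2 pi], its outer part is at most [1]. *)
Lemma coulomb2_le (chi h : R3 R -> R) : BV01 chi -> measurable_fun [set: T3] (h : T3 -> R) ->
  (forall x, 0 <= h x) ->
  (coulomb2 chi h <= (2 * pi + \int[vol]_x chi x)%:E * \int[vol]_x (h x)%:E)%E.
Proof.
move=> [chi01 ichi _] mh h0.
have chi0 x : 0 <= chi x by case: (chi01 x) => ->.
have chi1 x : chi x <= 1 by case: (chi01 x) => ->.
have mchi : measurable_fun [set: T3] (chi : T3 -> R).
  by have := measurable_int _ ichi => /measurable_EFinP.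
have mk := measurable_coulomb_kernel mchi mh.
have k0 (p : T3 * T3) : (0 <= (chi p.1 * h p.2 / eucl (p.1 - p.2))%:E)%E.
  by rewrite lee_fin divr_ge0 ?mulr_ge0// eucl_ge0.
have sw := @fubini_tonelli _ _ _ _ _ leb3 leb3 _ mk k0.
have V0 : 0 <= \int[vol]_x chi x by apply: Rintegral_ge0.
have pp : 0 <= 2 * pi :> R by rewrite mulr_ge0 ?pi_ge0.
have pV := addr_ge0 pp V0.
have E : coulomb2 chi h = (\int[vol]_y \int[vol]_x (chi x * h y / eucl (x - y))%:E)%E := sw.
rewrite E; clear E sw; move: pV; set kap := 2 * pi + _ => pV.
have mhE : measurable_fun [set: T3] (fun x : T3 => (h x)%:E) by exact/measurable_EFinP.
have h0E (x : T3) : setT x -> (0 <= (h x)%:E)%E by move=> _; rewrite lee_fin.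
have -> : (kap%:E * \int[vol]_x (h x)%:E = \int[vol]_x (kap%:E * (h x)%:E))%E.
  by apply/esym; apply: ge0_integralZl.
apply: ge0_le_integral.
- exact: measurableT.
- by move=> y _; apply: integral_ge0 => x _; exact: (k0 (x, y)).
- exact: (@measurable_fun_fubini_tonelli_G _ _ _ _ _ leb3 _ mk k0).
- by apply: emeasurable_funM; [exact: measurable_cst|exact: mhE].
move=> y _.
pose q x := if eucl (y - x) ^+ 2 < 1 then (eucl (y - x))^-1 else 0.
have mq : measurable_fun [set: T3] (fun x : T3 => (q x)%:E).
  have md : measurable_fun [set: T3] (fun x : T3 => eucl (y - x)).
    exact: measurableT_comp measurable_eucl (preserves_volume_sub y).1.
  apply/measurable_EFinP; apply: measurable_fun_ifT; last exact: measurable_cst.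
    by apply: measurable_fun_ltr; [exact: measurable_funX|exact: measurable_cst].
  exact: measurable_inv_dist.
have q0 x : (0 <= (q x)%:E)%E.
  rewrite lee_fin /q; case: (_ < 1); last exact: lexx.
  by rewrite invr_ge0; exact: eucl_ge0.
have mcE : measurable_fun [set: T3] (fun x : T3 => (chi x)%:E) by apply/measurable_EFinP.
have c0E x : (0 <= (chi x)%:E)%E by rewrite lee_fin.
apply: (@le_trans _ _ (\int[vol]_x ((h y)%:E * ((q x)%:E + (chi x)%:E)))%E).
  apply: ge0_le_integral.
  - exact: measurableT.
  - by move=> x _; exact: (k0 (x, y)).
  - have mp : measurable_fun [set: T3] (fun x : T3 => (x, y) : T3 * T3).
      by apply: measurable_fun_pair; [exact: measurable_id|exact: measurable_cst].
    exact: (measurableT_comp mk mp).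
  - by apply: emeasurable_funM; [exact: measurable_cst|exact: emeasurable_funD].
  - move=> x _; rewrite -EFinD -EFinM lee_fin /=.
    have -> : eucl (x - y) = eucl (y - x).
      rewrite /eucl /=; congr Num.sqrt; ring.
    rewrite /q; have c0 := chi0 x; have c1 := chi1 x; have hy := h0 y.
    have d0 := eucl_ge0 (y - x); move: (eucl (y - x)) d0 => d d0.
    have i0 : 0 <= d^-1 by rewrite invr_ge0.
    case: ifPn => [_|]; last rewrite -leNgt.
      rewrite (_ : chi x * h y / d = h y * (chi x * d^-1)); last by ring.
      rewrite ler_wpM2l//; have : chi x * d^-1 <= d^-1 by rewrite ler_piMl.
      by move: c0; move: (chi x) (d^-1) => c t; clear; lra.
    move=> d1; have d1' : 1 <= d by rewrite -(expr_ge1 (n := 2)).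
    rewrite add0r mulrC [h y * _]mulrC mulrA ler_wpM2r// ler_piMl//.
    by rewrite invf_le1// (lt_le_trans ltr01).
rewrite ge0_integralZl//; first last.
- by rewrite lee_fin.
- by move=> x _; rewrite adde_ge0.
- exact: emeasurable_funD.
rewrite ge0_integralD// inv_dist_potential muleC lee_wpmul2r ?lee_fin//.
by rewrite /kap EFinD fineK//; exact: integrable_fin_num.
Qed.

End LowerBound.

Section LowerBoundConclusion.
Context {R : realType}.
Notation T3 := (R3 (measurableTypeR R)).
Notation vol := (vol3 R).
Implicit Types (x y z : R3 R).

Lemma measurable_dist (f g : T3 -> R) : measurable_fun [set: T3] f -> measurable_fun [set: T3] g ->
  measurable_fun [set: T3] (fun x => `|f x - g x|).
Proof.
move=> mf mg; have m := measurable_funB mf mg.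
by apply: (measurableT_comp _ m).
Qed.

(** Most of the mass lies in a large ball; there, multiply an approximation in the
mean by a cut-off. *)
Lemma BV01_approximation (chi : R3 R -> R) (d : R) : BV01 chi -> 0 < d ->
  exists (L : R) (G : R3 R -> R), [/\ continuous G, forall y, 0 <= G y <= 1,
    forall y, ~ box L y -> G y = 0 & (\int[vol]_x (`|chi x - G x|)%:E <= d%:E)%E].
Proof.
move=> [chi01 ichi _] d0; have d20 : 0 < d / 2 by rewrite divr_gt0.
have chi0 x : 0 <= chi x by case: (chi01 x) => ->.
have mchi : measurable_fun [set: T3] (chi : T3 -> R).
  by have := measurable_int _ ichi => /measurable_EFinP.
pose zeta (n : nat) x := cutoff (n%:R ^+ 2) (n.+1%:R ^+ 2) (sqn x).
have nn (n : nat) : (n%:R ^+ 2 : R) < n.+1%:R ^+ 2.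
  by rewrite ltr_sqr ?nnegrE// ltr_nat.
have zc n : continuous (zeta n).
  exact: continuous_o (@continuous_cutoff R (n%:R ^+ 2) (n.+1%:R ^+ 2)) (@continuous_sqn R).
have z01 n x : 0 <= zeta n x <= 1 by exact: cutoff_bounds.
have mz n := continuous_measurable3 (zc n).
have mfE n : measurable_fun [set: T3] (fun x : T3 => (chi x * zeta n x)%:E).
  by apply/measurable_EFinP; exact: measurable_funM.
have mf : measurable_fun [set: T3] (fun x : T3 => (chi x)%:E) by apply/measurable_EFinP.
have ffE : {ae vol, forall x : T3, setT x -> (fun n => (chi x * zeta n x)%:E) @ \oo --> (chi x)%:E}.
  apply: aeW => x _; apply: cvg_near_cst; exists (Num.bound (sqn x)).+1 => // n /= bn.
  congr EFin; rewrite /zeta (cutoff_le (nn n) _).1 ?mulr1//.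
  have s1 : sqn x <= n%:R.
    apply/ltW/(lt_le_trans (archi_boundP (sqn_ge0 x))); rewrite ler_nat; exact: ltnW.
  apply: (le_trans s1); rewrite expr2 ler_peMl// ler1n; exact: leq_trans bn.
have fbd : {ae vol, forall (x : T3) n, setT x -> (`|(chi x * zeta n x)%:E| <= (EFin \o (chi : T3 -> R)) x)%E}.
  apply: aeW => x n _; have /andP[p0 p1] := z01 n x; have c0 := chi0 x.
  by rewrite /= lee_fin (ger0_norm (mulr_ge0 c0 p0)) ler_piMr.
have [_ dc _] := dominated_convergence measurableT mfE mf ffE ichi fbd.
have := dc [set u | (u < (d / 2)%:E)%E] (lt_nbhsl d20).
case=> n _ /(_ n (leqnn n)) /= /ltW fnd; clear dc.
pose A := [set x : T3 | chi x = 1].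
have mA : measurable A.
  rewrite [A](_ : _ = chi @^-1` [set 1]) // -[X in measurable X]setTI; exact: mchi.
have chiE : chi = \1_A.
  apply/funext => x; rewrite indicE; case: (chi01 x) => cx; rewrite cx.
    by rewrite memNset// /A /= cx => /eqP; rewrite eq_sym oner_eq0.
  by rewrite mem_set.
have [F [cF F01 Fd]] := measurable_approximable mA n.+1%:R d20.
have zout y : ~ box n.+1%:R y -> zeta n y = 0.
  by move=> /(sqn_box (ler0n R n.+1)) h; have [] := cutoff_ge (nn n) h.
have mB := @measurable_box R n.+1%:R.
exists n.+1%:R, (fun x => zeta n x * F x); split.
- exact: continuous_mulf (zc n) cF.
- move=> y; have /andP[a0 a1] := z01 n y; have /andP[b0 b1] := F01 y.
  by rewrite (mulr_ge0 a0 b0) mulr_ile1.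
- by move=> y /zout ->; rewrite mul0r.
have mcF := continuous_measurable3 cF.
have m1 : measurable_fun [set: T3] (fun x : T3 => (`|chi x * zeta n x - chi x|)%:E).
  by apply/measurable_EFinP; exact: measurable_dist (measurable_funM mchi (mz n)) mchi.
have m2 : measurable_fun [set: T3] (fun x : T3 => (`|chi x - F x|)%:E).
  by apply/measurable_EFinP; exact: measurable_dist.
pose g2 : T3 -> \bar R := (fun x : T3 => (`|chi x - F x|)%:E) \_ (box n.+1%:R).
have mg2 : measurable_fun [set: T3] g2.
  by apply/(measurable_restrictT _ mB); exact: measurable_funTS.
have g20 x : (0 <= g2 x)%E by rewrite /g2 patchE; case: ifP.
have pt x : (`|chi x - zeta n x * F x|%:E <= `|chi x * zeta n x - chi x|%:E + g2 x)%E.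
  rewrite /g2 patchE; case: ifPn => bx.
    rewrite -EFinD lee_fin [`|_ - chi x|]distrC.
    have -> : chi x - zeta n x * F x = (chi x - chi x * zeta n x) + zeta n x * (chi x - F x) by ring.
    apply: le_trans (ler_normD _ _) _; rewrite lerD2l normrM.
    by have /andP[a0 a1] := z01 n x; rewrite (ger0_norm a0) ler_piMl.
  have nb : ~ box n.+1%:R x by move=> h; move/negP: bx; apply; rewrite inE.
  by rewrite (zout _ nb) mul0r subr0 mulr0 sub0r normrN adde0.
apply: (@le_trans _ _ (\int[vol]_x (`|chi x * zeta n x - chi x|%:E + g2 x))%E).
  apply: ge0_le_integral.
  - exact: measurableT.
  - by move=> x _; rewrite lee_fin normr_ge0.
  - by apply/measurable_EFinP; exact: measurable_dist mchi (measurable_funM (mz n) mcF).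
  - exact: emeasurable_funD.
  - by move=> x _; exact: pt.
rewrite ge0_integralD//.
rewrite [X in (_ <= X%:E)%E](_ : d = d / 2 + d / 2); last by field.
rewrite EFinD; apply: leeD; first exact: fnd.
rewrite /g2 -integral_mkcond; move: Fd; rewrite chiE; exact.
Qed.

Lemma coulomb_le_split (chi G : R3 R -> R) : BV01 chi -> measurable_fun [set: T3] (G : T3 -> R) ->
  (forall y, 0 <= G y) ->
  (coulomb2 chi G <= coulomb chi + coulomb2 chi (fun y => (`|chi y - G y|)%R))%E.
Proof.
move=> [chi01 ichi _] mG G0.
have chi0 x : 0 <= chi x by case: (chi01 x) => ->.
have mchi : measurable_fun [set: T3] (chi : T3 -> R).
  by have := measurable_int _ ichi => /measurable_EFinP.
have mh : measurable_fun [set: T3] ((fun y => `|chi y - G y|) : T3 -> R).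
  exact: measurable_dist.
have h0 y : 0 <= `|chi y - G y| by exact: normr_ge0.
have mI1 := measurable_coulomb_inner mchi mchi chi0 chi0.
have mI2 := measurable_coulomb_inner mchi mh chi0 h0.
have mIG := measurable_coulomb_inner mchi mG chi0 G0.
have p0 (g : R3 R -> R) x y : (forall y, 0 <= g y) -> (0 <= (chi x * g y / eucl (x - y))%:E)%E.
  by move=> g0; rewrite lee_fin divr_ge0 ?mulr_ge0// eucl_ge0.
have i0 (g : R3 R -> R) x : (forall y, 0 <= g y) ->
    (0 <= \int[vol]_y (chi x * g y / eucl (x - y))%:E)%E.
  by move=> g0; apply: integral_ge0 => y _; exact: p0.
have mk (g : R3 R -> R) x : measurable_fun [set: T3] (g : T3 -> R) ->
    measurable_fun [set: T3] (fun y : T3 => (chi x * g y / eucl (x - y))%:E).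
  move=> mg; apply/measurable_EFinP; apply: measurable_funM; last exact: measurable_inv_dist.
  by apply: measurable_funM => //; exact: measurable_cst.
have -> : (coulomb chi + coulomb2 chi (fun y => (`|chi y - G y|)%R) = \int[vol]_x
    (\int[vol]_y (chi x * chi y / eucl (x - y))%:E +
     \int[vol]_y (chi x * `|chi y - G y| / eucl (x - y))%:E))%E.
  apply/esym; apply: ge0_integralD => //.
  - by move=> x _; exact: i0.
  - by move=> x _; exact: i0.
apply: ge0_le_integral.
- exact: measurableT.
- by move=> x _; exact: i0.
- exact: mIG.
- exact: emeasurable_funD mI1 mI2.
move=> x _.
pose h y := `|chi y - G y|.
have k1 y : [set: T3] y -> (0 <= (chi x * chi y / eucl (x - y))%:E)%E by move=> _; exact: (p0 chi x y chi0).
have k2 y : [set: T3] y -> (0 <= (chi x * h y / eucl (x - y))%:E)%E by move=> _; exact: (p0 h x y h0).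
have m1 := mk chi x mchi; have m2 := mk h x mh.
have -> : (\int[vol]_y (chi x * chi y / eucl (x - y))%:E + \int[vol]_y (chi x * h y / eucl (x - y))%:E =
    \int[vol]_y ((chi x * chi y / eucl (x - y))%:E + (chi x * h y / eucl (x - y))%:E))%E.
  by apply/esym; apply: ge0_integralD.
apply: ge0_le_integral.
- exact: measurableT.
- by move=> y _; exact: (p0 G x y G0).
- exact: (mk G x mG).
- exact: emeasurable_funD m1 m2.
move=> y _; rewrite -EFinD lee_fin -mulrDl -mulrDr.
apply: ler_wpM2r; first by rewrite invr_ge0 eucl_ge0.
apply: ler_wpM2l; first exact: chi0.
by have := ler_norm (G y - chi y); rewrite /h distrC; lra.
Qed.

(** Let [G] tend to [chi] in [mollified_lower_bound]. *)
Lemma isoperimetric_coulomb (chi : R3 R -> R) (r : R) : 0 < r -> BV01 chi ->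
  ((4 * pi * \int[vol]_x chi x)%:E <=
    (28 / 45 * pi * r)%:E * TV3 chi + (4 / r ^+ 2)%:E * coulomb chi)%E.
Proof.
move=> r0 bchi; have [chi01 ichi _] := bchi.
have chi0 x : 0 <= chi x by case: (chi01 x) => ->.
have mchi : measurable_fun [set: T3] (chi : T3 -> R).
  by have := measurable_int _ ichi => /measurable_EFinP.
pose V := \int[vol]_x chi x; pose K := 2 * pi + V.
have V0 : 0 <= V by apply: Rintegral_ge0.
have pp : 0 <= 2 * pi :> R by rewrite mulr_ge0 ?pi_ge0.
have K0 : 0 <= K := addr_ge0 pp V0.
pose B := 4 * pi + 4 / r ^+ 2 * K.
have q0 : 0 <= 4 / r ^+ 2 by rewrite divr_ge0 ?sqr_ge0.
have p4 : 0 <= 4 * pi :> R by rewrite mulr_ge0 ?pi_ge0.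
have B0 : 0 <= B := addr_ge0 p4 (mulr_ge0 q0 K0).
apply/lee_addgt0Pr => eps eps0.
pose d := eps / (B + 1); have B1 : 0 < B + 1 by rewrite ltr_wpDl.
have d0 : 0 < d by rewrite divr_gt0.
have dB : d * B <= eps.
  by rewrite /d mulrAC ler_pdivrMr// ler_wpM2l ?(ltW eps0)// lerDl.
have [L [G [cG G01 GL Gd]]] := BV01_approximation bchi d0.
have G0 y : 0 <= G y by case/andP: (G01 y).
have mG := continuous_measurable3 cG.
have mh : measurable_fun [set: T3] ((fun y => `|chi y - G y|) : T3 -> R).
  exact: measurable_dist.
have h0 y : 0 <= `|chi y - G y| by exact: normr_ge0.
have D1 : (coulomb2 chi G <= coulomb chi + (K * d)%:E)%E.
  apply: le_trans (coulomb_le_split bchi mG G0) _; apply: leeD => //.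
  apply: le_trans (coulomb2_le bchi mh h0) _; rewrite EFinM; apply: lee_wpmul2l => //.
have mass_le : V - d <= \int[vol]_x (chi x * G x).
  have i1 : vol.-integrable setT (EFin \o (fun x : T3 => chi x * G x)).
    apply: (le_integrable measurableT _ _ ichi).
      by apply/measurable_EFinP; exact: measurable_funM.
    move=> x _ /=; rewrite lee_fin normrM ler_piMr// ger0_norm//.
    by case/andP: (G01 x).
  have ih : vol.-integrable setT (EFin \o ((fun y => `|chi y - G y|) : T3 -> R)).
    apply/integrableP; split; first by apply/measurable_EFinP.
    apply: (@le_lt_trans _ _ d%:E); last exact: ltry.
    apply: le_trans Gd; rewrite le_eqVlt; apply/orP; left; apply/eqP.
    by apply: eq_integral => x _; rewrite /= normr_id.
  rewrite lerBlDr; apply: (@le_trans _ _ (\int[vol]_x (chi x * G x) + \int[vol]_x `|chi x - G x|)).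
    rewrite -RintegralD//; apply: le_Rintegral => //.
      exact: (integrableD measurableT i1 ih).
    move=> x _; case: (chi01 x) => ->; rewrite ?mul0r ?mul1r ?add0r ?normr_ge0//.
    by have := ler_norm (1 - G x); lra.
  by rewrite lerD2l -lee_fin fineK//; exact: integrable_fin_num ih.
have main := mollified_lower_bound r0 bchi cG G01 GL.
apply: (@le_trans _ _ ((4 * pi * \int[vol]_x (chi x * G x))%:E + (4 * pi * d)%:E)%E).
  rewrite -EFinD lee_fin -mulrDr; apply: (ler_wpM2l p4).
  by move: mass_le; rewrite -/V; lra.
apply: (@le_trans _ _ (((28 / 45 * pi * r)%:E * TV3 chi + (4 / r ^+ 2)%:E * coulomb2 chi G) + (4 * pi * d)%:E)%E).
  exact: leeD.
have c0 : (0 <= coulomb chi)%E.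
  apply: integral_ge0 => x _; apply: integral_ge0 => y _.
  by rewrite lee_fin divr_ge0 ?mulr_ge0// eucl_ge0.
clear main; move: D1 c0; move: (coulomb chi) (coulomb2 chi G) ((28 / 45 * pi * r)%:E * TV3 chi)%E => D DG P D1 D0.
rewrite -!addeA; apply: leeD; first exact: lexx.
apply: (@le_trans _ _ (((4 / r ^+ 2)%:E * (D + (K * d)%:E)) + (4 * pi * d)%:E)%E).
  by apply: leeD => //; apply: lee_wpmul2l.
have Kd0 : (0 <= (K * d)%:E)%E by rewrite lee_fin; exact: mulr_ge0 K0 (ltW d0).
rewrite (ge0_muleDr _ D0 Kd0) -addeA; apply: leeD; first exact: lexx.
rewrite -EFinM -EFinD lee_fin; move: dB; rewrite /B.
by rewrite (_ : d * (4 * pi + 4 / r ^+ 2 * K) = 4 / r ^+ 2 * (K * d) + 4 * pi * d); last ring.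
Qed.

(** With [r = 45/(7 Q)] the inequality of [isoperimetric_coulomb] reads
[Q V <= P + 49/2025 Q^3 D / pi], and [49/2025 * 243/64 <= 1/8]. *)
Lemma f_star_ge (Q : R) : 0 < Q -> Q ^+ 3 = 243 / 64 -> (Q%:E <= f_star R)%E.
Proof.
move=> Q0 Q3; apply: le_ereal_inf_tmp => _ [chi [bchi m0] <-].
have [chi01 ichi TVfin] := bchi.
have chi0 x : 0 <= chi x by case: (chi01 x) => ->.
have mE : mass chi = (\int[vol]_x chi x)%:E.
  by rewrite /mass fineK//; exact: integrable_fin_num ichi.
pose V := \int[vol]_x chi x.
have V0 : 0 < V by move: m0; rewrite mE lte_fin.
pose r := 45 / (7 * Q); have r0 : 0 < r by rewrite divr_gt0// mulr_gt0.
have := isoperimetric_coulomb r0 bchi.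
have c0 : (0 <= coulomb chi)%E.
  apply: integral_ge0 => x _; apply: integral_ge0 => y _.
  by rewrite lee_fin divr_ge0 ?mulr_ge0// eucl_ge0.
rewrite mE -/V /E_infty inver gt_eqF// lee_pdivlMr//.
have c28 : 0 < 28 / 45 :> R by lra.
have C0 : 0 < 28 / 45 * pi * r := mulr_gt0 (mulr_gt0 c28 (pi_gt0 R)) r0.
have q0 : 0 < 4 / r ^+ 2 by rewrite divr_gt0 ?exprn_gt0.
have p0 := pi_gt0 R.
have i8 : 0 < (8 * pi)^-1 :> R by rewrite invr_gt0 mulr_gt0.
move: TVfin c0; case: (TV3 chi) => [p| |] //.
  move=> _; case: (coulomb chi) => [D| |] //.
    rewrite -!EFinM -!EFinD !lee_fin => D0 h.
    have k0 : 0 < Q / (4 * pi) by rewrite divr_gt0// mulr_gt0.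
    have := ler_wpM2l (ltW k0) h.
    have pn : (pi : R) != 0 by rewrite gt_eqF.
    have Qn : Q != 0 by rewrite gt_eqF.
    have e1 (t v : R) : t != 0 -> Q / (4 * t) * (4 * t * v) = Q * v.
      by move=> tn; field.
    have e2 (t : R) : t != 0 -> Q / (4 * t) * (28 / 45 * t * r * p + 4 / r ^+ 2 * D) =
        p + 49 / 2025 * Q ^+ 3 * (t^-1 * D).
      by move=> tn; rewrite /r; field; rewrite ?Qn ?tn.
    rewrite (e1 _ _ pn) (e2 _ pn).
    move/le_trans; apply; rewrite Q3 lerD2l invfM -(mulrA 8^-1 (pi^-1)).
    have : 0 <= pi^-1 * D by rewrite mulr_ge0// invr_ge0 ltW.
    by move: (pi^-1 * D) => t; clear; lra.
  by move=> _ _; rewrite gt0_muley ?lte_fin// addey// leey.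
by rewrite gt0_muleNy ?lte_fin.
Qed.

Lemma lambda_c_lower : ((3 / (4 * 2 `^ (3^-1)))%:E <= lambda_c R)%E.
Proof.
rewrite /lambda_c prefactorE.
pose Q : R := (243 / 64) `^ (3^-1).
have Q0 : 0 < Q by rewrite powR_gt0// divr_gt0.
have Q3 : Q ^+ 3 = 243 / 64.
  by rewrite /Q -powR_mulrn ?powR_ge0// -powRrM mulVf// powRr1// divr_ge0.
have -> : 3 / (4 * 2 `^ (3^-1)) = 18 `^ (- 3^-1) * Q.
  have t0 : 2 `^ (3^-1) != 0 :> R by rewrite gt_eqF// powR_gt0.
  apply: (@mulIf _ (2 `^ (3^-1) * 18 `^ (3^-1))).
    by rewrite mulf_neq0// gt_eqF// powR_gt0.
  have e18 : 18 `^ (3^-1) != 0 :> R by rewrite gt_eqF// powR_gt0.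
  transitivity (3 / 4 * 18 `^ (3^-1) : R); first by field.
  transitivity (2 `^ (3^-1) * Q); last by rewrite powRN; field.
  rewrite /Q -powRM ?divr_ge0//.
  have -> : 2 * (243 / 64) = (3 / 4) `^ 3 * 18 :> R.
    by rewrite (powR_mulrn 3) ?divr_ge0//; field.
  by rewrite powRM ?powR_ge0// -powRrM divff ?powRr1 ?divr_ge0.
rewrite EFinM; apply: lee_wpmul2l; first by rewrite lee_fin powR_ge0.
exact: f_star_ge.
Qed.

End LowerBoundConclusion.

Theorem theorem1p2 (R : realType) :
  ((3 / (4 * 2 `^ (3^-1)))%:E <= lambda_c R)%E /\
  (lambda_c R <= (3 / (2 * 5 `^ (3^-1)))%:E)%E.
Proof. by split; [exact: lambda_c_lower|exact: lambda_c_upper]. Qed.
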